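(* (i) Let $n\geq 4$. Every deformation of (the coordinate algebra of) a Kleinian singularity of type $D_n$ that is not commutative is isomorphic as a filtered algebra to $D(q)$ for some polynomial $q\in\mathbb{C}[x]$ of degree $n$. (ii) Let $n\geq 5$ and let $q,q'\in\mathbb{C}[x]$ be two polynomials of degree $n$. Then $D(q)\cong D(q')$ as filtered algebras if and only if there exists a nonzero scalar $\theta\in\mathbb{C}$ such that $q'(x)q'(-x-1)=\theta^2 q(x)q(-x-1)$.
   Context: All algebras are over $\mathbb{C}$. For $n\ge 4$, the coordinate algebra of a Kleinian singularity of type $D_n$ is $\mathbb{C}[u,v,w]/((-1)^n u^{n-1}-uv^2+w^2)$, graded by putting $u,v,w$ in degrees $4$, $2n-4$, $2n-2$. A deformation of it is an (associative, unital) filtered algebra $F_0\subseteq F_1\subseteq\cdots$ (exhaustive) whose associated graded algebra is isomorphic, as a graded algebra, to this coordinate algebra. Definition of $D(q)$: let $q(x)\in\mathbb{C}[x]$ have degree $n\ge 4$. Put $\rho:=2q(-\tfrac12)$ and $s(x):=\dfrac{q(x)q(-x-1)}{x(x+1)(1+2x)^2}$. Let $G=\langle a\rangle$ be infinite cyclic and $\mathbb{C}(h)$ the field of rational functions in an indeterminate $h$. Let $\tilde T(s)$ be the skew group algebra $G\ast\mathbb{C}(h)$, i.e. the vector space $\mathbb{C}G\otimes\mathbb{C}(h)$ with multiplication $(a^i\, f(h))(a^j\, g(h))=a^{i+j}f(h+j)g(h)$, and put $b:=s(h)a^{-1}$. Then $D(q)$ is the subalgebra of $\tilde T(s)$ generated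 by $$u:=h^2,\qquad v:=a+b+\frac{2\rho}{1-4h^2},\qquad w:=(a-b)h-\frac{\rho}{1-4h^2}.$$ $D(q)$ is regarded as a filtered algebra by putting $u,v,w$ in degrees $4$, $2n-4$, $2n-2$ respectively. *)

(* Defs.v *)
From HB Require Import structures.
From mathcomp Require Import all_boot all_order all_algebra.
From mathcomp Require Import boolp reals.
From mathcomp Require Import finmap.
From mathcomp Require Import -(notations) monalg.
From mathcomp Require Import mpoly.
From mathcomp.real_closed Require Import complex.

Set Implicit Arguments.
Unset Strict Implicit.
Unset Printing Implicit Defensive.

Import GRing.Theory.
Local Open Scope ring_scope.

Local Notation "x %:F" := (@FracField.tofrac _ x).

Section Algebras.
Variable C : fieldType.

Record filtAlg := FiltAlg {
  filt_sort :> algType C;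
  filt : nat -> filt_sort -> Prop;
  filt0 : forall k, filt k 0;
  filtP : forall k (c : C) x y, filt k x -> filt k y -> filt k (c *: x + y);
  filt1 : filt 0 1;
  filtM : forall i j x y, filt i x -> filt j y -> filt (i + j) (x * y);
  filtS : forall k x, filt k x -> filt k.+1 x;
  filt_exhaustive : forall x, exists k, filt k x
}.

Definition filtered_iso (A B : filtAlg) : Prop :=
  exists f : {lrmorphism A -> B},
    bijective f /\ forall k x, filt k x <-> filt k (f x).

(* A grading of an algebra is given by the family of its homogeneous
   components. *)
Definition graded_iso (A B : algType C)
    (gA : nat -> A -> Prop) (gB : nat -> B -> Prop) : Prop :=
  exists f : {lrmorphism A -> B},
    bijective f /\ forall k x, gA k x <-> gB k (f x).

Section Subalgebra.
Variable A : algType C.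

Record subalgebra := Subalgebra {
  subalgebra_mem : A -> Prop;
  subalgebra1 : subalgebra_mem 1;
  subalgebraP : forall (c : C) x y,
    subalgebra_mem x -> subalgebra_mem y -> subalgebra_mem (c *: x + y);
  subalgebraM : forall x y,
    subalgebra_mem x -> subalgebra_mem y -> subalgebra_mem (x * y)
}.

Variable S : subalgebra.

Definition subalgebra_pred : pred A := fun x => `[< subalgebra_mem S x >].

Lemma subalgebra_closed : GRing.subalg_closed subalgebra_pred.
Proof.
split=> [|c x y /asboolP xS /asboolP yS|x y /asboolP xS /asboolP yS];
  apply/asboolP; [exact: subalgebra1 | exact: subalgebraP | exact: subalgebraM].
Qed.

HB.instance Definition _ := GRing.isSubalgClosed.Build C A subalgebra_pred
  (GRing.subalg_closed_semi subalgebra_closed).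

Record subalg := Subalg { subalg_val : A; _ : subalg_val \in subalgebra_pred }.

HB.instance Definition _ := [isSub for subalg_val].
HB.instance Definition _ := [Choice of subalg by <:].
HB.instance Definition _ :=
  [SubChoice_isSubAlgebra of subalg by <:].

Lemma subalg_valB : {morph subalg_val : x y / x - y}.
Proof. exact: (raddfB (val : subalg -> A)). Qed.

Lemma subalg_valM : {morph subalg_val : x y / x * y}.
Proof. exact: (rmorphM (val : subalg -> A)). Qed.

End Subalgebra.

Section Quotient.
Variable A : algType C.

Record ideal := Ideal {
  ideal_mem : A -> Prop;
  ideal0 : ideal_mem 0;
  idealB : forall x y, ideal_mem x -> ideal_mem y -> ideal_mem (x - y);
  idealMl : forall x y, ideal_mem y -> ideal_mem (x * y);
  idealMr : forall x y, ideal_mem x -> ideal_mem (x * y);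
  ideal_proper : ~ ideal_mem 1
}.

Variable I : ideal.

Definition ideal_pred : pred A := fun x => `[< ideal_mem I x >].

Lemma ideal_zmod_closed : zmod_closed ideal_pred.
Proof.
split=> [|x y /asboolP xI /asboolP yI]; apply/asboolP;
  [exact: ideal0 | exact: idealB].
Qed.

HB.instance Definition _ := GRing.isZmodClosed.Build A ideal_pred
  ideal_zmod_closed.

Definition ideal_zmod : zmodClosed A := GRing.ZmodClosed.clone A ideal_pred _.

Definition quotalg := Quotient.quot ideal_zmod.

HB.instance Definition _ := GRing.Zmodule.on quotalg.
HB.instance Definition _ := EqQuotient.on quotalg.

Definition quot_pi (x : A) : quotalg := \pi_(quotalg)%qT x.

Definition quot_repr (x : quotalg) : A := generic_quotient.repr x.

Lemma quot_reprK x : quot_pi (quot_repr x) = x.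
Proof. exact: generic_quotient.reprK. Qed.

Lemma quot_piE x y : quot_pi x = quot_pi y <-> ideal_mem I (x - y).
Proof.
have := Quotient.idealrBE ideal_zmod x y; rewrite /quot_pi => e.
split=> [/eqP xy|/asboolP xy]; first by apply/asboolP; rewrite -e in xy.
by apply/eqP; rewrite -e.
Qed.

Lemma quot_piB : zmod_morphism quot_pi.
Proof. by move=> x y; rewrite /quot_pi raddfB. Qed.

HB.instance Definition _ := GRing.isZmodMorphism.Build A quotalg quot_pi
  quot_piB.

Definition quot_one : quotalg := quot_pi 1.

Definition quot_mul (x y : quotalg) : quotalg :=
  quot_pi (quot_repr x * quot_repr y).

Definition quot_scale (c : C) (x : quotalg) : quotalg :=
  quot_pi (c *: quot_repr x).

Lemma quot_reprE x : ideal_mem I (quot_repr (quot_pi x) - x).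
Proof. by apply/quot_piE; rewrite quot_reprK. Qed.

Lemma idealD x y : ideal_mem I x -> ideal_mem I y -> ideal_mem I (x + y).
Proof.
move=> xI yI; rewrite -[y]opprK; apply: idealB => //.
by rewrite -[- y]sub0r; apply: idealB => //; apply: ideal0.
Qed.

Lemma idealZ c x : ideal_mem I x -> ideal_mem I (c *: x).
Proof. by move=> xI; rewrite -mulr_algl; apply: idealMl. Qed.

Lemma quot_piM x y : quot_mul (quot_pi x) (quot_pi y) = quot_pi (x * y).
Proof.
apply/quot_piE; set x' := quot_repr _; set y' := quot_repr _.
have -> : x' * y' - x * y = x' * (y' - y) + (x' - x) * y.
  by rewrite mulrBr mulrBl addrA subrK.
by apply: idealD; [apply: idealMl | apply: idealMr]; apply: quot_reprE.
Qed.

Lemma quot_piZ c x : quot_scale c (quot_pi x) = quot_pi (c *: x).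
Proof. by apply/quot_piE; rewrite -scalerBr; apply/idealZ/quot_reprE. Qed.

Lemma quotW (P : quotalg -> Prop) : (forall x, P (quot_pi x)) -> forall x, P x.
Proof. by move=> h x; rewrite -[x]quot_reprK. Qed.

Lemma quot_mulA : associative quot_mul.
Proof.
elim/quotW=> x; elim/quotW=> y; elim/quotW=> z.
by rewrite !quot_piM mulrA.
Qed.

Lemma quot_mul1 : left_id quot_one quot_mul.
Proof. by elim/quotW=> x; rewrite quot_piM mul1r. Qed.

Lemma quot_mulr1 : right_id quot_one quot_mul.
Proof. by elim/quotW=> x; rewrite quot_piM mulr1. Qed.

Lemma quot_mulDl : left_distributive quot_mul +%R.
Proof.
elim/quotW=> x; elim/quotW=> y; elim/quotW=> z.
by rewrite -raddfD !quot_piM mulrDl raddfD.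
Qed.

Lemma quot_mulDr : right_distributive quot_mul +%R.
Proof.
elim/quotW=> x; elim/quotW=> y; elim/quotW=> z.
by rewrite -raddfD !quot_piM mulrDr raddfD.
Qed.

Lemma quot_one_neq0 : quot_one != 0.
Proof.
apply/eqP; rewrite -(raddf0 quot_pi) => /quot_piE.
by rewrite subr0; apply: ideal_proper.
Qed.

HB.instance Definition _ := GRing.Zmodule_isNzRing.Build quotalg
  quot_mulA quot_mul1 quot_mulr1 quot_mulDl quot_mulDr quot_one_neq0.

Lemma quot_scaleA c d x : quot_scale c (quot_scale d x) = quot_scale (c * d) x.
Proof. by elim/quotW: x => x; rewrite !quot_piZ scalerA. Qed.

Lemma quot_scale1 : left_id 1 quot_scale.
Proof. by elim/quotW=> x; rewrite quot_piZ scale1r. Qed.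

Lemma quot_scaleDr : right_distributive quot_scale +%R.
Proof.
move=> c; elim/quotW=> x; elim/quotW=> y.
by rewrite -raddfD !quot_piZ scalerDr raddfD.
Qed.

Lemma quot_scaleDl x : {morph quot_scale^~ x : c d / c + d}.
Proof. by elim/quotW: x => x c d; rewrite !quot_piZ scalerDl raddfD. Qed.

HB.instance Definition _ := GRing.Zmodule_isLmodule.Build C quotalg
  quot_scaleA quot_scale1 quot_scaleDr quot_scaleDl.

Lemma quot_scaleAl (c : C) (x y : quotalg) : c *: (x * y) = (c *: x) * y.
Proof.
elim/quotW: x => x; elim/quotW: y => y.
change (quot_scale c (quot_mul (quot_pi x) (quot_pi y)) =
        quot_mul (quot_scale c (quot_pi x)) (quot_pi y)).
by rewrite !(quot_piM, quot_piZ) scalerAl.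
Qed.

HB.instance Definition _ := GRing.Lmodule_isLalgebra.Build C quotalg
  quot_scaleAl.

Lemma quot_scaleAr (c : C) (x y : quotalg) : c *: (x * y) = x * (c *: y).
Proof.
elim/quotW: x => x; elim/quotW: y => y.
change (quot_scale c (quot_mul (quot_pi x) (quot_pi y)) =
        quot_mul (quot_pi x) (quot_scale c (quot_pi y))).
by rewrite !(quot_piM, quot_piZ) scalerAr.
Qed.

HB.instance Definition _ := GRing.Lalgebra_isAlgebra.Build C quotalg
  quot_scaleAr.

End Quotient.

Section PolyAlgebra.
Variable A : algType C.

Definition polyalg := {poly A}.
HB.instance Definition _ := GRing.NzRing.on polyalg.

Definition polyalg_scale (c : C) (p : polyalg) : polyalg :=
  (c%:A : A) *: (p : {poly A}).

Lemma polyalg_scaleA c d p :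
  polyalg_scale c (polyalg_scale d p) = polyalg_scale (c * d) p.
Proof. by rewrite /polyalg_scale scalerA -scalerAl mul1r scalerA. Qed.

Lemma polyalg_scale1 : left_id 1 polyalg_scale.
Proof. by move=> p; rewrite /polyalg_scale !scale1r. Qed.

Lemma polyalg_scaleDr : right_distributive polyalg_scale +%R.
Proof. by move=> c p q; rewrite /polyalg_scale scalerDr. Qed.

Lemma polyalg_scaleDl p : {morph polyalg_scale^~ p : c d / c + d}.
Proof. by move=> c d; rewrite /polyalg_scale !scalerDl. Qed.

HB.instance Definition _ := GRing.Zmodule_isLmodule.Build C polyalg
  polyalg_scaleA polyalg_scale1 polyalg_scaleDr polyalg_scaleDl.

Lemma coef_polyalgZ (c : C) (p : polyalg) i :
  (c *: p : polyalg)`_i = c *: (p`_i : A).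
Proof. by rewrite [LHS]coefZ -scalerAl mul1r. Qed.

Lemma polyalg_scaleAl (c : C) (p q : polyalg) : c *: (p * q) = (c *: p) * q.
Proof. exact: scalerAl. Qed.

HB.instance Definition _ := GRing.Lmodule_isLalgebra.Build C polyalg
  polyalg_scaleAl.

Lemma polyalg_scaleAr (c : C) (p q : polyalg) : c *: (p * q) = p * (c *: q).
Proof.
apply/polyP => i; rewrite coef_polyalgZ !coefM scaler_sumr.
by apply: eq_bigr => j _; rewrite coef_polyalgZ scalerAr.
Qed.

HB.instance Definition _ := GRing.Lalgebra_isAlgebra.Build C polyalg
  polyalg_scaleAr.

End PolyAlgebra.

Section AssociatedGraded.
Variable A : filtAlg.

(* The convention is that F_(-1) = 0. *)
Definition filt_pred (k : nat) (x : A) : Prop :=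
  if k is j.+1 then filt j x else x = 0.

Lemma filtD k (x y : A) : filt k x -> filt k y -> filt k (x + y).
Proof. by move=> xk yk; rewrite -[x]scale1r; apply: filtP. Qed.

Lemma filt_sum k (I : Type) (r : seq I) (P : pred I) (F : I -> A) :
  (forall i, P i -> filt k (F i)) -> filt k (\sum_(i <- r | P i) F i).
Proof. by move=> h; elim/big_ind: _ => //; [exact: filt0 | exact: filtD]. Qed.

Lemma filt_pred0 k : filt_pred k 0.
Proof. by case: k => //= k; apply: filt0. Qed.

Lemma filt_predP k (c : C) x y :
  filt_pred k x -> filt_pred k y -> filt_pred k (c *: x + y).
Proof.
by case: k => [|k] /=; [move=> -> ->; rewrite scaler0 addr0 | apply: filtP].
Qed.

Lemma filt_pred_sum k (I : Type) (r : seq I) (P : pred I) (F : I -> A) :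
  (forall i, P i -> filt_pred k (F i)) ->
  filt_pred k (\sum_(i <- r | P i) F i).
Proof.
move=> h; elim/big_ind: _ => //; first exact: filt_pred0.
by move=> x y xk yk; rewrite -[x]scale1r; apply: filt_predP.
Qed.

Lemma filt_predMl i j x y :
  filt i x -> filt_pred j y -> filt_pred (i + j) (x * y).
Proof.
case: j => [|j] /= xi; first by move=> ->; rewrite mulr0; apply: filt_pred0.
by move=> yj; rewrite addnS /=; apply: filtM.
Qed.

Lemma filt_predMr i j x y :
  filt_pred i x -> filt j y -> filt_pred (i + j) (x * y).
Proof.
case: i => [|i] /=; first by move=> -> _; rewrite mul0r; apply: filt_pred0.
by move=> xi yj; apply: filtM.
Qed.

Definition rees_mem (p : polyalg A) : Prop := forall k, filt k (p`_k : A).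

Lemma rees1 : rees_mem 1.
Proof. by case=> [|k]; rewrite coef1; [exact: filt1 | exact: filt0]. Qed.

Lemma reesP (c : C) p q : rees_mem p -> rees_mem q -> rees_mem (c *: p + q).
Proof. by move=> hp hq k; rewrite coefD coef_polyalgZ; apply: filtP. Qed.

Lemma reesM p q : rees_mem p -> rees_mem q -> rees_mem (p * q).
Proof.
move=> hp hq k; rewrite coefM; apply: filt_sum => j _.
by rewrite -[X in filt X](subnKC (leq_ord j)); apply: filtM.
Qed.

(* The Rees algebra, i.e. the sum of the F_k t^k inside A[t]; it is the direct
   sum of the F_k with its convolution product. *)
Definition rees_subalgebra := Subalgebra rees1 reesP reesM.
Definition rees := subalg rees_subalgebra.

Definition gr_ideal_mem (p : rees) : Prop :=
  forall k, filt_pred k ((subalg_val p)`_k : A).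

Lemma rees_filt (p : rees) k : filt k ((subalg_val p)`_k : A).
Proof. by case: p => p /= /asboolP; apply. Qed.

Lemma gr_ideal0 : gr_ideal_mem 0.
Proof. by move=> k; rewrite [subalg_val _]/= coef0; apply: filt_pred0. Qed.

Lemma gr_idealB p q :
  gr_ideal_mem p -> gr_ideal_mem q -> gr_ideal_mem (p - q).
Proof.
move=> hp hq k; rewrite subalg_valB coefB.
by rewrite addrC -scaleN1r; apply: filt_predP.
Qed.

Lemma gr_idealMl p q : gr_ideal_mem q -> gr_ideal_mem (p * q).
Proof.
move=> hq k; rewrite subalg_valM coefM.
apply: filt_pred_sum => j _; rewrite -[X in filt_pred X](subnKC (leq_ord j)).
by apply: filt_predMl => //; apply: rees_filt.
Qed.

Lemma gr_idealMr p q : gr_ideal_mem p -> gr_ideal_mem (p * q).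
Proof.
move=> hp k; rewrite subalg_valM coefM.
apply: filt_pred_sum => j _; rewrite -[X in filt_pred X](subnKC (leq_ord j)).
by apply: filt_predMr => //; apply: rees_filt.
Qed.

Lemma gr_ideal_proper : ~ gr_ideal_mem 1.
Proof. by move/(_ 0); rewrite /= coef1 => /eqP; rewrite oner_eq0. Qed.

Definition gr_ideal :=
  Ideal gr_ideal0 gr_idealB gr_idealMl gr_idealMr gr_ideal_proper.

(* gr A is the direct sum of the F_k modulo the direct sum of the F_(k-1). *)
Definition gr : algType C := quotalg gr_ideal.

Definition gr_comp (k : nat) (z : gr) : Prop :=
  exists p : rees, z = quot_pi gr_ideal p /\
    forall i, i != k -> (subalg_val p)`_i = 0 :> A.

End AssociatedGraded.

(* The indices 0, 1, 2 stand for u, v, w. *)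
Definition D_degree (n : nat) (i : 'I_3) : nat :=
  nth 0%N [:: 4; 2 * n - 4; 2 * n - 2]%N i.

Section Kleinian.
Variable n : nat.

Definition kleinian_rel : {mpoly C[3]} :=
  let u : {mpoly C[3]} := 'X_0 in
  let v : {mpoly C[3]} := 'X_1 in
  let w : {mpoly C[3]} := 'X_2 in
  (-1) ^+ n * u ^+ n.-1 - u * v ^+ 2 + w ^+ 2.

Definition kleinian_ideal_mem (p : {mpoly C[3]}) : Prop :=
  exists g, p = g * kleinian_rel.

Lemma kleinian_ideal0 : kleinian_ideal_mem 0.
Proof. by exists 0; rewrite mul0r. Qed.

Lemma kleinian_idealB p q : kleinian_ideal_mem p -> kleinian_ideal_mem q ->
  kleinian_ideal_mem (p - q).
Proof. by move=> [g ->] [h ->]; exists (g - h); rewrite mulrBl. Qed.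

Lemma kleinian_idealMl p q :
  kleinian_ideal_mem q -> kleinian_ideal_mem (p * q).
Proof. by move=> [g ->]; exists (p * g); rewrite mulrA. Qed.

Lemma kleinian_idealMr p q :
  kleinian_ideal_mem p -> kleinian_ideal_mem (p * q).
Proof. by move=> [g ->]; exists (g * q); rewrite mulrAC. Qed.

Lemma kleinian_ideal_proper : ~ kleinian_ideal_mem 1.
Proof.
case=> g /(congr1 (meval (nth 0 [:: 1; (~~ odd n)%:R; (odd n)%:R]))).
rewrite meval1 mevalM /kleinian_rel; cbv zeta.
rewrite mevalD mevalB !mevalM !(rmorphXn (meval _)) rmorphN1 /= !mevalXU /=.
rewrite -signr_odd expr1n mulr1 mul1r; case: (odd n) => /=.
  by rewrite expr1 mul0r subr0 mul1r addNr mulr0 => /eqP; rewrite oner_eq0.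
by rewrite expr0 mul0r addr0 mul1r subrr mulr0 => /eqP; rewrite oner_eq0.
Qed.

Definition kleinian_ideal : ideal {mpoly C[3]} :=
  Ideal kleinian_ideal0 kleinian_idealB kleinian_idealMl kleinian_idealMr
    kleinian_ideal_proper.

Definition kleinian : algType C := quotalg kleinian_ideal.

Definition kleinian_comp (k : nat) (z : kleinian) : Prop :=
  exists p : {mpoly C[3]}, z = quot_pi kleinian_ideal p /\
    forall m, m \in msupp p -> (\sum_(i < 3) m i * D_degree n i)%N = k.

End Kleinian.

Definition deformation (n : nat) (A : filtAlg) : Prop :=
  graded_iso (@gr_comp A) (@kleinian_comp n).

Section Generated.
Variables (A : algType C) (m : nat) (g : 'I_m -> A) (d : 'I_m -> nat).

(* The span of the monomials g_(i_1) ... g_(i_l) for which W [:: i_1; ...; i_l]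
   holds. *)
Definition word_span (W : pred (seq 'I_m)) (x : A) : Prop :=
  exists r : seq (C * seq 'I_m),
    all (fun cs => W cs.2) r /\
    x = \sum_(cs <- r) cs.1 *: \prod_(i <- cs.2) g i.

Definition word_degree (s : seq 'I_m) : nat := \sum_(i <- s) d i.

Lemma word_span0 W : word_span W 0.
Proof. by exists [::]; rewrite big_nil. Qed.

Lemma word_spanP W (c : C) x y :
  word_span W x -> word_span W y -> word_span W (c *: x + y).
Proof.
move=> [r [Wr ->]] [r' [Wr' ->]].
exists ([seq (c * cs.1, cs.2) | cs <- r] ++ r'); split.
  by rewrite all_cat Wr' andbT all_map.
rewrite big_cat big_map scaler_sumr; congr (_ + _).
by apply: eq_bigr => cs _; rewrite scalerA.
Qed.

Lemma word_span1 (W : pred (seq 'I_m)) : W [::] -> word_span W 1.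
Proof.
by move=> W0; exists [:: (1, [::])]; rewrite /= W0 big_seq1 big_nil scale1r.
Qed.

Lemma word_spanM (W1 W2 W : pred (seq 'I_m)) :
  (forall s t, W1 s -> W2 t -> W (s ++ t)) ->
  forall x y, word_span W1 x -> word_span W2 y -> word_span W (x * y).
Proof.
move=> hW _ _ [r [Wr ->]] [r' [Wr' ->]].
exists [seq (cs.1 * ct.1, cs.2 ++ ct.2) | cs <- r, ct <- r']; split.
  apply/allP => _ /allpairsP[[cs ct] [/= csr ctr ->]] /=.
  by apply: hW; [exact: (allP Wr) | exact: (allP Wr')].
rewrite big_allpairs_dep mulr_suml; apply: eq_bigr => cs _.
rewrite mulr_sumr; apply: eq_bigr => ct _ /=.
by rewrite -scalerAl -scalerAr scalerA big_cat.
Qed.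

Lemma word_spanW (W W' : pred (seq 'I_m)) x :
  (forall s, W s -> W' s) -> word_span W x -> word_span W' x.
Proof. by move=> h [r [Wr ->]]; exists r; split => //; apply: sub_all Wr => cs; apply: h. Qed.

Definition generated : subalgebra A :=
  Subalgebra (word_span1 (W := xpredT) isT) (@word_spanP xpredT)
    (@word_spanM xpredT xpredT xpredT (fun _ _ _ _ => isT)).

Definition genalg := subalg generated.

Definition gen_filt (k : nat) (x : genalg) : Prop :=
  word_span (fun s => word_degree s <= k)%N (subalg_val x).

Lemma gen_filt0 k : gen_filt k 0.
Proof. exact: word_span0. Qed.

Lemma gen_filtP k (c : C) x y :
  gen_filt k x -> gen_filt k y -> gen_filt k (c *: x + y).
Proof. exact: word_spanP. Qed.

Lemma gen_filt1 : gen_filt 0 1.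
Proof. by apply: word_span1; rewrite /word_degree big_nil. Qed.

Lemma gen_filtM i j x y :
  gen_filt i x -> gen_filt j y -> gen_filt (i + j) (x * y).
Proof.
apply: word_spanM => s t hs ht.
by rewrite /word_degree big_cat; apply: leq_add.
Qed.

Lemma gen_filtS k x : gen_filt k x -> gen_filt k.+1 x.
Proof. by apply: word_spanW => s /leqW. Qed.

Lemma gen_filt_exhaustive x : exists k, gen_filt k x.
Proof.
case: x => x xS; rewrite /gen_filt /=; have /asboolP[r [_ ->]] := xS.
exists (\sum_(cs <- r) word_degree cs.2)%N, r; split=> //.
elim: r {xS} => //= cs r IH; rewrite big_cons leq_addr /=.
by apply: sub_all IH => ct /leq_trans; apply; apply: leq_addl.
Qed.

Definition gen_filtAlg : filtAlg :=
  FiltAlg gen_filt0 gen_filtP gen_filt1 gen_filtM gen_filtS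
    gen_filt_exhaustive.

End Generated.

Section SkewGroupAlgebra.

Definition ratfun : fieldType := {fraction {poly C}}.

Definition poly_shift (j : int) (p : {poly C}) : {poly C} :=
  p \Po ('X + (j%:~R)%:P).

(* f(h) |-> f(h + j) *)
Definition ratfun_shift (j : int) (f : ratfun) : ratfun :=
  let r := generic_quotient.repr f in
  (poly_shift j \n_r)%:F / (poly_shift j \d_r)%:F.

Lemma poly_shift_neq0 j p : p != 0 -> poly_shift j p != 0.
Proof. by rewrite -!size_poly_eq0 size_comp_poly2 ?size_XaddC. Qed.

Lemma poly_shift_rmorph j :
  zmod_morphism (poly_shift j) /\ monoid_morphism (poly_shift j).
Proof.
split; first by move=> p q; rewrite /poly_shift rmorphB.
by split=> [|p q]; rewrite /poly_shift ?rmorph1 ?rmorphM.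
Qed.

HB.instance Definition _ j := GRing.isZmodMorphism.Build {poly C} {poly C}
  (poly_shift j) (poly_shift_rmorph j).1.
HB.instance Definition _ j := GRing.isMonoidMorphism.Build {poly C} {poly C}
  (poly_shift j) (poly_shift_rmorph j).2.

Lemma poly_shift0 p : poly_shift 0 p = p.
Proof. by rewrite /poly_shift addr0 comp_polyXr. Qed.

Lemma poly_shiftD i j p : poly_shift (i + j) p = poly_shift j (poly_shift i p).
Proof.
rewrite /poly_shift -comp_polyA comp_polyD comp_polyX comp_polyC.
by rewrite -addrA -polyCD -intrD [j + i]addrC.
Qed.

Lemma poly_shiftC j c : poly_shift j c%:P = c%:P.
Proof. exact: comp_polyC. Qed.

Lemma ratio_piE (r : {ratio {poly C}}) :
  \pi_({fraction {poly C}})%qT r = (\n_r)%:F / (\d_r)%:F.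
Proof.
apply: (canRL (mulfK _)); first by rewrite tofrac_eq0 denom_ratioP.
unlock FracField.tofrac; rewrite -[LHS]FracField.pi_mul.
apply/generic_quotient.eqmodP; rewrite /= FracField.equivfE /FracField.mulf.
by rewrite !numden_Ratio ?mulr1 ?oner_neq0 ?denom_ratioP // mulrC.
Qed.

Lemma ratfunP (f : ratfun) :
  exists p q : {poly C}, q != 0 /\ f = p%:F / q%:F.
Proof.
rewrite -[f]generic_quotient.reprK ratio_piE.
exists \n_(generic_quotient.repr f), \d_(generic_quotient.repr f).
by split; first exact: denom_ratioP.
Qed.

Lemma ratfun_shiftE j (p q : {poly C}) : q != 0 ->
  ratfun_shift j (p%:F / q%:F) = (poly_shift j p)%:F / (poly_shift j q)%:F.
Proof.
move=> q0; rewrite /ratfun_shift; set r := generic_quotient.repr _.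
have /eqP : (\n_r)%:F / (\d_r)%:F = p%:F / q%:F.
  by rewrite -ratio_piE generic_quotient.reprK.
have d0 := denom_ratioP r.
rewrite eqr_div ?tofrac_eq0 // -!tofracM tofrac_eq => /eqP e.
apply/eqP; rewrite eqr_div ?tofrac_eq0 ?poly_shift_neq0 // -!tofracM tofrac_eq.
by rewrite -!rmorphM e.
Qed.

Lemma ratfun_shift_poly j (p : {poly C}) :
  ratfun_shift j p%:F = (poly_shift j p)%:F.
Proof.
have := ratfun_shiftE j p (oner_neq0 _).
by rewrite [poly_shift j 1]rmorph1 tofrac1 !divr1.
Qed.

Lemma ratfun_shift_zmod j : zmod_morphism (ratfun_shift j).
Proof.
move=> f g; have [p [q [q0 ->]]] := ratfunP f.
have [p' [q' [q0' ->]]] := ratfunP g.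
rewrite -mulNr addf_div ?tofrac_eq0 // -tofracN -!tofracM -tofracD.
rewrite !ratfun_shiftE ?mulf_neq0 // rmorphD !rmorphM rmorphN.
rewrite -[in RHS]mulNr -tofracN addf_div ?tofrac_eq0 ?poly_shift_neq0 //.
by rewrite -!tofracM -tofracD.
Qed.

Lemma ratfun_shift_monoid j : monoid_morphism (ratfun_shift j).
Proof.
split=> [|f g]; first by rewrite -tofrac1 ratfun_shift_poly rmorph1.
have [p [q [q0 ->]]] := ratfunP f; have [p' [q' [q0' ->]]] := ratfunP g.
rewrite mulf_div -!tofracM !ratfun_shiftE ?mulf_neq0 // !rmorphM.
by rewrite mulf_div -!tofracM.
Qed.

HB.instance Definition _ j := GRing.isZmodMorphism.Build ratfun ratfun
  (ratfun_shift j) (ratfun_shift_zmod j).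
HB.instance Definition _ j := GRing.isMonoidMorphism.Build ratfun ratfun
  (ratfun_shift j) (ratfun_shift_monoid j).

Lemma ratfun_shift0 f : ratfun_shift 0 f = f.
Proof.
by have [p [q [q0 ->]]] := ratfunP f; rewrite ratfun_shiftE // !poly_shift0.
Qed.

Lemma ratfun_shiftD i j f :
  ratfun_shift (i + j) f = ratfun_shift j (ratfun_shift i f).
Proof.
have [p [q [q0 ->]]] := ratfunP f.
by rewrite !ratfun_shiftE ?poly_shift_neq0 // !poly_shiftD.
Qed.

(* The element with coefficient family (f_i) stands for the sum of the
   a^i f_i(h), with the coefficients on the right. *)
Definition skew := monalg.malg int ratfun.
HB.instance Definition _ := GRing.Zmodule.on skew.

(* a^i f(h) *)
Definition skew_mono (i : int) (f : ratfun) : skew := monalg.mkmalgU i f.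

HB.instance Definition _ i := GRing.Additive.copy (skew_mono i)
  (@monalg.mkmalgU int ratfun i).

Definition skew_coef (i : int) (x : skew) : ratfun := monalg.mcoeff i x.

HB.instance Definition _ i := GRing.Additive.copy (skew_coef i)
  (@monalg.mcoeff int ratfun i).

Lemma skew_coefD i (x y : skew) :
  skew_coef i (x + y) = skew_coef i x + skew_coef i y.
Proof. exact: raddfD. Qed.

Definition skew_supp (x : skew) : {fset int} := monalg.msupp x.

Definition skew_mul (x y : skew) : skew :=
  \sum_(i <- skew_supp x) \sum_(j <- skew_supp y)
    skew_mono (i + j) (ratfun_shift j (skew_coef i x) * skew_coef j y).

Definition skew_one : skew := skew_mono 0 1.

Lemma skewP (x y : skew) : (forall i, skew_coef i x = skew_coef i y) -> x = y.
Proof. by move=> h; apply/monalg.malgP. Qed.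

Lemma skew_coef_mono i j f : skew_coef j (skew_mono i f) = f *+ (i == j).
Proof. exact: monalg.mcoeffU. Qed.

Lemma skew_coef_out i x : i \notin skew_supp x -> skew_coef i x = 0.
Proof. exact: monalg.mcoeff_outdom. Qed.

Lemma skewE (x : skew) :
  x = \sum_(i <- skew_supp x) skew_mono i (skew_coef i x).
Proof. exact: monalg.monalgE. Qed.

Lemma skew_ind (P : skew -> Prop) :
  P 0 -> (forall x y, P x -> P y -> P (x + y)) ->
  (forall i f, P (skew_mono i f)) -> forall x, P x.
Proof. by move=> P0 PD Pm x; rewrite (skewE x); elim/big_ind: _. Qed.

Lemma skew_mulw (d1 d2 : {fset int}) (x y : skew) :
  (skew_supp x `<=` d1)%fset -> (skew_supp y `<=` d2)%fset ->
  skew_mul x y = \sum_(i <- d1) \sum_(j <- d2)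
    skew_mono (i + j) (ratfun_shift j (skew_coef i x) * skew_coef j y).
Proof.
move=> le1 le2; rewrite /skew_mul (big_fset_incl _ le1) /=.
  apply: eq_bigr => i _; apply: big_fset_incl => // j _ /skew_coef_out ->.
  by rewrite mulr0 raddf0.
move=> i _ /skew_coef_out ->; rewrite big1 // => j _.
by rewrite raddf0 mul0r raddf0.
Qed.

Lemma skew_mulDl : left_distributive skew_mul +%R.
Proof.
move=> x y z; pose d := (skew_supp x `|` skew_supp y `|` skew_supp (x + y)%R)%fset.
have hx : (skew_supp x `<=` d)%fset by rewrite /d -fsetUA fsubsetUl.
have hy : (skew_supp y `<=` d)%fset by rewrite /d fsetUAC fsubsetUr.
have hxy : (skew_supp (x + y)%R `<=` d)%fset by rewrite fsubsetUr.
rewrite (skew_mulw hxy (fsubset_refl _)) (skew_mulw hx (fsubset_refl _)).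
rewrite (skew_mulw hy (fsubset_refl _)) -big_split; apply: eq_bigr => i _ /=.
rewrite -big_split; apply: eq_bigr => j _ /=.
by rewrite -raddfD -mulrDl -rmorphD -raddfD.
Qed.

Lemma skew_mulDr : right_distributive skew_mul +%R.
Proof.
move=> z x y; pose d := (skew_supp x `|` skew_supp y `|` skew_supp (x + y)%R)%fset.
have hx : (skew_supp x `<=` d)%fset by rewrite /d -fsetUA fsubsetUl.
have hy : (skew_supp y `<=` d)%fset by rewrite /d fsetUAC fsubsetUr.
have hxy : (skew_supp (x + y)%R `<=` d)%fset by rewrite fsubsetUr.
rewrite (skew_mulw (fsubset_refl _) hxy) (skew_mulw (fsubset_refl _) hx).
rewrite (skew_mulw (fsubset_refl _) hy) -big_split; apply: eq_bigr => i _ /=.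
rewrite -big_split; apply: eq_bigr => j _ /=.
by rewrite -raddfD -mulrDr -raddfD.
Qed.

Lemma skew_mul0l : left_zero 0 skew_mul.
Proof. by move=> x; apply: (addrI (skew_mul 0 x)); rewrite -skew_mulDl !addr0. Qed.

Lemma skew_mul0r : right_zero 0 skew_mul.
Proof. by move=> x; apply: (addrI (skew_mul x 0)); rewrite -skew_mulDr !addr0. Qed.

(* (a^i f(h)) (a^j g(h)) = a^(i+j) f(h+j) g(h) *)
Lemma skew_mono_mul i j f g :
  skew_mul (skew_mono i f) (skew_mono j g) =
  skew_mono (i + j) (ratfun_shift j f * g).
Proof.
rewrite (skew_mulw monalg.msuppU_le monalg.msuppU_le) !big_seq_fset1.
by rewrite !skew_coef_mono !eqxx.
Qed.

Lemma skew_mulA : associative skew_mul.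
Proof.
move=> x y z.
elim/skew_ind: x => [|x x' ex ex'|i f]; first by rewrite !skew_mul0l.
  by rewrite !skew_mulDl ex ex'.
elim/skew_ind: y => [|y y' ey ey'|j g].
- by rewrite skew_mul0l skew_mul0r skew_mul0l.
- by rewrite skew_mulDl !skew_mulDr skew_mulDl ey ey'.
elim/skew_ind: z => [|z z' ez ez'|k h]; first by rewrite !skew_mul0r.
  by rewrite !skew_mulDr ez ez'.
by rewrite !skew_mono_mul rmorphM ratfun_shiftD addrA mulrA.
Qed.

Lemma skew_mul1 : left_id skew_one skew_mul.
Proof.
elim/skew_ind=> [|x y ex ey|i f]; first by rewrite skew_mul0r.
  by rewrite skew_mulDr ex ey.
by rewrite skew_mono_mul rmorph1 mul1r add0r.
Qed.

Lemma skew_mulr1 : right_id skew_one skew_mul.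
Proof.
elim/skew_ind=> [|x y ex ey|i f]; first by rewrite skew_mul0l.
  by rewrite skew_mulDl ex ey.
by rewrite skew_mono_mul ratfun_shift0 mulr1 addr0.
Qed.

Lemma skew_one_neq0 : skew_one != 0.
Proof.
apply/eqP => /(congr1 (skew_coef 0)) /eqP.
by rewrite skew_coef_mono raddf0 oner_eq0.
Qed.

HB.instance Definition _ := GRing.Zmodule_isNzRing.Build skew
  skew_mulA skew_mul1 skew_mulr1 skew_mulDl skew_mulDr skew_one_neq0.

Definition ratfunC (c : C) : ratfun := (c%:P)%:F.

Lemma ratfun_shiftC j c : ratfun_shift j (ratfunC c) = ratfunC c.
Proof. by rewrite ratfun_shift_poly poly_shiftC. Qed.

Definition skew_scale (c : C) (x : skew) : skew :=
  \sum_(i <- skew_supp x) skew_mono i (ratfunC c * skew_coef i x).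

Lemma skew_coef_scale c i x :
  skew_coef i (skew_scale c x) = ratfunC c * skew_coef i x.
Proof.
rewrite {2}[x]skewE !raddf_sum mulr_sumr; apply: eq_bigr => j _ /=.
by rewrite !skew_coef_mono mulrnAr.
Qed.

Lemma skew_scaleA c d x : skew_scale c (skew_scale d x) = skew_scale (c * d) x.
Proof.
by apply/skewP=> i; rewrite !skew_coef_scale mulrA /ratfunC -tofracM -polyCM.
Qed.

Lemma skew_scale1 : left_id 1 skew_scale.
Proof. by move=> x; apply/skewP=> i; rewrite skew_coef_scale /ratfunC tofrac1 mul1r. Qed.

Lemma skew_scaleDr : right_distributive skew_scale +%R.
Proof.
by move=> c x y; apply/skewP=> i; rewrite skew_coefD !skew_coef_scale skew_coefD mulrDr.
Qed.

Lemma skew_scaleDl x : {morph skew_scale^~ x : c d / c + d}.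
Proof.
move=> c d; apply/skewP=> i.
by rewrite skew_coefD !skew_coef_scale -mulrDl /ratfunC polyCD tofracD.
Qed.

HB.instance Definition _ := GRing.Zmodule_isLmodule.Build C skew
  skew_scaleA skew_scale1 skew_scaleDr skew_scaleDl.

Lemma skew_monoZ (c : C) i f :
  c *: skew_mono i f = skew_mono i (ratfunC c * f).
Proof.
apply/skewP=> j; rewrite [LHS]skew_coef_scale !skew_coef_mono.
by rewrite mulrnAr.
Qed.

Lemma skew_monoM i j f g :
  skew_mono i f * skew_mono j g = skew_mono (i + j) (ratfun_shift j f * g).
Proof. exact: skew_mono_mul. Qed.

Lemma skew_scaleAl (c : C) (x y : skew) : c *: (x * y) = (c *: x) * y.
Proof.
elim/skew_ind: x => [|x x' ex ex'|i f]; first by rewrite !(mul0r, scaler0).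
  by rewrite !(mulrDl, scalerDr) ex ex'.
elim/skew_ind: y => [|y y' ey ey'|j g]; first by rewrite !(mulr0, scaler0).
  by rewrite !(mulrDr, scalerDr) ey ey'.
by rewrite !(skew_monoM, skew_monoZ) rmorphM /= ratfun_shiftC mulrA.
Qed.

HB.instance Definition _ := GRing.Lmodule_isLalgebra.Build C skew skew_scaleAl.

Lemma skew_scaleAr (c : C) (x y : skew) : c *: (x * y) = x * (c *: y).
Proof.
elim/skew_ind: x => [|x x' ex ex'|i f]; first by rewrite !(mul0r, scaler0).
  by rewrite !(mulrDl, scalerDr) ex ex'.
elim/skew_ind: y => [|y y' ey ey'|j g]; first by rewrite !(mulr0, scaler0).
  by rewrite !(mulrDr, scalerDr) ey ey'.
by rewrite !(skew_monoM, skew_monoZ) mulrCA.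
Qed.

HB.instance Definition _ := GRing.Lalgebra_isAlgebra.Build C skew skew_scaleAr.

End SkewGroupAlgebra.

Definition skew_emb (f : ratfun) : skew := skew_mono 0 f.

Section Dq.
Variable q : {poly C}.

Local Notation h := ('X%:F : ratfun).

Definition Dq_rho : C := 2 * q.[- 2^-1].

Definition Dq_s : ratfun :=
  (q * (q \Po (- 'X - 1)))%:F / (h * (h + 1) * (1 + 2 * h) ^+ 2).

Definition Dq_a : skew := skew_mono 1 1.
Definition Dq_b : skew := skew_emb Dq_s * skew_mono (-1) 1.

Definition Dq_u : skew := skew_emb (h ^+ 2).
Definition Dq_v : skew :=
  Dq_a + Dq_b + skew_emb (2 * ratfunC Dq_rho / (1 - 4 * h ^+ 2)).
Definition Dq_w : skew :=
  (Dq_a - Dq_b) * skew_emb h - skew_emb (ratfunC Dq_rho / (1 - 4 * h ^+ 2)).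

Definition Dq_gen (i : 'I_3) : skew := nth 0 [:: Dq_u; Dq_v; Dq_w] i.

Definition Dalg : filtAlg := gen_filtAlg Dq_gen (D_degree (size q).-1).

End Dq.

End Algebras.

(* Main.v *)
From Stdlib Require Import Ncring Ncring_tac.
Require Import Defs.
From HB Require Import structures.
From mathcomp Require Import all_boot all_order all_algebra reals zify ring.
From mathcomp Require Import boolp finmap.
From mathcomp Require Import -(notations) monalg.
From mathcomp Require Import mpoly.
From mathcomp.real_closed Require Import complex.

(** The proof gives the algebras D(q) a presentation that no longer mentions
    the skew group algebra, and shows that every noncommutative deformation has
    such a presentation.

    Put rho = 2 q(-1/2). The polynomial 4 q(x) q(-x-1) is invariant under the
    reflection x -> -x-1, and its value at the fixed point -1/2 is rho^2. Hence
    it equals rho^2 + (1+2x)^2 G(x) with G again invariant; let P and Q be the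
    polynomials with G(x) = Q(x^2) + x P(x^2). A computation in the skew group
    algebra [Drel_skew] shows that the generators of D(q) satisfy
      [u,v] = v + 2w,              [u,w] = 2vu + w + rho,
      [v,w] = P(u) - v^2,          w^2 = v^2 u + vw + rho v - Q(u),
    a system written [Drel rho P Q u v w]. Leading terms in the group generator
    show that the monomials v^j u^i and v^j w u^i are linearly independent
    [nf_free_skew]. An algebra with these relations, in which these monomials
    form a basis adapted to the filtration, is determined by rho, P and Q up to
    filtered isomorphism [filtered_iso_of_Drel].

    For (i), lift the coordinates of the Kleinian singularity to generators
    u, v, w of the deformation. Their commutators have lower degree than the
    products. If some commutator is nonzero, commuting u and v with the lifted
    relation shows that the leading parts of [u,v] and [u,w] are a w and a vu
    for one nonzero scalar a [noncommutative_leading], so that these commutators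
    can be normalised by a filtered change of generators. The Jacobi identity
    and the derivation property of the commutator with u then leave no freedom
    but rho, P and Q [lie_vw_shape, square_relation], and computing [v,w^2] in
    two ways yields G(-x-1) = G(x) for G(x) = Q(x^2) + x P(x^2)
    [compatibility]. Therefore rho^2 + (1+2x)^2 G(x) is a polynomial in
    (x+1/2)^2. Over an algebraically closed field it factors as
    4 q(x) q(-x-1), where the sign of q can be chosen so that 2 q(-1/2) = rho
    [q_of_parameters]. The deformation and D(q) thus have the same presentation.

    For (ii), if q'(x) q'(-x-1) = theta^2 q(x) q(-x-1), then, after a possible
    change of the sign of theta, the parameters of q' are theta rho,
    theta^2 P and theta^2 Q, and these are the parameters of the generators
    u, theta v, theta w of D(q). Conversely, when n >= 5 the generator v has
    larger degree than u, so a filtered isomorphism sends u to a u + b and v to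
    c v + p(u). The relations force a = 1, b = 0 and p = 0, so the parameters
    differ by the scaling just described [rigidity]. *)

Set Implicit Arguments.
Unset Strict Implicit.
Unset Printing Implicit Defensive.

Import Order.TTheory GRing.Theory Num.Theory.
Local Open Scope ring_scope.

Local Notation "c .<[ u ]>" := (horner_alg u c) (at level 2, format "c .<[ u ]>").
Local Notation "x %:F" := (@FracField.tofrac _ x).

(** * Commutators and the weight filtration *)

Section NoncommutativeRingTactic.
Variable A : nzRingType.

#[export] Instance nzring_ops :
  @Ring_ops A 0 1 +%R *%R (fun x y => x - y) -%R eq := {}.

#[export] Instance nzring_axioms : @Ring A _ _ _ _ _ _ _ nzring_ops.
Proof.
split.
- exact: RelationClasses.eq_equivalence.
- by move=> x y -> z t ->.
- by move=> x y -> z t ->.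
- by move=> x y -> z t ->.
- by move=> x y ->.
all: cbn.
- exact: add0r.
- exact: addrC.
- exact: addrA.
- exact: mul1r.
- exact: mulr1.
- exact: mulrA.
- exact: mulrDl.
- by move=> x y z; exact: mulrDr.
- by [].
- exact: subrr.
Qed.

End NoncommutativeRingTactic.

(** Decides identities between elements that do not commute by normalisation
    in the free ring, where scalar multiples count as further variables. *)
Ltac ncring := non_commutative_ring.

Section Commutator.
Variables (C : fieldType) (A : algType C).
Implicit Types x y z : A.

Definition lie x y : A := x * y - y * x.

Lemma lieMr x y z : lie x (y * z) = lie x y * z + y * lie x z.
Proof. rewrite /lie; ncring. Qed.

Lemma lieMl x y z : lie (x * y) z = x * lie y z + lie x z * y.
Proof. rewrite /lie; ncring. Qed.

Lemma lieC x y : lie y x = - lie x y.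
Proof. by rewrite /lie opprB. Qed.

Lemma liexx x : lie x x = 0.
Proof. exact: subrr. Qed.

Lemma lieDr x y z : lie x (y + z) = lie x y + lie x z.
Proof. rewrite /lie; ncring. Qed.

Lemma lieDl x y z : lie (x + y) z = lie x z + lie y z.
Proof. rewrite /lie; ncring. Qed.

Lemma lieBr x y z : lie x (y - z) = lie x y - lie x z.
Proof. rewrite /lie; ncring. Qed.

Lemma lieZr c x y : lie x (c *: y) = c *: lie x y.
Proof. by rewrite /lie -scalerAl -scalerAr scalerBr. Qed.

Lemma lieZl c x y : lie (c *: x) y = c *: lie x y.
Proof. by rewrite /lie -scalerAl -scalerAr scalerBr. Qed.

Lemma lie1r x : lie x 1 = 0.
Proof. by rewrite /lie mulr1 mul1r subrr. Qed.

Lemma lie0r x : lie x 0 = 0.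
Proof. by rewrite /lie mulr0 mul0r subrr. Qed.

Lemma lie1l x : lie 1 x = 0.
Proof. by rewrite lieC lie1r oppr0. Qed.

Lemma lie0l x : lie 0 x = 0.
Proof. by rewrite lieC lie0r oppr0. Qed.

End Commutator.

Section WeightFiltration.
Variables (C : fieldType) (A : algType C) (n : nat).
Variables u v w : A.

(** Weights are half the degrees of the problem. They are integers rather than
    natural numbers so that a commutator may be shown to have negative weight,
    hence to vanish. *)
Inductive weight_filt : int -> A -> Prop :=
| Wfilt0 k : weight_filt k 0
| Wfilt1 k : 0 <= k -> weight_filt k 1
| WfiltP k c x y : weight_filt k x -> weight_filt k y -> weight_filt k (c *: x + y)
| Wfiltu k x : weight_filt (k - 2) x -> weight_filt k (u * x)
| Wfiltv k x : weight_filt (k - (n%:Z - 2)) x -> weight_filt k (v * x)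
| Wfiltw k x : weight_filt (k - (n%:Z - 1)) x -> weight_filt k (w * x).

Lemma wfiltW k l x : k <= l -> weight_filt k x -> weight_filt l x.
Proof.
move=> + kx; elim: kx l => {k x} [k l _|k k0 l kl|k c x y _ IHx _ IHy l kl|
  k x _ IHx l kl|k x _ IHx l kl|k x _ IHx l kl].
- exact: Wfilt0.
- by apply: Wfilt1; lia.
- by apply: WfiltP; auto.
- by apply: Wfiltu; apply: IHx; lia.
- by apply: Wfiltv; apply: IHx; lia.
- by apply: Wfiltw; apply: IHx; lia.
Qed.

Lemma wfiltD k x y : weight_filt k x -> weight_filt k y -> weight_filt k (x + y).
Proof. by move=> kx ky; rewrite -[x]scale1r; apply: WfiltP. Qed.

Lemma wfiltZ k c x : weight_filt k x -> weight_filt k (c *: x).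
Proof. by move=> kx; rewrite -[_ *: _]addr0; apply: WfiltP => //; apply: Wfilt0. Qed.

Lemma wfiltN k x : weight_filt k x -> weight_filt k (- x).
Proof. by rewrite -scaleN1r; apply: wfiltZ. Qed.

Lemma wfiltB k x y : weight_filt k x -> weight_filt k y -> weight_filt k (x - y).
Proof. by move=> kx ky; apply/wfiltD/wfiltN. Qed.

Lemma wfilt_sum k (I : Type) (r : seq I) (P : pred I) (F : I -> A) :
  (forall i, P i -> weight_filt k (F i)) -> weight_filt k (\sum_(i <- r | P i) F i).
Proof. by move=> h; elim/big_ind: _ => //; [exact: Wfilt0 | exact: wfiltD]. Qed.

Lemma wfiltM i j x y : weight_filt i x -> weight_filt j y -> weight_filt (i + j) (x * y).
Proof.
move=> ix; elim: ix j y => {i x} [k j y _|k k0 j y jy|k c x z _ IHx _ IHz j y jy|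
  k x _ IHx j y jy|k x _ IHx j y jy|k x _ IHx j y jy].
- by rewrite mul0r; apply: Wfilt0.
- by rewrite mul1r; apply: wfiltW jy; lia.
- by rewrite mulrDl -scalerAl; apply: WfiltP; auto.
- by rewrite -mulrA; apply: Wfiltu; apply: wfiltW (IHx _ _ jy); lia.
- by rewrite -mulrA; apply: Wfiltv; apply: wfiltW (IHx _ _ jy); lia.
- by rewrite -mulrA; apply: Wfiltw; apply: wfiltW (IHx _ _ jy); lia.
Qed.

Lemma wfilt_u : weight_filt 2 u.
Proof. by rewrite -[u]mulr1; apply/Wfiltu/Wfilt1. Qed.

Lemma wfilt_v : weight_filt (n%:Z - 2) v.
Proof. by rewrite -[v]mulr1; apply: Wfiltv; apply: Wfilt1; lia. Qed.

Lemma wfilt_w : weight_filt (n%:Z - 1) w.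
Proof. by rewrite -[w]mulr1; apply: Wfiltw; apply: Wfilt1; lia. Qed.

Lemma wfiltX i x k : weight_filt i x -> weight_filt (k%:Z * i) (x ^+ k).
Proof.
move=> ix; elim: k => [|k IH]; first by rewrite expr0 mul0r; apply: Wfilt1.
by rewrite exprS intS mulrDl mul1r; apply: wfiltM.
Qed.

Lemma wfilt_alg k (c : C) : 0 <= k -> weight_filt k c%:A.
Proof. by move=> k0; apply: wfiltZ; apply: Wfilt1. Qed.

(** All three generators have positive weight. *)
Lemma wfilt_lt0 k x : (1 < n)%N -> k < 0 -> weight_filt k x -> x = 0.
Proof.
move=> n2 + kx; elim: kx => {k x} [//|k k0|k c x y _ IHx _ IHy|
  k x _ IHx|k x _ IHx|k x _ IHx] klt0; first by move: (le_lt_trans k0 klt0).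
- by rewrite IHx // IHy // scaler0 addr0.
- by rewrite IHx ?mulr0 //; lia.
- by rewrite IHx ?mulr0 //; lia.
- by rewrite IHx ?mulr0 //; lia.
Qed.

Section Drop.
Variable d : int.
Hypothesis uv : weight_filt (n%:Z - d) (lie u v).
Hypothesis uw : weight_filt (n%:Z + 1 - d) (lie u w).
Hypothesis vw : weight_filt (2 * n%:Z - 3 - d) (lie v w).

(** Commuting with x is a derivation, so it is enough to control it on the
    generators. *)
Lemma wfilt_lie_gen a x j y :
  weight_filt a x ->
  weight_filt (a + 2 - d) (lie x u) -> weight_filt (a + (n%:Z - 2) - d) (lie x v) ->
  weight_filt (a + (n%:Z - 1) - d) (lie x w) ->
  weight_filt j y -> weight_filt (a + j - d) (lie x y).
Proof.
move=> ax xu xv xw jy; elim: jy => {j y} [k|k k0|k c y z _ IHy _ IHz|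
  k y ky IHy|k y ky IHy|k y ky IHy].
- by rewrite lie0r; apply: Wfilt0.
- by rewrite lie1r; apply: Wfilt0.
- by rewrite lieDr lieZr; apply: WfiltP.
- rewrite lieMr; apply: wfiltD; last by apply: Wfiltu; apply: wfiltW IHy; lia.
  by apply: wfiltW (wfiltM xu ky); lia.
- rewrite lieMr; apply: wfiltD; last by apply: Wfiltv; apply: wfiltW IHy; lia.
  by apply: wfiltW (wfiltM xv ky); lia.
- rewrite lieMr; apply: wfiltD; last by apply: Wfiltw; apply: wfiltW IHy; lia.
  by apply: wfiltW (wfiltM xw ky); lia.
Qed.

(** The derivation argument is applied to the second factor for each
    generator, and then to the first factor. *)
Lemma wfilt_lie i x j y :
  weight_filt i x -> weight_filt j y -> weight_filt (i + j - d) (lie x y).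
Proof.
have Hu j' y' : weight_filt j' y' -> weight_filt (2 + j' - d) (lie u y').
  apply: wfilt_lie_gen wfilt_u _ _ _; first by rewrite liexx; apply: Wfilt0.
    by apply: wfiltW uv; lia.
  by apply: wfiltW uw; lia.
have Hv j' y' : weight_filt j' y' -> weight_filt (n%:Z - 2 + j' - d) (lie v y').
  apply: wfilt_lie_gen wfilt_v _ _ _; last by apply: wfiltW vw; lia.
    by rewrite lieC; apply/wfiltN/(wfiltW _ uv); lia.
  by rewrite liexx; apply: Wfilt0.
have Hw j' y' : weight_filt j' y' -> weight_filt (n%:Z - 1 + j' - d) (lie w y').
  apply: wfilt_lie_gen wfilt_w _ _ _; last by rewrite liexx; apply: Wfilt0.
    by rewrite lieC; apply/wfiltN/(wfiltW _ uw); lia.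
  by rewrite lieC; apply/wfiltN/(wfiltW _ vw); lia.
move=> ix jy; elim: ix => {i x} [k|k k0|k c x z _ IHx _ IHz|
  k x kx IHx|k x kx IHx|k x kx IHx].
- by rewrite lie0l; apply: Wfilt0.
- by rewrite lie1l; apply: Wfilt0.
- by rewrite lieDl lieZl; apply: WfiltP.
- rewrite lieMl; apply: wfiltD; first by apply: Wfiltu; apply: wfiltW IHx; lia.
  by apply: wfiltW (wfiltM (Hu _ _ jy) kx); lia.
- rewrite lieMl; apply: wfiltD; first by apply: Wfiltv; apply: wfiltW IHx; lia.
  by apply: wfiltW (wfiltM (Hv _ _ jy) kx); lia.
- rewrite lieMl; apply: wfiltD; first by apply: Wfiltw; apply: wfiltW IHx; lia.
  by apply: wfiltW (wfiltM (Hw _ _ jy) kx); lia.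
Qed.

End Drop.
End WeightFiltration.

(** * Normal forms *)

Section Weights.
Variables (C : fieldType) (n : nat).
Implicit Types (p q : {poly {poly C}}) (c : {poly C}).

(** The outer variable stands for v and the inner one for u. *)
Definition weight_le (k : int) p :=
  forall i j : nat, k < 2 * i%:Z + (n%:Z - 2) * j%:Z -> p`_j`_i = 0.

Lemma wleW k l p : k <= l -> weight_le k p -> weight_le l p.
Proof. by move=> kl kp i j h; apply: kp; apply: le_lt_trans h. Qed.

Lemma wle0 k : weight_le k 0.
Proof. by move=> i j _; rewrite !coef0. Qed.

Lemma wleD k p q : weight_le k p -> weight_le k q -> weight_le k (p + q).
Proof. by move=> kp kq i j h; rewrite !coefD kp // kq // addr0. Qed.

Lemma wleN k p : weight_le k p -> weight_le k (- p).
Proof. by move=> kp i j h; rewrite !coefN kp // oppr0. Qed.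

Lemma wleB k p q : weight_le k p -> weight_le k q -> weight_le k (p - q).
Proof. by move=> kp kq; apply: wleD => //; apply: wleN. Qed.

Lemma wleM k l p q : weight_le k p -> weight_le l q -> weight_le (k + l) (p * q).
Proof.
move=> kp lq i j h; rewrite coefM coef_sum big1 // => a _.
rewrite coefM big1 // => b _.
have [hk|hk] := ltP k (2 * b%:Z + (n%:Z - 2) * a%:Z).
  by rewrite kp // mul0r.
rewrite lq ?mulr0 //; have := ltn_ord a; have := ltn_ord b => hb ha.
move: h hk; rewrite -!subzn -1?ltnS //; lia.
Qed.

Lemma wleC k c : (forall i : nat, k < 2 * i%:Z -> c`_i = 0) -> weight_le k c%:P.
Proof.
move=> h i j kij; rewrite coefC; case: j kij => [|j] kij; last by rewrite coef0.
by apply: h; lia.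
Qed.

Lemma wleCC k (a : C) : 0 <= k -> weight_le k a%:P%:P.
Proof.
move=> k0; apply: wleC => i ki; rewrite coefC; case: i ki => // ki; lia.
Qed.

Lemma wleX : weight_le (n%:Z - 2) 'X.
Proof.
by move=> i j h; rewrite coefX; case: eqP h => [->|]; rewrite ?coef0 ?coef1 //;
  case: i => //= h; lia.
Qed.

Lemma wleCX : weight_le 2 ('X)%:P.
Proof. by apply: wleC => i h; rewrite coefX; case: eqP h => [->|]. Qed.

Lemma wleXn k p m : weight_le k p -> weight_le (m%:Z * k) (p ^+ m).
Proof.
move=> kp; elim: m => [|m IH]; last by rewrite exprS intS mulrDl mul1r; apply: wleM.
by rewrite expr0 mul0r -[1]/(1%:P%:P); apply: wleCC.
Qed.

Lemma wle_exhaustive p : (2 <= n)%N -> exists N : nat, weight_le N%:Z p.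
Proof.
move=> n2; exists (2 * \max_(c <- p) size c + (n - 2) * size p)%N => i j.
have [jp|jp] := ltnP j (size p); last by move=> _; rewrite (nth_default _ jp) coef0.
move=> h; apply: nth_default.
have : (size (nth 0%R p j) <= \max_(c <- p) size c)%N.
  by apply: (leq_bigmax_seq (F := fun c : {poly C} => size c)) => //; apply: mem_nth.
move: h; set M := \max_(c <- p) _; move=> h sM.
move: (leq_mul (leqnn (n - 2)) (ltnW jp)) h.
have -> : n%:Z - 2 = (n - 2)%N by lia.
move: (n - 2)%N => m hm; rewrite -!PoszM -PoszD ltz_nat => h; apply: leq_trans sM _.
move: (m * j)%N (m * _)%N hm h => a b hm h. lia.
Qed.

Lemma wle_lt0 k p : (2 <= n)%N -> k < 0 -> weight_le k p -> p = 0.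
Proof.
by move=> n2 k0 kp; apply/polyP => j; apply/polyP => i; rewrite !coef0 kp //; nia.
Qed.

End Weights.

Section NormalForm.
Variables (C : fieldType) (A : algType C).
Implicit Types (p q : {poly {poly C}}) (c : {poly C}).

Section Evaluation.
Variables u v : A.

(** The middle factor m is 1 or w. *)
Definition polyev (m : A) p : A := \sum_(j < size p) v ^+ j * m * (p`_j).<[u]>.

Lemma ev_widen m p N : (size p <= N)%N ->
  polyev m p = \sum_(j < N) v ^+ j * m * (p`_j).<[u]>.
Proof.
move=> pN; rewrite /polyev (big_ord_widen N (fun j => v ^+ j * m * (p`_j).<[u]>)) //.
rewrite big_mkcond; apply: eq_bigr => j _ /=; case: ltnP => // pj.
by rewrite nth_default // rmorph0 mulr0.
Qed.

Lemma evP m (a : C) p q : polyev m (a%:P%:P * p + q) = a *: polyev m p + polyev m q.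
Proof.
pose N := maxn (size p) (size q).
have sN : (size (a%:P%:P * p + q)%R <= N)%N.
  apply: (leq_trans (size_polyD _ _)); rewrite geq_max leq_maxr andbT.
  by rewrite mul_polyC (leq_trans (size_scale_leq _ _)) // leq_maxl.
rewrite (ev_widen m sN) (ev_widen m (leq_maxl _ (size q))).
rewrite (ev_widen m (leq_maxr (size p) _)) scaler_sumr -big_split /=.
apply: eq_bigr => j _; rewrite coefD coefCM mul_polyC.
by rewrite linearP /= mulrDr mulr_algl -scalerAr.
Qed.

Lemma evD m p q : polyev m (p + q) = polyev m p + polyev m q.
Proof. by rewrite -[p in LHS]mul1r (evP m 1) scale1r. Qed.

Lemma ev0 m : polyev m 0 = 0.
Proof. by rewrite /polyev size_poly0 big_ord0. Qed.

Lemma evZ m (a : C) p : polyev m (a%:P%:P * p) = a *: polyev m p.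
Proof. by rewrite -[LHS]addr0 -[0 in LHS](ev0 m) -evD addr0 -[_ * p]addr0 evP ev0 addr0. Qed.

Lemma evN m p : polyev m (- p) = - polyev m p.
Proof. by rewrite -[RHS]scaleN1r -evZ !polyCN mulN1r. Qed.

Lemma evB m p q : polyev m (p - q) = polyev m p - polyev m q.
Proof. by rewrite evD evN. Qed.

Lemma evMC m p c : polyev m (p * c%:P) = polyev m p * c.<[u]>.
Proof.
rewrite (@ev_widen m (p * c%:P) (size p)).
  rewrite /polyev mulr_suml; apply: eq_bigr => j _.
  by rewrite coefMC rmorphM mulrA.
apply: (leq_trans (size_polyMleq _ _)); rewrite size_polyC.
by case: (c == 0); rewrite ?addn0 ?addn1 // leq_pred.
Qed.

Lemma evC m c : polyev m c%:P = m * c.<[u]>.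
Proof.
rewrite (@ev_widen m c%:P 1) ?size_polyC ?leq_b1 // big_ord1.
by rewrite coefC expr0 mul1r.
Qed.

Lemma evX m p : polyev m ('X * p) = v * polyev m p.
Proof.
have s : (size ('X * p)%R <= (size p).+1)%N.
  by apply: (leq_trans (size_polyMleq _ _)); rewrite size_polyX.
rewrite (ev_widen m s) big_ord_recl coefXM rmorph0 mulr0 add0r.
rewrite /polyev mulr_sumr; apply: eq_bigr => j _.
by rewrite coefXM /= exprS !mulrA.
Qed.

Lemma evXn m k p : polyev m ('X^k * p) = v ^+ k * polyev m p.
Proof.
elim: k => [|k IH]; first by rewrite !expr0 !mul1r.
by rewrite !exprS -!mulrA evX IH.
Qed.

End Evaluation.

Variables (n : nat) (u v w : A).
Local Notation wfilt := (weight_filt n u v w).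
Local Notation ev := (polyev u v).
Local Notation wle := (@weight_le C n).

(** Normal forms combine the monomials v^j u^i and v^j w u^i. Higher powers of
    w do not occur because w^2 is rewritten in terms of u and v. *)
Definition nf p r := ev 1 p + ev w r.

Lemma nfD p q r s : nf (p + q) (r + s) = nf p r + nf q s.
Proof. by rewrite /nf !evD addrACA. Qed.

Lemma nfB p q r s : nf (p - q) (r - s) = nf p r - nf q s.
Proof. by rewrite /nf !evB opprD addrACA. Qed.

Lemma nfZ a p r : nf (a%:P%:P * p) (a%:P%:P * r) = a *: nf p r.
Proof. by rewrite /nf !evZ scalerDr. Qed.

Lemma nf0 : nf 0 0 = 0.
Proof. by rewrite /nf !ev0 addr0. Qed.

Lemma nfX p r : nf ('X * p) ('X * r) = v * nf p r.
Proof. by rewrite /nf !evX mulrDr. Qed.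

Lemma nfMC p r c : nf (p * c%:P) (r * c%:P) = nf p r * c.<[u]>.
Proof. by rewrite /nf !evMC mulrDl. Qed.

Definition nf_free := forall p r, nf p r = 0 -> p = 0 /\ r = 0.

Lemma nf_inj : nf_free -> forall p r q s, nf p r = nf q s -> p = q /\ r = s.
Proof.
move=> free p r q s /eqP; rewrite -subr_eq0 -nfB => /eqP /free [] /eqP + /eqP.
by rewrite !subr_eq0 => /eqP-> /eqP->.
Qed.

Lemma horner_coef_alg c : c.<[u]> = \sum_(i < size c) c`_i *: u ^+ i.
Proof.
rewrite /horner_alg /horner_morph horner_coef size_map_poly.
by apply: eq_bigr => i _; rewrite coef_map /= mulr_algl.
Qed.

Lemma wfilt_horner k c : (forall i : nat, k < 2 * i%:Z -> c`_i = 0) -> wfilt k c.<[u]>.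
Proof.
move=> h; rewrite horner_coef_alg; apply: wfilt_sum => i _.
have [ki|ki] := ltP k (2 * i%:Z); first by rewrite h // scale0r; apply: Wfilt0.
apply: wfiltZ; apply: wfiltW ki _; rewrite mulrC.
by apply: wfiltX; apply: wfilt_u.
Qed.

Lemma wfilt_ev a m k p : wfilt a m -> wle k p -> wfilt (a + k) (ev m p).
Proof.
move=> am kp; apply: wfilt_sum => j _.
have /wfilt_horner h : forall i : nat, k - (n%:Z - 2) * j%:Z < 2 * i%:Z -> p`_j`_i = 0.
  by move=> i h; apply: kp; lia.
apply: wfiltW (wfiltM (wfiltM (wfiltX j (wfilt_v _ _ _ _)) am) h); lia.
Qed.

Lemma wfilt_nf k p r : wle k p -> wle (k - (n%:Z - 1)) r -> wfilt k (nf p r).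
Proof.
move=> kp kr; apply: wfiltD.
  by apply: wfiltW (wfilt_ev (Wfilt1 _ _ _ _ (lexx 0)) kp); lia.
by apply: wfiltW (wfilt_ev (wfilt_w _ _ _ _) kr); lia.
Qed.

(** These conditions say that the associated graded algebra is commutative and
    satisfies the relation w^2 = v^2 u - eps u^(n-1). *)
Definition reduced (eps : C) :=
  [/\ wfilt (n%:Z - 1) (lie u v), wfilt n%:Z (lie u w),
      wfilt (2 * n%:Z - 4) (lie v w) &
      wfilt (2 * n%:Z - 3) (w ^+ 2 - v ^+ 2 * u + eps *: u ^+ (n.-1))].

Variable eps : C.
Hypothesis n4 : (4 <= n)%N.
Hypothesis red : reduced eps.

Lemma reduced_lie i j x y : wfilt i x -> wfilt j y -> wfilt (i + j - 1) (lie x y).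
Proof.
case: red => h1 h2 h3 _; apply: wfilt_lie; first by apply: wfiltW h1; lia.
  by apply: wfiltW h2; lia.
by apply: wfiltW h3; lia.
Qed.

(** The leading part of the normal form of w^2. *)
Definition wsquare : {poly {poly C}} := 'X^2 * ('X)%:P - (eps *: 'X^(n.-1))%:P.

(** Moving m past the powers of u only costs commutators, which have lower
    weight. *)
Lemma ev_shift k a m p : wle k p -> wfilt a m ->
  wfilt (k + a - 1) (ev m p - ev 1 p * m).
Proof.
move=> kp am; rewrite /ev mulr_suml -sumrB; apply: wfilt_sum => j _.
have /wfilt_horner h : forall i : nat, k - (n%:Z - 2) * j%:Z < 2 * i%:Z -> p`_j`_i = 0.
  by move=> i hi; apply: kp; lia.
rewrite mulr1 -!mulrA -mulrBr.
apply: wfiltW (wfiltM (wfiltX j (wfilt_v _ _ _ _)) (reduced_lie am h)); lia.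
Qed.

Lemma ev_wsquare p : ev 1 (wsquare * p) = v ^+ 2 * ev 1 p * u - ev 1 p * (eps *: u ^+ (n.-1)).
Proof.
rewrite /wsquare mulrBl evB; congr (_ - _).
  by rewrite -[X in ev 1 X]mulrA evXn [_ * p]mulrC evMC horner_algX mulrA.
by rewrite mulrC evMC linearZ /= mulr_algl rmorphXn /= horner_algX.
Qed.

(** Up to lower weight, left multiplication by w turns v^j u^i into v^j w u^i,
    and v^j w u^i into v^j w^2 u^i, so it exchanges the two halves of a normal
    form and multiplies one of them by w^2. *)
Lemma mulw_nf k p r : wle k p -> wle (k - (n%:Z - 1)) r ->
  wfilt (k + n%:Z - 2) (w * nf p r - nf (wsquare * r) p).
Proof.
move=> kp kr; have ww := wfilt_w n u v w; have uu := wfilt_u n u v w.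
have vv := wfilt_v n u v w.
have ey : wfilt k (ev 1 p).
  by apply: wfiltW (wfilt_ev (Wfilt1 _ _ _ _ (lexx 0)) kp); lia.
have ez : wfilt (k - (n%:Z - 1)) (ev 1 r).
  by apply: wfiltW (wfilt_ev (Wfilt1 _ _ _ _ (lexx 0)) kr); lia.
rewrite /nf ev_wsquare; set y := ev 1 p in ey *; set z := ev 1 r in ez *.
pose X := w ^+ 2 - v ^+ 2 * u + eps *: u ^+ (n.-1).
have -> : w * (y + ev w r) - (v ^+ 2 * z * u - z * (eps *: u ^+ (n.-1)) + ev w p) =
   lie w y - (ev w p - y * w) + w * (ev w r - z * w) + lie w z * w + z * X
   - lie (v ^+ 2) z * u.
  by rewrite /X /lie !expr2; ncring.
have dy : wfilt (k + n%:Z - 2) (ev w p - y * w).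
  by apply: wfiltW (ev_shift kp ww); lia.
have dz := ev_shift kr ww.
have vv2 : wfilt (2 * (n%:Z - 2)) (v ^+ 2) by apply: wfiltX.
apply: wfiltB; first apply: wfiltD; first apply: wfiltD; first apply: wfiltD;
  first apply: wfiltB => //.
- by apply: wfiltW (reduced_lie ww ey); lia.
- by apply: wfiltW (wfiltM ww dz); lia.
- by apply: wfiltW (wfiltM (reduced_lie ww ez) ww); lia.
- by case: red => _ _ _ hX; apply: wfiltW (wfiltM ez hX); lia.
- by apply: wfiltW (wfiltM (reduced_lie vv2 ez) uu); lia.
Qed.

Lemma wle_wsquare : wle (2 * n%:Z - 2) wsquare.
Proof.
apply: wleB.
  by apply: wleW (wleM (wleXn (m := 2) (@wleX C n)) (@wleCX C n)); lia.
apply: wleC => i h; rewrite coefZ coefXn; case: eqP h => [->|]; last by rewrite mulr0.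
lia.
Qed.

Definition nf_le k x := exists p r, [/\ x = nf p r, wle k p & wle (k - (n%:Z - 1)) r].

Lemma nf_leD k x y : nf_le k x -> nf_le k y -> nf_le k (x + y).
Proof.
move=> [p [r [-> kp kr]]] [q [s [-> kq ks]]]; exists (p + q), (r + s).
by rewrite nfD; split=> //; apply: wleD.
Qed.

Lemma nf_leZ k a x : nf_le k x -> nf_le k (a *: x).
Proof.
move=> [p [r [-> kp kr]]]; exists (a%:P%:P * p), (a%:P%:P * r).
have ha l q : wle l q -> wle l (a%:P%:P * q).
  by move=> lq; rewrite -[l]add0r; apply: wleM => //; apply: wleCC.
by rewrite nfZ; split=> //; apply: ha.
Qed.

Lemma nf_leW k l x : k <= l -> nf_le k x -> nf_le l x.
Proof.
by move=> kl [p [r [-> kp kr]]]; exists p, r; split=> //;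
  [apply: wleW kp | apply: wleW kr; rewrite lerB].
Qed.

(** Rewriting into normal form terminates because every correction term has
    smaller weight: the outer induction is on the weight, the inner one on the
    construction of x as an element of the filtration. *)
Lemma nf_leP k x : wfilt k x -> nf_le k x.
Proof.
have IH : forall (N : nat) k x, k < N%:Z -> wfilt k x -> nf_le k x; last first.
  by move=> kx; apply: (IH `|k|%N.+1) kx; lia.
elim=> [|N IH] {}k {}x.
  move=> k0 /(wfilt_lt0 (ltnW (ltnW n4)) k0) ->; exists 0, 0.
  by rewrite nf0; split=> //; apply: wle0.
move=> + kx; elim: kx => {k x} [k|k k0|k c x y _ IHx _ IHy|
  k x kx IHx|k x kx IHx|k x kx IHx] kN.
- by exists 0, 0; rewrite nf0; split=> //; apply: wle0.
- exists 1, 0; rewrite /nf ev0 addr0; split; [|exact: wleCC|exact: wle0].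
  by rewrite evC rmorph1 mulr1.
- by apply: nf_leD; [apply: nf_leZ; apply: IHx | apply: IHy].
- have -> : u * x = x * u + lie u x by rewrite /lie addrC subrK.
  apply: nf_leD.
    have [|p [r [-> kp kr]]] := IHx; first lia.
    exists (p * ('X)%:P), (r * ('X)%:P); rewrite nfMC horner_algX; split=> //.
      by apply: wleW (wleM kp (@wleCX C n)); lia.
    by apply: wleW (wleM kr (@wleCX C n)); lia.
  have := reduced_lie (wfilt_u n u v w) kx => h.
  by apply: (@nf_leW (k - 1)); [lia | apply: IH; [lia | apply: wfiltW h; lia]].
- have [|p [r [-> kp kr]]] := IHx; first lia.
  exists ('X * p), ('X * r); rewrite nfX; split=> //.
    by apply: wleW (wleM (@wleX C n) kp); lia.
  by apply: wleW (wleM (@wleX C n) kr); lia.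
have [|p [r [-> kp kr]]] := IHx; first lia.
have h := mulw_nf kp kr.
rewrite -(subrK (nf (wsquare * r) p) (w * nf p r)); apply: nf_leD.
  by apply: (@nf_leW (k - 1)); [lia | apply: IH; [lia | apply: wfiltW h; lia]].
exists (wsquare * r), p; split=> //.
by apply: wleW (wleM wle_wsquare kr); lia.
Qed.

(** By freeness the short normal form provided by the filtration is the given
    one. *)
Lemma nf_wle k p r : nf_free -> wfilt k (nf p r) -> wle k p /\ wle (k - (n%:Z - 1)) r.
Proof.
by move=> free /nf_leP [q [s [/(nf_inj free) [-> ->] kq ks]]].
Qed.

End NormalForm.

(** * Change of generators *)

Section Rescale.
Variables (C : fieldType) (A : algType C) (n : nat).
Variables (a b d : C).
Hypotheses (a0 : a != 0) (b0 : b != 0) (d0 : d != 0).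

Definition rescale_coef (c : {poly C}) : {poly C} := \poly_(i < size c) (c`_i * a ^+ i).

(** The effect on coefficients of scaling u, v and the middle factor by a, b
    and k. *)
Definition rescale (k : C) (p : {poly {poly C}}) : {poly {poly C}} :=
  \poly_(j < size p) ((k * b ^+ j) *: rescale_coef p`_j).

Lemma coef_rescale k p i j : (rescale k p)`_j`_i = p`_j`_i * a ^+ i * (k * b ^+ j).
Proof.
rewrite coef_poly; case: ltnP => jp; last by rewrite [p`_j]nth_default // !coef0 !mul0r.
rewrite coefZ coef_poly mulrC; case: ltnP => // ip.
by rewrite [p`_j`_i]nth_default // !mul0r.
Qed.

Lemma wle_rescale k l p : k != 0 -> weight_le n l (rescale k p) -> weight_le n l p.
Proof.
move=> k0 h i j lij; have /eqP := h i j lij; rewrite coef_rescale !mulf_eq0.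
by rewrite (negPf k0) !expf_eq0 (negPf a0) (negPf b0) !andbF !orbF => /eqP.
Qed.

Lemma horner_rescale (u : A) c : (rescale_coef c).<[u]> = c.<[a *: u]>.
Proof.
have s : (size (rescale_coef c) <= size c)%N by apply: size_poly.
rewrite !horner_coef_alg (big_ord_widen _ (fun i => (rescale_coef c)`_i *: u ^+ i) s).
rewrite big_mkcond /=; apply: eq_bigr => i _.
rewrite /rescale_coef coef_poly ltn_ord exprZn scalerA.
case: ifP => // h; have : (rescale_coef c)`_i = 0.
  by apply: nth_default; rewrite leqNgt h.
by rewrite coef_poly ltn_ord => ->; rewrite scale0r.
Qed.

Lemma polyev_rescale (u v m : A) k p :
  polyev (a *: u) (b *: v) (k *: m) p = polyev u v m (rescale k p).
Proof.
have s : (size (rescale k p) <= size p)%N by apply: size_poly.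
rewrite (ev_widen _ _ _ s) /polyev; apply: eq_bigr => j _.
rewrite coef_poly ltn_ord linearZ /= mulr_algl -scalerAr.
rewrite horner_rescale.
by rewrite exprZn -scalerAr -!scalerAl scalerA.
Qed.

End Rescale.

Section Perturbation.
Variables (C : fieldType) (A : algType C) (n : nat) (u v w : A) (eps : C).
Hypothesis n4 : (4 <= n)%N.
Hypothesis red : reduced n u v w eps.
Hypothesis free : nf_free u v w.
Local Notation wfilt := (weight_filt n u v w).
Local Notation wle := (@weight_le C n).

(** Equality of the parts of weight k. *)
Definition eqtop (k : int) (x y : A) := [/\ wfilt k x, wfilt k y & wfilt (k - 1) (x - y)].

Lemma eqtop_refl k x : wfilt k x -> eqtop k x x.
Proof. by split=> //; rewrite subrr; apply: Wfilt0. Qed.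

Lemma eqtopM k l x y x' y' : eqtop k x x' -> eqtop l y y' -> eqtop (k + l) (x * y) (x' * y').
Proof.
move=> [h1 h2 h3] [h1' h2' h3']; split; [exact: wfiltM|exact: wfiltM|].
have -> : x * y - x' * y' = (x - x') * y + x' * (y - y') by ncring.
apply: wfiltD; first by apply: wfiltW (wfiltM h3 h1'); lia.
by apply: wfiltW (wfiltM h2 h3'); lia.
Qed.

Lemma eqtopX k x x' j : eqtop k x x' -> eqtop (j%:Z * k) (x ^+ j) (x' ^+ j).
Proof.
move=> h; elim: j => [|j IH].
  by rewrite !expr0 mul0r; apply/eqtop_refl/Wfilt1.
by rewrite !exprS intS mulrDl mul1r; apply: eqtopM.
Qed.

Lemma eqtopZ k x x' c : eqtop k x x' -> eqtop k (c *: x) (c *: x').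
Proof.
move=> [h1 h2 h3]; split; [exact: wfiltZ|exact: wfiltZ|].
by rewrite -scalerBr; apply: wfiltZ.
Qed.

Lemma eqtopD k x x' y y' : eqtop k x x' -> eqtop k y y' -> eqtop k (x + y) (x' + y').
Proof.
move=> [h1 h2 h3] [h1' h2' h3']; split; [exact: wfiltD|exact: wfiltD|].
by rewrite opprD addrACA; apply: wfiltD.
Qed.

Lemma eqtop_sum k N (F G : 'I_N -> A) :
  (forall i, eqtop k (F i) (G i)) -> eqtop k (\sum_i F i) (\sum_i G i).
Proof.
by move=> h; elim/big_ind2: _ => //; [apply/eqtop_refl/Wfilt0 | move=> *; apply: eqtopD].
Qed.

Lemma eqtopW k l x x' : k <= l -> eqtop k x x' -> eqtop l x x'.
Proof.
by move=> kl [h1 h2 h3]; split; [apply: wfiltW h1|apply: wfiltW h2|apply: wfiltW h3; lia].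
Qed.

Variables (a b d : C).
Hypotheses (a0 : a != 0) (b0 : b != 0) (d0 : d != 0).
Variables (u1 v1 w1 : A).
Hypothesis hu : wfilt 1 (u1 - a *: u).
Hypothesis hv : wfilt (n%:Z - 3) (v1 - b *: v).
Hypothesis hw : wfilt (n%:Z - 2) (w1 - d *: w).
Local Notation wfilt1 := (weight_filt n u1 v1 w1).

Lemma eqtop_of k x y : wfilt k y -> wfilt (k - 1) (x - y) -> eqtop k x y.
Proof.
move=> ky h; split=> //; rewrite -(subrK y x); apply: wfiltD => //.
by apply: wfiltW h; lia.
Qed.

Let eu : eqtop 2 u1 (a *: u).
Proof. by apply: eqtop_of; [apply/wfiltZ/wfilt_u | apply: wfiltW hu; lia]. Qed.
Let ev : eqtop (n%:Z - 2) v1 (b *: v).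
Proof. by apply: eqtop_of; [apply/wfiltZ/wfilt_v | apply: wfiltW hv; lia]. Qed.
Let ew : eqtop (n%:Z - 1) w1 (d *: w).
Proof. by apply: eqtop_of; [apply/wfiltZ/wfilt_w | apply: wfiltW hw; lia]. Qed.

(** A change of generators that is triangular for the weight can be inverted
    by induction on the weight. *)
Lemma perturb_wfilt k x : wfilt1 k x <-> wfilt k x.
Proof.
split.
  have [u1f _ _] := eu; have [v1f _ _] := ev; have [w1f _ _] := ew.
  elim=> {k x} [k|k k0|k c x y _ IHx _ IHy|k x _ IHx|k x _ IHx|k x _ IHx].
  - exact: Wfilt0.
  - exact: Wfilt1.
  - exact: WfiltP.
  - by apply: wfiltW (wfiltM u1f IHx); lia.
  - by apply: wfiltW (wfiltM v1f IHx); lia.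
  - by apply: wfiltW (wfiltM w1f IHx); lia.
have IH : forall (N : nat) k x, k < N%:Z -> wfilt k x -> wfilt1 k x; last first.
  by move=> kx; apply: (IH `|k|%N.+1) kx; lia.
have n2 : (1 < n)%N by lia.
(* A generator y is a combination of its replacement y1 and of an element of
   lower weight, to which the induction hypothesis applies. *)
have solve (N : nat) (c : C) (y y1 z : A) (k' i : int) : c != 0 ->
    (forall l t, l < N%:Z -> wfilt l t -> wfilt1 l t) -> k' < N.+1%:Z ->
    wfilt (i - 1) (y1 - c *: y) -> wfilt1 i y1 -> wfilt (k' - i) z ->
    wfilt1 (k' - i) z -> wfilt1 k' (y * z).
  move=> c0 IH kN hy y1i zk zk1; have [ki|ik] := ltP k' i.
    have -> : z = 0 by apply: wfilt_lt0 zk => //; lia.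
    by rewrite mulr0; apply: Wfilt0.
  have hy1 : wfilt1 (i - 1) (y1 - c *: y) by apply: IH => //; lia.
  have -> : y = c^-1 *: (y1 - (y1 - c *: y)) by rewrite opprB addrC subrK scalerA mulVf // scale1r.
  rewrite (_ : k' = i + (k' - i)); last by lia.
  apply: wfiltM => //; apply: wfiltZ; apply: wfiltB => //.
  by apply: wfiltW hy1; lia.
elim=> [|N IH] {}k {}x.
  by move=> k0 /(wfilt_lt0 n2 k0) ->; apply: Wfilt0.
move=> + kx; elim: kx => {k x} [k|k k0|k c x y _ IHx _ IHy|
  k x kx IHx|k x kx IHx|k x kx IHx] kN.
- exact: Wfilt0.
- exact: Wfilt1.
- by apply: WfiltP; auto.
- apply: (solve N a u u1 x k 2 a0 IH kN) => //; first exact: wfilt_u.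
  by apply: IHx; lia.
- apply: (solve N b v v1 x k _ b0 IH kN _ (wfilt_v _ _ _ _) kx).
    by apply: wfiltW hv; lia.
  by apply: IHx; lia.
- apply: (solve N d w w1 x k _ d0 IH kN _ (wfilt_w _ _ _ _) kx).
    by apply: wfiltW hw; lia.
  by apply: IHx; lia.
Qed.

Lemma eqtop_polyev k l m m' p : eqtop l m m' -> wle k p ->
  eqtop (k + l) (polyev u1 v1 m p) (polyev (a *: u) (b *: v) m' p).
Proof.
move=> hm kp; rewrite /polyev; apply: eqtop_sum => j.
rewrite !horner_coef_alg !mulr_sumr; apply: eqtop_sum => i.
have [kij|ijk] := ltP k (2 * i%:Z + (n%:Z - 2) * j%:Z).
  by rewrite kp // !scale0r !mulr0; apply/eqtop_refl/Wfilt0.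
rewrite -!scalerAr; apply: eqtopZ.
apply: eqtopW (eqtopM (eqtopM (eqtopX j ev) hm) (eqtopX i eu)); lia.
Qed.

(** The part of top weight of a relation between the new generators is a
    rescaled relation between the old ones, so the coefficients of top weight
    vanish. *)
Lemma perturb_nf_free : nf_free u1 v1 w1.
Proof.
have n2 : (2 <= n)%N by lia.
have main (N : nat) p r : wle (N%:Z - 1) p -> wle (N%:Z - n%:Z) r ->
    nf u1 v1 w1 p r = 0 -> p = 0 /\ r = 0.
  elim: N p r => [|N IH] p r kp kr nf0.
    by split; [apply: wle_lt0 kp | apply: wle_lt0 kr] => //; lia.
  have [_ _ h1] := eqtop_polyev (eqtop_refl (Wfilt1 _ _ _ _ (lexx 0))) kp.
  have [_ _ h2] := eqtop_polyev ew kr.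
  have h : wfilt (N%:Z - 1) (nf u1 v1 w1 p r - nf (a *: u) (b *: v) (d *: w) p r).
    rewrite /nf opprD addrACA; apply: wfiltD.
      by apply: wfiltW h1; lia.
    by apply: wfiltW h2; lia.
  have : wfilt (N%:Z - 1) (nf u v w (rescale a b 1 p) (rescale a b d r)).
    rewrite /nf -!polyev_rescale scale1r -/(nf (a *: u) (b *: v) (d *: w) p r).
    by rewrite -[nf _ _ _ _ _]opprK; apply: wfiltN; move: h; rewrite nf0 sub0r.
  move=> /(nf_wle n4 red free) [].
  move=> /(wle_rescale a0 b0 (oner_neq0 _)) kp' /(wle_rescale a0 b0 d0) kr'.
  by apply: IH => //; apply: wleW kr'; lia.
move=> p r; have [k kp] := wle_exhaustive p n2; have [l lr] := wle_exhaustive r n2.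
apply: (main (k + l + n).+1); first by apply: wleW kp; lia.
by apply: wleW lr; lia.
Qed.

(** The condition d^2 = b^2 a lets w^2 and v^2 u scale by the same factor. *)
Lemma perturb_reduced eps1 : d ^+ 2 = b ^+ 2 * a -> eps1 * a ^+ (n.-1) = d ^+ 2 * eps ->
  reduced n u1 v1 w1 eps1.
Proof.
move=> dba eps1E; have [u1f _ _] := eu; have [v1f _ _] := ev; have [w1f _ _] := ew.
split; apply/perturb_wfilt.
- by apply: wfiltW (reduced_lie n4 red u1f v1f); lia.
- by apply: wfiltW (reduced_lie n4 red u1f w1f); lia.
- by apply: wfiltW (reduced_lie n4 red v1f w1f); lia.
have [_ _ h1] := eqtopX 2 ew.
have [_ _ h2] := eqtopM (eqtopX 2 ev) eu.
have [_ _ h3] := eqtopZ eps1 (eqtopX n.-1 eu).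
have [_ _ _ h4] := red; have h5 := wfiltZ (d ^+ 2) h4.
have -> : w1 ^+ 2 - v1 ^+ 2 * u1 + eps1 *: u1 ^+ n.-1 =
  (w1 ^+ 2 - (d *: w) ^+ 2) - (v1 ^+ 2 * u1 - (b *: v) ^+ 2 * (a *: u)) +
  (eps1 *: u1 ^+ n.-1 - eps1 *: (a *: u) ^+ n.-1) +
  d ^+ 2 *: (w ^+ 2 - v ^+ 2 * u + eps *: u ^+ n.-1).
  rewrite !exprZn -scalerAl -scalerAr !scalerA -dba eps1E scalerDr scalerBr scalerA.
  move: (d ^+ 2 *: _) (d ^+ 2 *: _) (_ *: u ^+ _) => x1 x2 x3.
  move: (_ *: u1 ^+ _) (w1 ^+ 2) (v1 ^+ 2) => x4 x5 x6; ncring.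
apply: wfiltD => //; apply: wfiltD; first apply: wfiltB.
- by apply: wfiltW h1; lia.
- by apply: wfiltW h2; lia.
- by apply: wfiltW h3; lia.
Qed.

End Perturbation.

(** * Algebras presented by rho, P and Q *)

Section Relations.
Variables (C : fieldType).

(** Together with the basis of normal forms these relations determine all
    products, so rho, P and Q are the only parameters. *)
Definition Drel (A : algType C) (rho : C) (P Q : {poly C}) (u v w : A) :=
  [/\ lie u v = v + w *+ 2,
      lie u w = (v * u) *+ 2 + w + rho%:A,
      lie v w = P.<[u]> - v ^+ 2 &
      w ^+ 2 = v ^+ 2 * u + v * w + rho *: v - Q.<[u]>].

Lemma Drel_reduced (A : algType C) n rho (P Q : {poly C}) (u v w : A) : (4 <= n)%N ->
  (size P <= n.-1)%N -> (size Q <= n)%N -> Drel rho P Q u v w ->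
  reduced n u v w Q`_(n.-1).
Proof.
move=> n4 sP sQ [h1 h2 h3 h4].
have uu := wfilt_u n u v w; have vv := wfilt_v n u v w; have ww := wfilt_w n u v w.
have vu := wfiltM vv uu; have vw := wfiltM vv ww; have v2 := wfiltX 2 vv.
have c0 : weight_filt n u v w 0 rho%:A by apply: wfilt_alg.
split.
- rewrite h1 mulr2n; apply: wfiltD; first by apply: wfiltW vv; lia.
  by apply: wfiltD.
- rewrite h2 mulr2n; apply: wfiltD; last by apply: wfiltW c0; lia.
  apply: wfiltD; last by apply: wfiltW ww; lia.
  by apply: wfiltD; apply: wfiltW vu; lia.
- rewrite h3; apply: wfiltB; last by apply: wfiltW v2; lia.
  by apply: wfilt_horner => i hi; apply: nth_default; apply: leq_trans sP _; lia.
pose Q' := Q - Q`_(n.-1) *: 'X^(n.-1).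
have -> : w ^+ 2 - v ^+ 2 * u + Q`_(n.-1) *: u ^+ (n.-1) = v * w + rho *: v - Q'.<[u]>.
  rewrite h4 rmorphB /= linearZ /= mulr_algl rmorphXn /= horner_algX.
  move: (v ^+ 2 * u) (_ *: v) (Q.<[u]>) (_ *: _ ^+ _) => a b c d; ncring.
apply: wfiltB; first apply: wfiltD.
- by apply: wfiltW vw; lia.
- by apply: wfiltW (wfiltZ rho vv); lia.
apply: wfilt_horner => i hi; rewrite coefB coefZ coefXn.
case: eqP => [->|]; first by rewrite mulr1 subrr.
move=> ni; rewrite mulr0 subr0 nth_default //; apply: leq_trans sQ _; lia.
Qed.

Lemma polyev_morph (A B : algType C) (f : {lrmorphism A -> B}) u v m p :
  f (polyev u v m p) = polyev (f u) (f v) (f m) p.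
Proof.
rewrite /polyev rmorph_sum /=; apply: eq_bigr => j _; rewrite !rmorphM rmorphXn /=.
congr (_ * _); rewrite !horner_coef_alg linear_sum; apply: eq_bigr => i _.
by rewrite linearZ rmorphXn.
Qed.

Lemma nf_morph (A B : algType C) (f : {lrmorphism A -> B}) u v w p r :
  f (nf u v w p r) = nf (f u) (f v) (f w) p r.
Proof. by rewrite /nf raddfD /= !polyev_morph rmorph1. Qed.

Lemma horner_alg_morph (A B : algType C) (f : {lrmorphism A -> B}) u (c : {poly C}) :
  f c.<[u]> = c.<[f u]>.
Proof.
rewrite !horner_coef_alg linear_sum; apply: eq_bigr => i _.
by rewrite linearZ rmorphXn.
Qed.

Lemma lrmorphism_of (A B : algType C) (f : A -> B) :
  linear f -> f 1 = 1 -> {morph f : x y / x * y} ->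
  exists g : {lrmorphism A -> B}, g =1 f.
Proof.
move=> fl f1 fM.
pose L := GRing.isLinear.Build C A B *:%R f fl.
pose M := GRing.isMonoidMorphism.Build A B f (f1, fM).
pose g : {lrmorphism A -> B} := HB.pack f L M.
by exists g.
Qed.

Section Pair.
Variables (A B : algType C) (rho : C) (P Q : {poly C}).
Variables (u v w : A) (u' v' w' : B).

Let fstL : {lrmorphism (A * B)%type -> A} := fst.
Let sndL : {lrmorphism (A * B)%type -> B} := snd.

Lemma horner_pair (c : {poly C}) : c.<[(u, u')]> = (c.<[u]>, c.<[u']>).
Proof.
rewrite [LHS]surjective_pairing.
by rewrite -[_.1]/(fstL _) -[_.2]/(sndL _) !horner_alg_morph.
Qed.

Lemma nf_pair p r : nf (u, u') (v, v') (w, w') p r = (nf u v w p r, nf u' v' w' p r).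
Proof.
rewrite [LHS]surjective_pairing.
by rewrite -[_.1]/(fstL _) -[_.2]/(sndL _) !nf_morph.
Qed.

Lemma Drel_pair : Drel rho P Q u v w -> Drel rho P Q u' v' w' ->
  @Drel (A * B)%type rho P Q (u, u') (v, v') (w, w').
Proof.
move=> [h1 h2 h3 h4] [h1' h2' h3' h4'].
split; rewrite ?horner_pair; apply: injective_projections => //=.
Qed.

End Pair.

Section Isomorphism.
Variables (n : nat) (rho : C) (P Q : {poly C}).
Hypotheses (n4 : (4 <= n)%N) (sP : (size P <= n.-1)%N) (sQ : (size Q <= n)%N).

(** The index is halved because the generators have even degree: an odd step
    of the filtration adds nothing. *)
Definition coordinates (A : filtAlg C) (u v w : A) :=
  nf_free u v w /\
  forall k x, filt k x <-> weight_filt n u v w k./2%:Z x.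

Lemma wfilt_nf_exists (A : algType C) (u v w : A) p r :
  exists k, weight_filt n u v w k (nf u v w p r).
Proof.
have n2 : (2 <= n)%N by lia.
have [a pa] := wle_exhaustive p n2; have [b rb] := wle_exhaustive r n2.
exists (a%:Z + b%:Z + n%:Z); apply: wfilt_nf.
  by apply: wleW pa; lia.
by apply: wleW rb; lia.
Qed.

Lemma nf_exists (A : filtAlg C) (u v w : A) :
  coordinates u v w -> Drel rho P Q u v w ->
  forall k x, filt k x <-> nf_le n u v w k./2%:Z x.
Proof.
move=> [_ fA] /(Drel_reduced n4 sP sQ) red k x; rewrite fA.
split; first by move=> /(nf_leP n4 red).
by case=> p [r [-> kp kr]]; apply: wfilt_nf.
Qed.

Section Map.
Variables (A B : filtAlg C) (u v w : A) (u' v' w' : B).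
Hypotheses (cA : coordinates u v w) (cB : coordinates u' v' w').
Hypotheses (rA : Drel rho P Q u v w) (rB : Drel rho P Q u' v' w').

(** Sending a normal form to the same expression in the other generators is
    multiplicative. In the product algebra the pairs of generators satisfy the
    relations as well, so a product of normal forms in the pairs is again a
    normal form in the pairs, and its two components have the same
    coefficients. *)
Lemma nf_map : exists f : {lrmorphism A -> B},
  forall p r, f (nf u v w p r) = nf u' v' w' p r.
Proof.
have ex (x : A) : exists pr, x = nf u v w pr.1 pr.2.
  have [k /(nf_exists cA rA) [p [r [-> _ _]]]] := filt_exhaustive x.
  by exists (p, r).
have [c cE] := choice ex.
pose f x := nf u' v' w' (c x).1 (c x).2.
have fE p r : f (nf u v w p r) = nf u' v' w' p r.
  have [free _] := cA; rewrite /f.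
  by have [<- <-] := nf_inj free (cE (nf u v w p r)).
(* The graph of f consists of the normal forms in the pairs of generators. *)
have nfP x y pr : (x, y) = nf (u, u') (v, v') (w, w') pr.1 pr.2 -> f x = y.
  by rewrite nf_pair => -[-> ->]; rewrite fE.
have nff x : (x, f x) = nf (u, u') (v, v') (w, w') (c x).1 (c x).2.
  by rewrite nf_pair -cE.
have [] := @lrmorphism_of A B f.
- move=> a x y; apply: (nfP _ _ (a%:P%:P * (c x).1 + (c y).1, a%:P%:P * (c x).2 + (c y).2)).
  by rewrite nfD nfZ -!nff.
- apply: (nfP _ _ (1, 0)); rewrite /nf ev0 addr0.
  by rewrite evC rmorph1 mulr1.
- move=> x y.
  have red := Drel_reduced n4 sP sQ (Drel_pair rA rB).
  have [i hx] := wfilt_nf_exists (u, u') (v, v') (w, w') (c x).1 (c x).2.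
  have [j hy] := wfilt_nf_exists (u, u') (v, v') (w, w') (c y).1 (c y).2.
  have := wfiltM hx hy; rewrite -!nff => /(nf_leP n4 red) [p [r [e _ _]]].
  exact: (nfP _ _ (p, r)).
by move=> g gf; exists g => p r; rewrite gf fE.
Qed.

End Map.

Lemma filtered_iso_of_Drel (A B : filtAlg C) (u v w : A) (u' v' w' : B) :
  coordinates u v w -> coordinates u' v' w' ->
  Drel rho P Q u v w -> Drel rho P Q u' v' w' -> filtered_iso A B.
Proof.
move=> cA cB rA rB; have [f fE] := nf_map cA rA rB; have [g gE] := nf_map cB rB rA.
have fK : cancel f g.
  move=> x; have [k /(nf_exists cA rA) [p [r [-> _ _]]]] := filt_exhaustive x.
  by rewrite fE gE.
have gK : cancel g f.
  move=> x; have [k /(nf_exists cB rB) [p [r [-> _ _]]]] := filt_exhaustive x.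
  by rewrite gE fE.
exists f; split; first by exists g.
move=> k x; split=> [/(nf_exists cA rA)|/(nf_exists cB rB)] [p [r [e kp kr]]].
  by rewrite e fE; apply/(nf_exists cB rB); exists p, r.
by rewrite -[x]fK e gE; apply/(nf_exists cA rA); exists p, r.
Qed.

End Isomorphism.
End Relations.

(** * The relations of D(q) in the skew group algebra *)

Lemma eq_of_submul (F : fieldType) (k a b c : F) : c = 0 -> a - b = k * c -> a = b.
Proof. by move=> ->; rewrite mulr0 => /eqP; rewrite subr_eq0 => /eqP. Qed.

Section FieldIdentities.
Variables (F : fieldType) (x r s t P Q : F).
Hypothesis two : (2 : F) != 0.
Hypotheses (x0 : x != 0) (x1 : x + 1 != 0) (x1' : x - 1 != 0).
Hypotheses (x2 : 1 + 2 * x != 0) (x2' : 2 * x - 1 != 0).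
Hypotheses (x3 : 2 * x + 3 != 0) (x3' : 2 * x - 3 != 0).

Lemma four_neq0 : (4 : F) != 0.
Proof. by rewrite (natrM F 2 2) mulf_neq0. Qed.

Lemma den_neq0 : 1 - 4 * x ^+ 2 != 0.
Proof.
have -> : 1 - 4 * x ^+ 2 = - (1 + 2 * x) * (2 * x - 1) by ring.
by rewrite mulf_neq0 ?oppr_eq0.
Qed.

Lemma den_shift_neq0 : 1 - 4 * (x + 1) ^+ 2 != 0.
Proof.
have -> : 1 - 4 * (x + 1) ^+ 2 = - (1 + 2 * x) * (2 * x + 3) by ring.
by rewrite mulf_neq0 ?oppr_eq0.
Qed.

Lemma den_unshift_neq0 : 1 - 4 * (x - 1) ^+ 2 != 0.
Proof.
have -> : 1 - 4 * (x - 1) ^+ 2 = - (2 * x - 1) * (2 * x - 3) by ring.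
by rewrite mulf_neq0 ?oppr_eq0.
Qed.

Lemma s_formula f : 4 * f = r ^+ 2 + (1 + 2 * x) ^+ 2 * (Q + x * P) ->
  f / (x * (x + 1) * (1 + 2 * x) ^+ 2) = (r ^+ 2 + (1 + 2 * x) ^+ 2 * (Q + x * P)) /
    (4 * x * (x + 1) * (1 + 2 * x) ^+ 2).
Proof. by move=> <-; field; rewrite x0 x1 x2 four_neq0. Qed.

(** The same expression with x replaced by x - 1: the reflection x -> -x-1
    makes the numerator invariant, which accounts for the change of sign of P.
    *)
Lemma s_unshift_formula f : 4 * f = r ^+ 2 + (1 - 2 * x) ^+ 2 * (Q - x * P) ->
  f / ((x - 1) * (x - 1 + 1) * (1 + 2 * (x - 1)) ^+ 2) =
    (r ^+ 2 + (2 * x - 1) ^+ 2 * (Q - x * P)) /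
    (4 * x * (x - 1) * (2 * x - 1) ^+ 2).
Proof.
have -> : (1 - 2 * x) ^+ 2 = (2 * x - 1) ^+ 2 by ring.
have -> : 1 + 2 * (x - 1) = 2 * x - 1 by ring.
rewrite subrK => <-; field.
by rewrite x0 x1' x2' four_neq0.
Qed.

(* For x = h these are rho/(1-4h^2), s(h) and s(h-1), the last two expressed
   through P and Q. *)
Local Notation e := (r / (1 - 4 * x ^+ 2)).
Local Notation s' := ((r ^+ 2 + (1 + 2 * x) ^+ 2 * (Q + x * P)) /
    (4 * x * (x + 1) * (1 + 2 * x) ^+ 2)).
Local Notation g' := ((r ^+ 2 + (2 * x - 1) ^+ 2 * (Q - x * P)) /
    (4 * x * (x - 1) * (2 * x - 1) ^+ 2)).

Lemma e_identity : e * (1 - 4 * x ^+ 2) = r.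
Proof. by rewrite divfK // den_neq0. Qed.

Lemma e_shift_identity :
  e * (1 - 2 * x) + r / (1 - 4 * (x + 1) ^+ 2) * (2 * x + 3) = 0.
Proof. by field; rewrite den_shift_neq0 den_neq0. Qed.

Lemma e_unshift_identity :
  e * (1 + 2 * x) - r / (1 - 4 * (x - 1) ^+ 2) * (2 * x - 3) = 0.
Proof. by field; rewrite den_unshift_neq0 den_neq0. Qed.

(** The coefficient of the zeroth power of the group generator in [v,w] = P(u)
    - v^2, where the two fractions are s(h) and s(h-1). *)
Lemma lie_vw_identity :
  s' * (2 * x + 2) - g' * (2 * x - 2) + 4 * e ^+ 2 = P.
Proof. field. by rewrite den_neq0 x0 x1 x1' x2 x2' four_neq0. Qed.

(** The coefficient of the zeroth power of the group generator in the relation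
    for w^2. *)
Lemma square_w_identity :
  - (x - 1) * g' * x - s' * (x + 1) * x + e ^+ 2 =
  (g' + s' + 4 * e ^+ 2) * x ^+ 2 + (s' * x - g' * x - 2 * e ^+ 2) + 2 * r * e - Q.
Proof. field. by rewrite den_neq0 x0 x1 x1' x2 x2' four_neq0. Qed.

End FieldIdentities.

Section Skew.
Variable C : fieldType.
Local Notation skew := (Defs.skew C).
Local Notation ratfun := (ratfun C).
Local Notation S := (@ratfun_shift C 1).
Local Notation T := (@ratfun_shift C (-1)).
Local Notation h := ('X%:F : ratfun).

(** The element t a(h) + t^-1 b(h) + c(h), where t is the group generator.
    Each of u, v and w has this form. *)
Definition laurent (a b c : ratfun) : skew :=
  skew_mono 1 a + skew_mono (-1) b + skew_mono 0 c.

(** Products of two elements of the previous form also involve t^2 and t^-2.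
    *)
Definition laurent2 (a2 a1 c b1 b2 : ratfun) : skew :=
  skew_mono 2 a2 + skew_mono (-2) b2 + laurent a1 b1 c.

Lemma laurentE a b c : laurent a b c = skew_mono 1 a + skew_mono (-1) b + skew_mono 0 c.
Proof. by []. Qed.

Lemma laurentD a b c a' b' c' :
  laurent a b c + laurent a' b' c' = laurent (a + a') (b + b') (c + c').
Proof. by rewrite /laurent !raddfD /= addrACA [X in X + _]addrACA. Qed.

Lemma laurentN a b c : - laurent a b c = laurent (- a) (- b) (- c).
Proof. by rewrite /laurent !raddfN /= !opprD. Qed.

Lemma laurentZ k a b c :
  k *: laurent a b c = laurent (ratfunC k * a) (ratfunC k * b) (ratfunC k * c).
Proof. by rewrite /laurent !scalerDr !skew_monoZ. Qed.

Lemma laurent2D a2 a1 c b1 b2 a2' a1' c' b1' b2' :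
  laurent2 a2 a1 c b1 b2 + laurent2 a2' a1' c' b1' b2' =
  laurent2 (a2 + a2') (a1 + a1') (c + c') (b1 + b1') (b2 + b2').
Proof. by rewrite /laurent2 -laurentD !raddfD /= addrACA [X in X + _ = _]addrACA. Qed.

Lemma laurent2N a2 a1 c b1 b2 :
  - laurent2 a2 a1 c b1 b2 = laurent2 (- a2) (- a1) (- c) (- b1) (- b2).
Proof. by rewrite /laurent2 -laurentN !raddfN /= !opprD. Qed.

Lemma laurent_laurent2 a b c : laurent a b c = laurent2 0 a c b 0.
Proof. by rewrite /laurent2 !raddf0 !add0r. Qed.

Lemma laurentM a b c a' b' c' :
  laurent a b c * laurent a' b' c' =
  laurent2 (S a * a') (a * c' + S c * a') (T a * b' + S b * a' + c * c')
    (b * c' + T c * b') (T b * b').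
Proof.
rewrite /laurent2 /laurent !mulrDl !mulrDr !skew_monoM !ratfun_shift0 !raddfD /=.
move: (skew_mono 2 _) => x1; ncring.
Qed.

Lemma laurent_emb (f : ratfun) : skew_emb f = laurent 0 0 f.
Proof. by rewrite /laurent !raddf0 !add0r. Qed.

Lemma laurent2M0 a2 a1 c b1 b2 f :
  laurent2 a2 a1 c b1 b2 * laurent 0 0 f = laurent2 (a2 * f) (a1 * f) (c * f) (b1 * f) (b2 * f).
Proof.
rewrite -laurent_emb /laurent2 /laurent /skew_emb !mulrDl.
by rewrite !skew_monoM !ratfun_shift0 !addr0.
Qed.

Lemma laurent2Z k a2 a1 c b1 b2 : k *: laurent2 a2 a1 c b1 b2 =
  laurent2 (ratfunC k * a2) (ratfunC k * a1) (ratfunC k * c) (ratfunC k * b1) (ratfunC k * b2).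
Proof. by rewrite /laurent2 /laurent !scalerDr !skew_monoZ. Qed.

Lemma skew_embM (f g : ratfun) : skew_emb (f * g) = skew_emb f * skew_emb g.
Proof. by rewrite /skew_emb skew_monoM ratfun_shift0. Qed.

Lemma skew_embX (f : ratfun) k : skew_emb (f ^+ k) = skew_emb f ^+ k.
Proof. by elim: k => // k IH; rewrite !exprS skew_embM IH. Qed.

Lemma horner_skew_emb (f : {poly C}) (c : {poly C}) :
  c.<[skew_emb f%:F]> = skew_emb (c \Po f)%:F.
Proof.
rewrite horner_coef_alg comp_polyE rmorph_sum [in RHS]/skew_emb raddf_sum /=.
apply: eq_bigr => i _; rewrite -mul_polyC rmorphM rmorphXn /=.
by rewrite -skew_embX skew_monoZ.
Qed.

Lemma ratfun_shiftX j : ratfun_shift j h = h + (j%:~R)%:P%:F.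
Proof. by rewrite ratfun_shift_poly /poly_shift comp_polyX tofracD. Qed.

Lemma laurent2_eq a2 a1 c b1 b2 a2' a1' c' b1' b2' :
  a2 = a2' -> a1 = a1' -> c = c' -> b1 = b1' -> b2 = b2' ->
  laurent2 a2 a1 c b1 b2 = laurent2 a2' a1' c' b1' b2'.
Proof. by move=> -> -> -> -> ->. Qed.

Opaque laurent laurent2.

Section LaurentRelations.
Variables (x g s t e e1 e2 p0 q0 : ratfun) (rho : C) (P Q : {poly C}).
Local Notation r := (ratfunC rho).
Hypotheses (Sx : S x = x + 1) (Tx : T x = x - 1) (Sg : S g = s) (Tg : T g = t).
Hypotheses (Se : S e = e1) (Te : T e = e2).
Hypothesis He : e * (1 - 4 * x ^+ 2) = r.
Hypothesis H1 : e * (1 - 2 * x) + e1 * (2 * x + 3) = 0.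
Hypothesis H1' : e * (1 + 2 * x) - e2 * (2 * x - 3) = 0.
Hypothesis H0 : s * (2 * x + 2) - g * (2 * x - 2) + 4 * e ^+ 2 = p0.
Hypothesis Hw : - (x - 1) * g * x - s * (x + 1) * x + e ^+ 2 =
  (g + s + 4 * e ^+ 2) * x ^+ 2 + (s * x - g * x - 2 * e ^+ 2) + 2 * r * e - q0.

Let u := laurent 0 0 (x ^+ 2).
Let v := laurent 1 g (2 * e).
Let w := laurent x (- (g * x)) (- e).
Let S1 : S 1 = 1. Proof. exact: rmorph1. Qed.
Let T1 : T 1 = 1. Proof. exact: rmorph1. Qed.
Let S0 : S 0 = 0. Proof. exact: rmorph0. Qed.
Let T0 : T 0 = 0. Proof. exact: rmorph0. Qed.
Let Sx2 : S (x ^+ 2) = (x + 1) ^+ 2. Proof. by rewrite rmorphXn /= Sx. Qed.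
Let Tx2 : T (x ^+ 2) = (x - 1) ^+ 2. Proof. by rewrite rmorphXn /= Tx. Qed.
Let S2e : S (2 * e) = 2 * e1. Proof. by rewrite rmorphM rmorph_nat /= Se. Qed.
Let T2e : T (2 * e) = 2 * e2. Proof. by rewrite rmorphM rmorph_nat /= Te. Qed.
Let SNe : S (- e) = - e1. Proof. by rewrite rmorphN /= Se. Qed.
Let TNe : T (- e) = - e2. Proof. by rewrite rmorphN /= Te. Qed.
Let Sgx : S (- (g * x)) = - (s * (x + 1)). Proof. by rewrite rmorphN rmorphM /= Sx Sg. Qed.
Let Tgx : T (- (g * x)) = - (t * (x - 1)). Proof. by rewrite rmorphN rmorphM /= Tx Tg. Qed.

Lemma laurent_uv : u * v = laurent2 0 ((x + 1) ^+ 2) (2 * (x ^+ 2 * e)) ((x - 1) ^+ 2 * g) 0.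
Proof. by rewrite laurentM Sx2 Tx2 S0 T0 !mul0r mulr1 mulrCA !add0r. Qed.
Lemma laurent_vu : v * u = laurent2 0 (x ^+ 2) (2 * (e * x ^+ 2)) (g * x ^+ 2) 0.
Proof. by rewrite laurentM !mulr0 mul1r mulrA !addr0 !add0r. Qed.
Lemma laurent_uw : u * w = laurent2 0 ((x + 1) ^+ 2 * x) (- (x ^+ 2 * e)) (- ((x - 1) ^+ 2 * (g * x))) 0.
Proof. by rewrite laurentM Sx2 Tx2 S0 T0 !mul0r !mulrN !add0r. Qed.
Lemma laurent_wu : w * u = laurent2 0 (x * x ^+ 2) (- (e * x ^+ 2)) (- (g * x * x ^+ 2)) 0.
Proof. by rewrite laurentM !mulr0 !mulNr !addr0 !add0r. Qed.
Lemma laurent_vw : v * w = laurent2 x (- e + 2 * e1 * x) (- (g * x) + s * x - 2 * e ^+ 2)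
   (- (g * e) - 2 * e2 * (g * x)) (- (t * (g * x))).
Proof. by rewrite laurentM S1 S2e T1 Sg T2e Tg !mul1r !mulrN expr2 !mulrA. Qed.
Lemma laurent_wv : w * v = laurent2 (x + 1) (x * (2 * e) - e1) ((x - 1) * g - s * (x + 1) - e * (2 * e))
   (- (g * x) * (2 * e) - e2 * g) (- (t * (x - 1)) * g).
Proof. by rewrite laurentM Sx SNe Tx Sgx TNe Tgx !mulr1 !mulNr. Qed.
Lemma laurent_vv : v ^+ 2 = laurent2 1 (2 * e + 2 * e1) (g + s + 2 * e * (2 * e))
   (g * (2 * e) + 2 * e2 * g) (t * g).
Proof. by rewrite expr2 laurentM S1 S2e T1 Sg T2e Tg !mul1r !mulr1. Qed.
Lemma laurent_ww : w ^+ 2 = laurent2 ((x + 1) * x) (x * (- e) - e1 * x)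
   ((x - 1) * (- (g * x)) - s * (x + 1) * x + e ^+ 2)
   (g * x * e + e2 * (g * x)) (t * (x - 1) * (g * x)).
Proof. by rewrite expr2 laurentM Sx SNe Tx Sgx TNe Tgx !mulNr !mulrN !opprK expr2. Qed.

Hypothesis HP : P.<[u]> = skew_emb p0.
Hypothesis HQ : Q.<[u]> = skew_emb q0.

(* Only the relations between the coefficients matter, so the coefficients are
   taken in an arbitrary field. *)
Ltac abstract_field := move: He H1 H1' H0 Hw; move: r; clear;
  repeat match goal with y : ?U |- _ => lazymatch U with fieldType => fail | _ => revert y end end;
  move: (Defs.ratfun C) => F; clear; intros *;
  move=> He H1 H1' H0 Hw.

Let uvE : lie u v = v + w *+ 2.
Proof.
have -> : v + w *+ 2 = _ := etrans (congr1 (+%R v) (etrans (mulr2n w) (laurentD _ _ _ _ _ _)))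
   (etrans (laurentD _ _ _ _ _ _) (laurent_laurent2 _ _ _)).
rewrite /lie laurent_uv laurent_vu.
apply: etrans (congr1 (+%R _) (laurent2N _ _ _ _ _)) _.
apply: etrans (laurent2D _ _ _ _ _ _ _ _ _ _) _.
by apply: laurent2_eq; abstract_field; ring.
Qed.

Let sum2 y z y2 y1 y0 y1' y2' z2 z1 z0 z1' z2' : y = laurent2 y2 y1 y0 y1' y2' ->
  z = laurent2 z2 z1 z0 z1' z2' -> y + z = laurent2 (y2 + z2) (y1 + z1) (y0 + z0) (y1' + z1') (y2' + z2').
Proof. by move=> -> ->; apply: laurent2D. Qed.

Let opp2 y y2 y1 y0 y1' y2' : y = laurent2 y2 y1 y0 y1' y2' ->
  - y = laurent2 (- y2) (- y1) (- y0) (- y1') (- y2').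
Proof. by move=> ->; apply: laurent2N. Qed.

Let uwE : lie u w = (v * u) *+ 2 + w + rho%:A.
Proof.
have E1 := sum2 laurent_vu laurent_vu.
have E2 : w = laurent2 0 x (- e) (- (g * x)) 0 := laurent_laurent2 _ _ _.
have E3 : rho%:A = laurent2 0 0 (r * 1) 0 0 :> Defs.skew C.
  have E : 1 = laurent2 0 0 1 0 0 :> Defs.skew C.
    exact: etrans (laurent_emb 1) (laurent_laurent2 _ _ _).
  apply: etrans (congr1 ( *:%R rho) E) _; apply: etrans (laurent2Z _ _ _ _ _ _) _.
  by apply: laurent2_eq => //; exact: mulr0.
rewrite mulr2n; apply: etrans _ (esym (sum2 (sum2 E1 E2) E3)).
apply: etrans (sum2 laurent_uw (opp2 laurent_wu)) _.
apply: laurent2_eq; abstract_field.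
all: try ring.
by rewrite -He; ring.
Qed.

Let vwE : lie v w = P.<[u]> - v ^+ 2.
Proof.
have E := etrans HP (etrans (laurent_emb _) (laurent_laurent2 _ _ _)).
apply: etrans _ (esym (sum2 E (opp2 laurent_vv))).
apply: etrans (sum2 laurent_vw (opp2 laurent_wv)) _.
apply: laurent2_eq; abstract_field.
all: try ring.
- by apply: (eq_of_submul (k := 1) H1); ring.
- by rewrite -H0; ring.
- by apply: (eq_of_submul (k := g) H1'); ring.
Qed.

Let wwE : w ^+ 2 = v ^+ 2 * u + v * w + rho *: v - Q.<[u]>.
Proof.
have E := etrans HQ (etrans (laurent_emb _) (laurent_laurent2 _ _ _)).
have E1 : rho *: v = _ := etrans (laurentZ _ _ _ _) (laurent_laurent2 _ _ _).
have E2 : v ^+ 2 * u = _ := etrans (congr1 (fun y => y * u) laurent_vv) (laurent2M0 _ _ _ _ _ _).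
apply: etrans _ (esym (sum2 (sum2 (sum2 E2 laurent_vw) E1) (opp2 E))).
apply: etrans laurent_ww _.
apply: laurent2_eq; abstract_field.
all: try ring.
- by apply: (eq_of_submul (k := - x) H1); rewrite -He; ring.
- by apply: etrans _ (etrans Hw _); ring.
- by apply: (eq_of_submul (k := g * x) H1'); rewrite -He; ring.
Qed.

(** Comparing coefficients of the powers of the group generator turns each
    relation into identities between rational functions, which follow from the
    hypotheses. *)
Lemma laurent_Drel : Drel rho P Q u v w.
Proof. by split. Qed.

End LaurentRelations.

Section Relations.
Variables (q P Q : {poly C}).
Hypothesis two : (2 : C) != 0.
Local Notation rho := (Dq_rho q).
Local Notation r := (ratfunC rho).
Hypothesis qPQ : 4%:P * (q * (q \Po (- 'X - 1))) =
  (rho ^+ 2)%:P + (1 + 2%:P * 'X) ^+ 2 * ((Q \Po 'X^2) + 'X * (P \Po 'X^2)).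

Local Notation sigma := (T (Dq_s q)).
Local Notation e := (r / (1 - 4 * h ^+ 2)).

Lemma Dq_uE : Dq_u C = laurent 0 0 (h ^+ 2).
Proof. exact: laurent_emb. Qed.

Lemma Dq_bE : Dq_b q = skew_mono (-1) sigma.
Proof. by rewrite /Dq_b /skew_emb skew_monoM mulr1. Qed.

Lemma Dq_vE : Dq_v q = laurent 1 sigma (2 * e).
Proof. by rewrite laurentE /Dq_v Dq_bE mulrA. Qed.

Lemma Dq_wE : Dq_w q = laurent h (- (sigma * h)) (- e).
Proof.
rewrite laurentE /Dq_w Dq_bE mulrBl /Dq_a /skew_emb !skew_monoM !ratfun_shift0.
by rewrite !raddfN mul1r.
Qed.

Lemma ratfun2_neq0 : (2 : ratfun) != 0.
Proof.
have -> : 2 = (2%:P : {poly C})%:F by rewrite !rmorph_nat.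
by rewrite tofrac_eq0 polyC_eq0.
Qed.

Lemma affine_neq0 (a b : C) : a != 0 -> ratfunC a * h + ratfunC b != 0.
Proof.
move=> a0; rewrite -tofracM -tofracD tofrac_eq0 -size_poly_eq0.
by rewrite -cons_poly_def size_cons_poly nil_poly polyC_eq0 (negPf a0).
Qed.

Definition P_sqr : ratfun := (P \Po 'X^2)%:F.
Definition Q_sqr : ratfun := (Q \Po 'X^2)%:F.

Lemma tofrac2 : (2%:P)%:F = 2 :> ratfun. Proof. by rewrite !rmorph_nat. Qed.
Lemma tofrac4 : (4%:P)%:F = 4 :> ratfun. Proof. by rewrite !rmorph_nat. Qed.

Lemma h_neq0 : h != 0. Proof. by rewrite tofrac_eq0 polyX_eq0. Qed.

Lemma intaffine_neq0 (a b : int) : (a%:~R : C) != 0 -> a%:~R * h + b%:~R != 0.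
Proof. by move=> /(affine_neq0 b%:~R); rewrite /ratfunC !rmorph_int. Qed.

Lemma h1_neq0 : h + 1 != 0.
Proof. by have := @intaffine_neq0 1 1; rewrite mul1r; apply; apply: oner_neq0. Qed.
Lemma h1'_neq0 : h - 1 != 0.
Proof. by have := @intaffine_neq0 1 (-1); rewrite mul1r; apply; apply: oner_neq0. Qed.
Lemma h2_neq0 : 1 + 2 * h != 0. Proof. by rewrite addrC; apply: (@intaffine_neq0 2 1). Qed.
Lemma h2'_neq0 : 2 * h - 1 != 0. Proof. by apply: (@intaffine_neq0 2 (-1)). Qed.
Lemma h3_neq0 : 2 * h + 3 != 0. Proof. by apply: (@intaffine_neq0 2 3). Qed.
Lemma h3'_neq0 : 2 * h - 3 != 0. Proof. by apply: (@intaffine_neq0 2 (-3)). Qed.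

Lemma shift_h : S h = h + 1. Proof. by rewrite ratfun_shiftX. Qed.
Lemma unshift_h : T h = h - 1.
Proof. by rewrite ratfun_shiftX mulrN1z polyCN tofracN. Qed.

Lemma Dq_sE : Dq_s q = (r ^+ 2 + (1 + 2 * h) ^+ 2 * (Q_sqr + h * P_sqr)) /
    (4 * h * (h + 1) * (1 + 2 * h) ^+ 2).
Proof.
apply: (s_formula ratfun2_neq0 h_neq0 h1_neq0 h2_neq0).
have := congr1 (@FracField.tofrac _) qPQ.
rewrite !(tofracM, tofracD, tofracXn) tofrac4 tofrac2 tofrac1.
by move=> ->; rewrite /ratfunC rmorphXn tofracXn.
Qed.

Lemma unshift_den : T (h * (h + 1) * (1 + 2 * h) ^+ 2) =
  (h - 1) * (h - 1 + 1) * (1 + 2 * (h - 1)) ^+ 2.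
Proof.
rewrite rmorphM rmorphXn rmorphM /=.
by rewrite [T (h + 1)]rmorphD [T (1 + _)]rmorphD /= [T (2 * _)]rmorphM /= rmorph1 rmorph_nat unshift_h.
Qed.

(** The hypothesis on q at -x, where q(-x) q(x-1) is the numerator of s(x-1).
    *)
Lemma unshift_num : 4 * T (q * (q \Po (- 'X - 1)))%:F = r ^+ 2 + (1 - 2 * h) ^+ 2 * (Q_sqr - h * P_sqr).
Proof.
rewrite ratfun_shift_poly /poly_shift mulrN1z polyCN.
have e := congr1 (fun p => p \Po (- 'X)) qPQ; move: e.
rewrite !(comp_polyM, comp_polyD, comp_polyC, comp_polyX, rmorphXn) /=.
rewrite -!comp_polyA !(comp_polyD, comp_polyB, comp_polyC, comp_polyX, comp_Xn_poly, rmorphN1, rmorphN) /=.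
rewrite !comp_polyX => /(congr1 (@FracField.tofrac _)) e.
move: e; rewrite opprK sqrrN mulrN -expr2 polyC1 opprB addrAC subrr add0r.
rewrite [_ * (q \Po ('X - 1))]mulrC => e.
rewrite -tofrac4 -tofracM e mulNr.
by rewrite !(tofracM, tofracD, tofracN, tofracXn) tofrac2 tofrac1.
Qed.

Lemma unshift_s : sigma = (r ^+ 2 + (2 * h - 1) ^+ 2 * (Q_sqr - h * P_sqr)) /
    (4 * h * (h - 1) * (2 * h - 1) ^+ 2).
Proof.
rewrite /Dq_s fmorph_div /= unshift_den.
exact: (s_unshift_formula ratfun2_neq0 h_neq0 h1'_neq0 h2'_neq0 unshift_num).
Qed.

Lemma shift_unshift_s : S sigma = Dq_s q.
Proof. by rewrite -ratfun_shiftD addNr ratfun_shift0. Qed.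

Lemma shift_e : S e = r / (1 - 4 * (h + 1) ^+ 2).
Proof.
by rewrite fmorph_div rmorphB rmorphM rmorphXn rmorph_nat rmorph1 /= ratfun_shiftC shift_h.
Qed.
Lemma unshift_e : T e = r / (1 - 4 * (h - 1) ^+ 2).
Proof.
by rewrite fmorph_div rmorphB rmorphM rmorphXn rmorph_nat rmorph1 /= ratfun_shiftC unshift_h.
Qed.

Lemma Drel_skew : Drel rho P Q (Dq_u C) (Dq_v q) (Dq_w q).
Proof.
have two' := ratfun2_neq0; have h0 := h_neq0; have h1 := h1_neq0; have h1' := h1'_neq0.
have h2 := h2_neq0; have h2' := h2'_neq0; have h3 := h3_neq0; have h3' := h3'_neq0.
rewrite Dq_uE Dq_vE Dq_wE.
apply: (@laurent_Drel h sigma (Dq_s q) (T sigma) e _ _ P_sqr Q_sqr rho P Q shift_h unshift_h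
  shift_unshift_s erefl shift_e unshift_e).
- exact: e_identity.
- exact: e_shift_identity.
- exact: e_unshift_identity.
- by rewrite unshift_s Dq_sE; apply: lie_vw_identity.
- by rewrite unshift_s Dq_sE; apply: square_w_identity.
- rewrite -laurent_emb -tofracXn; exact: horner_skew_emb.
- rewrite -laurent_emb -tofracXn; exact: horner_skew_emb.
Qed.

End Relations.
End Skew.

(** * Normal forms and filtration of D(q) *)

Section EvenOdd.
Variable C : fieldType.
Implicit Types p r : {poly C}.

(** The first summand has only even exponents and the second only odd ones. *)
Lemma even_odd_free p r : (p \Po 'X^2) + 'X * (r \Po 'X^2) = 0 -> p = 0 /\ r = 0.
Proof.
move=> h; have coef i := congr1 (fun f : {poly C} => f`_i) h.
split; apply/polyP => i.
  have := coef (2 * i)%N; rewrite coefD coefXM !coef_comp_poly_Xn // !coef0.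
  rewrite dvdn_mulr // mulKn //; case: i => [|i]; first by rewrite addr0.
  by rewrite mulnS add2n /= dvdn2 /= oddM /= addr0.
have := coef (2 * i).+1%N; rewrite coefD coefXM !coef_comp_poly_Xn // !coef0 /=.
by rewrite dvdn_mulr // mulKn // dvdn2 /= oddM /= add0r.
Qed.

End EvenOdd.

Section Leading.
Variable C : fieldType.
Local Notation skew := (Defs.skew C).
Local Notation ratfun := (Defs.ratfun C).
Local Notation h := ('X%:F : ratfun).

Definition skew_le (k : int) (x : skew) := forall i, k < i -> skew_coef i x = 0.

Lemma skew_leW k l x : k <= l -> skew_le k x -> skew_le l x.
Proof. by move=> kl kx i li; apply: kx; apply: le_lt_trans li. Qed.

Lemma skew_leD k x y : skew_le k x -> skew_le k y -> skew_le k (x + y).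
Proof. by move=> kx ky i ki; rewrite skew_coefD kx // ky // addr0. Qed.

Lemma skew_le0 k : skew_le k 0.
Proof. by move=> i _; rewrite raddf0. Qed.

Lemma skew_le_sum k (I : Type) (r : seq I) (P : pred I) (F : I -> skew) :
  (forall i, P i -> skew_le k (F i)) -> skew_le k (\sum_(i <- r | P i) F i).
Proof. by move=> H; elim/big_ind: _ => //; [exact: skew_le0 | exact: skew_leD]. Qed.

Lemma skew_le_mono k i f : i <= k -> skew_le k (skew_mono i f).
Proof. by move=> ik j kj; rewrite skew_coef_mono; case: eqP => // e; lia. Qed.

Lemma skew_leM k l x y : skew_le k x -> skew_le l y -> skew_le (k + l) (x * y).
Proof.
move=> kx ly; rewrite -[x * y]/(skew_mul x y) /skew_mul.
apply: skew_le_sum => i _; apply: skew_le_sum => j _.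
have [ki|ik] := ltP k i; first by rewrite kx // rmorph0 mul0r raddf0; apply: skew_le0.
have [lj|jl] := ltP l j; first by rewrite ly // mulr0 raddf0; apply: skew_le0.
by apply: skew_le_mono; lia.
Qed.

(** The term with the highest power of the group generator. *)
Definition lead k f (x : skew) := skew_le (k - 1) (x - skew_mono k f).

Lemma lead_le k f x : lead k f x -> skew_le k x.
Proof.
move=> kx; rewrite -(subrK (skew_mono k f) x); apply: skew_leD.
  by apply: skew_leW kx; lia.
exact: skew_le_mono.
Qed.

Lemma leadM k l f g x y : lead k f x -> lead l g y ->
  lead (k + l) (ratfun_shift l f * g) (x * y).
Proof.
move=> kx ly; rewrite /lead -skew_monoM.
have -> : x * y - skew_mono k f * skew_mono l g =
  (x - skew_mono k f) * y + skew_mono k f * (y - skew_mono l g).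
  by rewrite mulrBl mulrBr addrA subrK.
apply: skew_leD.
  by apply: skew_leW (skew_leM kx (lead_le ly)); lia.
by apply: skew_leW (skew_leM (skew_le_mono f (lexx k)) ly); lia.
Qed.

Lemma lead_mono k f : lead k f (skew_mono k f).
Proof. by rewrite /lead subrr; apply: skew_le0. Qed.

Lemma leadD k f g x y : lead k f x -> lead k g y -> lead k (f + g) (x + y).
Proof. by move=> kx ky; rewrite /lead raddfD opprD addrACA; apply: skew_leD. Qed.

Lemma lead_sum N k (f : nat -> ratfun) (F : nat -> skew) :
  (forall j : nat, lead (k + j%:Z) (f j) (F j)) ->
  lead (k + N%:Z) (f N) (\sum_(j < N.+1) F j).
Proof.
move=> H; rewrite big_ord_recr /lead -[X in skew_le _ X]addrA; apply: skew_leD; last exact: (H N).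
apply: skew_le_sum => j _; apply: skew_leW (lead_le (H j)).
by have := ltn_ord j; lia.
Qed.

Lemma lead_coef_eq k f x : lead k f x -> skew_coef k x = f.
Proof.
move=> /(_ k); rewrite raddfB /= skew_coef_mono eqxx => h.
by apply/eqP; rewrite -subr_eq0 h //; lia.
Qed.

Lemma leadX1 x j : lead 1 1 x -> lead j%:Z 1 (x ^+ j).
Proof.
move=> x1; elim: j => [|j IH]; first exact: lead_mono.
rewrite exprS intS; have := leadM x1 IH.
by rewrite rmorph1 mulr1.
Qed.

Variables (v w : skew).
Hypotheses (vlead : lead 1 1 v) (wlead : lead 1 h w).
Local Notation u := (skew_emb (h ^+ 2)).

Let hornerE c : c.<[u]> = skew_emb (c \Po 'X^2)%:F.
Proof. by rewrite -tofracXn horner_skew_emb. Qed.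

Lemma lead_vp j (c : {poly C}) : lead j%:Z (c \Po 'X^2)%:F (v ^+ j * 1 * c.<[u]>).
Proof.
rewrite mulr1 hornerE; have := leadM (leadX1 (j := j) vlead) (@lead_mono 0 (c \Po 'X^2)%:F).
by rewrite addr0 rmorph1 mul1r.
Qed.

Lemma lead_vwp j (c : {poly C}) :
  lead j.+1%:Z ('X * (c \Po 'X^2))%:F (v ^+ j * w * c.<[u]>).
Proof.
rewrite hornerE.
have := leadM (leadM (leadX1 (j := j) vlead) wlead) (@lead_mono 0 (c \Po 'X^2)%:F).
by rewrite addr0 rmorph1 mul1r ratfun_shift0 intS [1 + _]addrC tofracM.
Qed.

(** The leading terms of v and w are t and t h, where t is the group
    generator. Hence v^(N+1) c(u) and v^N w c(u) have leading coefficients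
    c(h^2) and h c(h^2). *)
Lemma lead_nf N (p r : {poly {poly C}}) : (size p <= N.+2)%N -> (size r <= N.+1)%N ->
  skew_coef N.+1%:Z (nf u v w p r) =
    (p`_N.+1 \Po 'X^2 + 'X * (r`_N \Po 'X^2))%:F.
Proof.
move=> sp sr; rewrite /nf (ev_widen _ _ _ sp) (ev_widen _ _ _ sr).
rewrite tofracD; apply: lead_coef_eq; apply: leadD.
  have := @lead_sum N.+1 0 (fun j => (p`_j \Po 'X^2)%:F)
    (fun j => v ^+ j * 1 * (p`_j).<[u]>).
  by rewrite add0r; apply=> j; rewrite add0r; apply: lead_vp.
have := @lead_sum N 1 (fun j => ('X * (r`_j \Po 'X^2))%:F)
  (fun j => v ^+ j * w * (r`_j).<[u]>).
rewrite -intS; apply=> j; rewrite -intS; exact: lead_vwp.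
Qed.

(** In the leading coefficient of a relation, the contributions of the two
    halves of the normal form are separated by parity in h. *)
Lemma nf_free_skew : nf_free u v w.
Proof.
have main N (p r : {poly {poly C}}) : (size p <= N.+1)%N -> (size r <= N)%N ->
    nf u v w p r = 0 -> p = 0 /\ r = 0.
  elim: N p r => [|N IH] p r sp sr nf0.
    have r0 : r = 0 by apply/eqP; rewrite -size_poly_leq0.
    move: nf0; rewrite r0 /nf ev0 addr0 (size1_polyC sp) evC mul1r hornerE.
    move=> /(congr1 (skew_coef 0)); rewrite skew_coef_mono raddf0 => /eqP.
    rewrite tofrac_eq0 => /eqP e; split=> //.
    have [|-> _] := @even_odd_free _ (p`_0) 0; last by rewrite polyC0.
    by rewrite e comp_poly0 mulr0 addr0.
  have := lead_nf sp sr; rewrite nf0 raddf0 => /esym /eqP; rewrite tofrac_eq0.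
  move=> /eqP /even_odd_free [pN rN].
  apply: IH => //.
    apply/leq_sizeP => j; rewrite leq_eqVlt => /orP[/eqP <- //|].
    by move/(leq_sizeP _ _ sp).
  apply/leq_sizeP => j; rewrite leq_eqVlt => /orP[/eqP <- //|].
  by move/(leq_sizeP _ _ sr).
move=> p r; apply: (main (maxn (size p) (size r))).
  by rewrite leqW // leq_maxl.
exact: leq_maxr.
Qed.

End Leading.

Lemma word_degree_even n s : exists m, word_degree (D_degree n) s = (2 * m)%N.
Proof.
elim: s => [|i s [m IH]]; first by exists 0%N; rewrite /word_degree big_nil.
rewrite /word_degree big_cons -/(word_degree _ s) IH.
case: i => -[|[|[|//]]] lti; rewrite /D_degree /=.
- by exists (2 + m)%N; lia.
- by exists (n - 2 + m)%N; lia.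
- by exists (n - 1 + m)%N; lia.
Qed.

Section WordFiltration.
Variables (C : fieldType) (A : algType C) (n : nat) (g : 'I_3 -> A).
Hypothesis n2 : (2 <= n)%N.
Local Notation deg s := (word_degree (D_degree n) s).
Local Notation i0 := (@Ordinal 3 0 isT).
Local Notation i1 := (@Ordinal 3 1 isT).
Local Notation i2 := (@Ordinal 3 2 isT).
Local Notation wfilt := (weight_filt n (g i0) (g i1) (g i2)).

Lemma word_span_gen i k (W : pred (seq 'I_3)) (x : A) :
  (forall s, (deg s)%:Z <= k -> W (i :: s)) ->
  word_span g (fun s => (deg s)%:Z <= k) x -> word_span g W (g i * x).
Proof.
move=> h; apply: (word_spanM (W1 := pred1 [:: i]) (W2 := fun s => (deg s)%:Z <= k)).
  by move=> s t /eqP-> /h.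
by exists [:: (1, [:: i])]; rewrite /= eqxx !big_seq1 scale1r.
Qed.

Lemma wfilt_word_span k x : wfilt k x -> word_span g (fun s => (deg s)%:Z <= 2 * k) x.
Proof.
elim=> {k x} [k|k k0|k c x y _ IHx _ IHy|k x _ IHx|k x _ IHx|k x _ IHx].
- exact: word_span0.
- by apply: word_span1; rewrite /word_degree big_nil; lia.
- exact: word_spanP.
- by apply: word_span_gen IHx => s; rewrite /word_degree big_cons /D_degree /=; lia.
- by apply: word_span_gen IHx => s; rewrite /word_degree big_cons /D_degree /=; lia.
- by apply: word_span_gen IHx => s; rewrite /word_degree big_cons /D_degree /=; lia.
Qed.

Lemma wfilt_word s k : (deg s)%:Z <= 2 * k -> wfilt k (\prod_(i <- s) g i).
Proof.
elim: s k => [|i s IH] k; rewrite /word_degree !(big_nil, big_cons).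
  by move=> k0; apply: Wfilt1; lia.
rewrite -/(word_degree _ s) => h.
case: i h => -[|[|[|//]]] lti h; rewrite (bool_irrelevance lti isT);
  [apply: Wfiltu | apply: Wfiltv | apply: Wfiltw]; apply: IH; move: h; rewrite /D_degree /=; lia.
Qed.

Lemma word_span_wfilt k x : word_span g (fun s => (deg s)%:Z <= 2 * k) x -> wfilt k x.
Proof.
case=> r [/allP rW ->]; rewrite big_seq; apply: wfilt_sum => cs /rW csW.
by apply: wfiltZ; apply: wfilt_word.
Qed.

End WordFiltration.

Section Dalgebra.
Variables (C : fieldType) (q : {poly C}).
Hypothesis q4 : (4 <= (size q).-1)%N.
Local Notation h := ('X%:F : Defs.ratfun C).

Lemma leadDl k f x y : @lead C k f x -> skew_le (k - 1) y -> lead k f (x + y).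
Proof. by move=> kx ky; rewrite /lead addrAC; apply: skew_leD. Qed.

Lemma Dq_b_le : skew_le (1 - 1) (Dq_b q).
Proof. by rewrite /Dq_b /skew_emb skew_monoM; apply: skew_le_mono; lia. Qed.

Lemma Dq_v_lead : lead 1 1 (Dq_v q).
Proof.
apply: leadDl; last by apply: skew_le_mono; lia.
by apply: leadDl; [exact: lead_mono | exact: Dq_b_le].
Qed.

Lemma Dq_w_lead : lead 1 h (Dq_w q).
Proof.
apply: leadDl; last by rewrite -raddfN; apply: skew_le_mono; lia.
have : lead 1 1 (Dq_a C - Dq_b q).
  apply: leadDl; first exact: lead_mono.
  by move=> i hi; rewrite raddfN /= Dq_b_le // oppr0.
by move/leadM => /(_ 0 h _ (@lead_mono _ 0 h)); rewrite addr0 rmorph1 mul1r.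
Qed.

Lemma generated_gen i : Dq_gen q i \in subalgebra_pred (generated (Dq_gen q)).
Proof.
apply/asboolP; exists [:: (1, [:: i])]; split=> //.
by rewrite !big_seq1 scale1r.
Qed.

Definition Dgen i : Dalg q := Subalg (generated_gen i).
Definition Du := Dgen (@Ordinal 3 0 isT).
Definition Dv := Dgen (@Ordinal 3 1 isT).
Definition Dw := Dgen (@Ordinal 3 2 isT).

Definition Dval (x : Dalg q) : Defs.skew C := subalg_val x.

Lemma Dval_linear : linear Dval. Proof. by []. Qed.
Lemma Dval_monoid : monoid_morphism Dval. Proof. by []. Qed.
HB.instance Definition _ := GRing.isLinear.Build C (Dalg q) (Defs.skew C) *:%R Dval Dval_linear.
HB.instance Definition _ := GRing.isMonoidMorphism.Build (Dalg q) (Defs.skew C) Dval Dval_monoid.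

Lemma Dval_inj : injective Dval.
Proof. exact: val_inj. Qed.

Lemma Dalg_nf_free : nf_free Du Dv Dw.
Proof.
move=> p r /(congr1 Dval); rewrite nf_morph raddf0.
exact: (nf_free_skew Dq_v_lead Dq_w_lead).
Qed.

Lemma word_span_Dval W (x : Dalg q) : word_span (Dq_gen q) W (Dval x) -> word_span Dgen W x.
Proof.
case=> r [rW e]; exists r; split=> //; apply: Dval_inj; rewrite e linear_sum.
by apply: eq_bigr => cs _; rewrite linearZ rmorph_prod.
Qed.

Lemma Dval_word_span W (x : Dalg q) : word_span Dgen W x -> word_span (Dq_gen q) W (Dval x).
Proof.
case=> r [rW e]; exists r; split=> //; rewrite e linear_sum.
by apply: eq_bigr => cs _; rewrite linearZ rmorph_prod.
Qed.

(** The filtration of D(q) is defined by words in the skew group algebra. As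
    the embedding is injective, the same words span it inside D(q), where they
    define the weight filtration. *)
Lemma Dalg_coordinates : coordinates (size q).-1 Du Dv Dw.
Proof.
have n2 : (2 <= (size q).-1)%N by lia.
split; first exact: Dalg_nf_free.
move=> k x; split.
  move=> /word_span_Dval h; apply: (word_span_wfilt n2); apply: word_spanW h => s.
  have [m ->] := word_degree_even (size q).-1 s; lia.
move=> /(wfilt_word_span (g := Dgen) n2) h; apply: Dval_word_span; apply: word_spanW h => s.
have := odd_double_half k; lia.
Qed.

End Dalgebra.

(** * Lifting the coordinates of a Kleinian singularity *)

Section QuotientMorphism.
Variables (C : fieldType) (A : algType C) (I : ideal A).

Lemma quot_pi_lrmorphism : exists f : {lrmorphism A -> quotalg I}, f =1 quot_pi I.
Proof.
apply: lrmorphism_of => [a x y||x y] //; last by rewrite -quot_piM.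
by rewrite raddfD /= -[quot_pi I (a *: x)]quot_piZ.
Qed.

Lemma quot_pi_eq0 x : quot_pi I x = 0 <-> ideal_mem I x.
Proof. by rewrite -(raddf0 (quot_pi I)) quot_piE subr0. Qed.

End QuotientMorphism.

Section Symbol.
Variables (C : fieldType) (A : filtAlg C).
Implicit Types (x y : A) (k : nat).

Lemma filt_mem k x : filt k x -> (x *: 'X^k : polyalg A) \in subalgebra_pred (rees_subalgebra A).
Proof.
move=> kx; apply/asboolP => i; rewrite coefZ coefXn.
by case: eqP => [->|_]; rewrite ?mulr1 ?mulr0 //; apply: filt0.
Qed.

(** The class of x t^k in the quotient of the Rees algebra that defines gr A;
    insubd makes it a total function of x. *)
Definition symbol k x : gr A := quot_pi (gr_ideal A) (insubd 0 (x *: 'X^k : polyalg A)).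

Lemma symbol_quot k x (p : rees A) : filt k x -> subalg_val p = x *: 'X^k ->
  symbol k x = quot_pi (gr_ideal A) p.
Proof.
move=> kx e; congr quot_pi; apply: val_inj.
by rewrite val_insubd filt_mem // -e.
Qed.

Lemma symbolP k x : filt k x ->
  exists p : rees A, symbol k x = quot_pi (gr_ideal A) p /\ subalg_val p = x *: 'X^k.
Proof. by move=> kx; exists (Subalg (filt_mem kx)); split=> //; apply: symbol_quot. Qed.

Lemma symbol_lin k (c : C) x y : filt k x -> filt k y ->
  symbol k (c *: x + y) = c *: symbol k x + symbol k y.
Proof.
move=> kx ky; have [p [-> pE]] := symbolP kx; have [q [-> qE]] := symbolP ky.
have [f fE] := quot_pi_lrmorphism (gr_ideal A).
rewrite (@symbol_quot _ _ (c *: p + q)); first by rewrite -!fE linearP.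
  exact: filtP.
rewrite -[LHS]/(c *: subalg_val p + subalg_val q) pE qE.
apply/polyP => i; rewrite !coefD coef_polyalgZ !coefZ mulrDl.
by rewrite scalerAl.
Qed.

Lemma symbolM i j x y : filt i x -> filt j y ->
  symbol (i + j) (x * y) = symbol i x * symbol j y.
Proof.
move=> kx ky; have [p [-> pE]] := symbolP kx; have [q [-> qE]] := symbolP ky.
rewrite (@symbol_quot _ _ (p * q)); first exact/esym/quot_piM.
  exact: filtM.
rewrite subalg_valM pE qE.
rewrite -!mul_polyC polyCM exprD -!mulrA; congr (_ * _).
by rewrite !mulrA -commr_polyXn.
Qed.

Lemma symbol_eq0 k x : filt k x -> symbol k x = 0 <-> filt_pred k x.
Proof.
move=> kx; have [p [-> pE]] := symbolP kx; rewrite quot_pi_eq0 /= /gr_ideal_mem pE.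
split=> [/(_ k)|h i]; rewrite coefZ coefXn ?eqxx ?mulr1 //.
by case: eqP => [->|_]; rewrite ?mulr1 ?mulr0 //; apply: filt_pred0.
Qed.

Lemma symbol_comp k x : filt k x -> gr_comp k (symbol k x).
Proof.
move=> kx; have [p [-> pE]] := symbolP kx; exists p; split=> // i ik.
by rewrite pE coefZ coefXn (negPf ik) mulr0.
Qed.

Lemma gr_comp_symbol k z : gr_comp k z -> exists x, filt k x /\ z = symbol k x.
Proof.
case=> p [-> pk]; exists (subalg_val p)`_k; split; first exact: rees_filt.
apply/esym/symbol_quot; first exact: rees_filt.
apply/polyP => i; rewrite coefZ coefXn; case: eqP => [->|/eqP ik]; first by rewrite mulr1.
by rewrite mulr0 pk.
Qed.

Lemma symbol1 : symbol 0 1 = 1.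
Proof.
apply: (@symbol_quot _ _ 1); first exact: filt1.
by rewrite expr0 alg_polyC.
Qed.

End Symbol.

Section KleinianNormalForm.
Variables (C : fieldType) (n : nat).
Local Notation K := (kleinian C n).
Local Notation X i := ('X_i : {mpoly C[3]}).
Local Notation i0 := (@Ordinal 3 0 isT).
Local Notation i1 := (@Ordinal 3 1 isT).
Local Notation i2 := (@Ordinal 3 2 isT).
Local Notation tower_ring := {poly {poly {poly C}}}.

Definition tower_const (c : C) : tower_ring := c%:P%:P%:P.
HB.instance Definition _ := GRing.RMorphism.copy tower_const
  (polyC \o (polyC \o (@polyC C))).

Definition tower_var (i : 'I_3) : tower_ring := nth 0 [:: ('X)%:P%:P; ('X)%:P; 'X] i.

(** The polynomial ring in three variables as C[u][v][w], where the Kleinian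
    relation is monic of degree two in w. *)
Definition tower : {mpoly C[3]} -> tower_ring := mmap tower_const tower_var.
HB.instance Definition _ := GRing.RMorphism.copy tower (mmap tower_const tower_var).

Lemma towerX i : tower (X i) = tower_var i.
Proof. by rewrite /tower mmapX mmap1U. Qed.

Lemma towerZ c p : tower (c *: p) = tower_const c * tower p.
Proof. exact: mmapZ. Qed.

Lemma tower_horner c : tower c.<[X i0]> = c%:P%:P.
Proof.
rewrite horner_coef_alg rmorph_sum -[c in RHS]coefK poly_def !rmorph_sum /=.
apply: eq_bigr => i _; rewrite towerZ rmorphXn /= towerX.
by rewrite -mul_polyC !rmorphM !rmorphXn.
Qed.

Lemma tower_polyev m p : tower (polyev (X i0) (X i1) m p) = tower m * p%:P.
Proof.
rewrite /polyev rmorph_sum -[p in RHS]coefK poly_def rmorph_sum mulr_sumr /=.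
apply: eq_bigr => j _; rewrite !rmorphM rmorphXn /= tower_horner towerX.
rewrite -mul_polyC rmorphM rmorphXn /= [Y in Y * _ = _]mulrC -mulrA.
by congr (_ * _); rewrite mulrC.
Qed.

Lemma tower_rel : exists c, tower (kleinian_rel C n) = 'X^2 + c%:P.
Proof.
rewrite /kleinian_rel; eexists.
rewrite addrC !(rmorphD, rmorphN, rmorphM, rmorphXn, rmorph1) /= !towerX.
rewrite /tower_var /= -!rmorphXn /= -!rmorphM -?rmorphN -?rmorphD /=.
by rewrite -polyC_exp -polyCM -polyCD.
Qed.

(** A nonzero multiple of a polynomial that is monic of degree two in w has
    degree at least two in w. *)
Lemma kleinian_nf_free :
  nf_free (quot_pi (kleinian_ideal C n) (X i0)) (quot_pi (kleinian_ideal C n) (X i1))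
   (quot_pi (kleinian_ideal C n) (X i2)).
Proof.
move=> p r; have [f fE] := quot_pi_lrmorphism (kleinian_ideal C n).
rewrite -!fE -nf_morph fE => /quot_pi_eq0 /= [g /(congr1 tower)].
rewrite /nf rmorphD /= !tower_polyev rmorph1 mul1r towerX rmorphM /=.
have [c ->] := tower_rel; rewrite /tower_var /=.
have sc : size ('X^2 + c%:P) = 3%N.
  by rewrite size_polyDl size_polyXn // size_polyC; case: (c == 0).
move=> e; have : tower g = 0.
  apply/eqP; apply: contraT => g0.
  have := congr1 (fun y : tower_ring => size y) e.
  rewrite size_mul // -?size_poly_gt0 ?sc // addn3 /= => h.
  have : (size (p%:P + 'X * r%:P)%R <= 2)%N.
    rewrite addrC mulrC -cons_poly_def size_cons_poly.
    by case: ifP => //; rewrite ltnS size_polyC; case: (r == 0).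
  by rewrite h !ltnS leqn0 size_poly_eq0 (negPf g0).
move=> g0; move: e; rewrite g0 mul0r => e.
split.
  by have := congr1 (fun y : tower_ring => y`_0) e; rewrite coefD coefC coefXM !coef0 addr0.
have := congr1 (fun y : tower_ring => y`_1) e.
by rewrite coefD coefC coefXM coefC coef0 add0r.
Qed.

End KleinianNormalForm.

Lemma big_ord3 (R : Type) (idx : R) (op : R -> R -> R) (F : 'I_3 -> R) :
  \big[op/idx]_(i < 3) F i =
  op (F (@Ordinal 3 0 isT)) (op (F (@Ordinal 3 1 isT)) (op (F (@Ordinal 3 2 isT)) idx)).
Proof.
rewrite !big_ord_recl big_ord0; congr (op (F _) (op (F _) (op (F _) _)));
  exact: val_inj.
Qed.

Section Deformation.
Variables (C : fieldType) (n : nat) (A : filtAlg C).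
Hypothesis n4 : (4 <= n)%N.
Local Notation K := (kleinian C n).
Local Notation pi := (quot_pi (kleinian_ideal C n)).
Local Notation X i := ('X_i : {mpoly C[3]}).
Local Notation i0 := (@Ordinal 3 0 isT).
Local Notation i1 := (@Ordinal 3 1 isT).
Local Notation i2 := (@Ordinal 3 2 isT).
Variable f : {lrmorphism gr A -> K}.
Hypothesis f_bij : bijective f.
Hypothesis f_comp : forall k z, gr_comp k z <-> kleinian_comp k (f z).

(** The principal symbol of x, read in the coordinate algebra of the
    singularity. *)
Definition ksymbol k (x : A) : K := f (symbol k x).

Lemma ksymbol_lin k (c : C) x y : filt k x -> filt k y ->
  ksymbol k (c *: x + y) = c *: ksymbol k x + ksymbol k y.
Proof. by move=> kx ky; rewrite /ksymbol symbol_lin // linearP. Qed.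

Lemma ksymbolM i j x y : filt i x -> filt j y ->
  ksymbol (i + j) (x * y) = ksymbol i x * ksymbol j y.
Proof. by move=> kx ky; rewrite /ksymbol symbolM // rmorphM. Qed.

Lemma ksymbol_eq0 k x : filt k x -> ksymbol k x = 0 <-> filt_pred k x.
Proof.
move=> kx; rewrite -(symbol_eq0 kx) -(raddf0 f) /ksymbol.
by split=> [/(bij_inj f_bij)|->].
Qed.

Lemma ksymbol0 k : ksymbol k 0 = 0.
Proof. by apply/ksymbol_eq0; [exact: filt0|exact: filt_pred0]. Qed.

Lemma ksymbolD k x y : filt k x -> filt k y -> ksymbol k (x + y) = ksymbol k x + ksymbol k y.
Proof. by move=> kx ky; rewrite -[x in LHS]scale1r ksymbol_lin // scale1r. Qed.

Lemma ksymbolZ k c x : filt k x -> ksymbol k (c *: x) = c *: ksymbol k x.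
Proof. by move=> kx; rewrite -[_ *: x]addr0 ksymbol_lin ?ksymbol0 ?addr0 //; apply: filt0. Qed.

Lemma filtZ k c (x : A) : filt k x -> filt k (c *: x).
Proof. by move=> kx; rewrite -[_ *: x]addr0; apply: filtP => //; apply: filt0. Qed.

Lemma filtW k l (x : A) : (k <= l)%N -> filt k x -> filt l x.
Proof.
move=> kl kx; rewrite -(subnKC kl); elim: (l - k)%N => [|m IH]; first by rewrite addn0.
by rewrite addnS; apply: filtS.
Qed.

Lemma filtB k (x y : A) : filt k x -> filt k y -> filt k (x - y).
Proof. by move=> kx ky; rewrite addrC -scaleN1r; apply: filtP. Qed.

Lemma ksymbolB k x y : filt k x -> filt k y -> ksymbol k (x - y) = ksymbol k x - ksymbol k y.
Proof. by move=> kx ky; rewrite addrC -scaleN1r ksymbol_lin // scaleN1r addrC. Qed.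

Lemma ksymbol1 : ksymbol 0 1 = 1.
Proof. by rewrite /ksymbol symbol1 rmorph1. Qed.

Lemma filtX k j (x : A) : filt k x -> filt (j * k) (x ^+ j).
Proof.
move=> kx; elim: j => [|j IH]; first exact: filt1.
by rewrite exprS mulSn; apply: filtM.
Qed.

Lemma ksymbolX k j x : filt k x -> ksymbol (j * k) (x ^+ j) = ksymbol k x ^+ j.
Proof.
move=> kx; elim: j => [|j IH]; first by rewrite !expr0 mul0n ksymbol1.
by rewrite !exprS mulSn ksymbolM // ?IH //; apply: filtX.
Qed.

Lemma ksymbol_sum k (I : eqType) (r : seq I) (G : I -> A) :
  (forall i, i \in r -> filt k (G i)) ->
  filt k (\sum_(i <- r) G i) /\ ksymbol k (\sum_(i <- r) G i) = \sum_(i <- r) ksymbol k (G i).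
Proof.
elim: r => [|i r IH] h; first by rewrite !big_nil ksymbol0; split=> //; apply: filt0.
have [|h1 h2] := IH; first by move=> j jr; apply: h; rewrite inE jr orbT.
have hi : filt k (G i) by apply: h; rewrite inE eqxx.
by rewrite !big_cons ksymbolD // h2; split=> //; apply: filtD.
Qed.

Lemma ksymbol_gen i : exists x, filt (D_degree n i) x /\ ksymbol (D_degree n i) x = pi (X i).
Proof.
have [g gK fK] := f_bij.
have : gr_comp (D_degree n i) (g (pi (X i))).
  apply/f_comp; rewrite fK; exists (X i); split=> // m; rewrite msuppX inE => /eqP ->.
  rewrite (bigD1 i) //= mnm1E eqxx mul1n big1 ?addn0 // => j ji.
  by rewrite mnm1E eq_sym (negPf ji).
by move=> /gr_comp_symbol [x [kx e]]; exists x; rewrite /ksymbol -e fK.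
Qed.

Lemma kleinian_mulC (x y : K) : x * y = y * x.
Proof.
have comm p q : pi p * pi q = pi q * pi p.
  apply: etrans (quot_piM _ p q) _; rewrite mulrC; exact/esym/quot_piM.
by rewrite -(quot_reprK x) -(quot_reprK y) comm.
Qed.

Variables u v w : A.
Hypothesis (uf : filt 4 u) (vf : filt (2 * n - 4) v) (wf : filt (2 * n - 2) w).
Hypothesis ue : ksymbol 4 u = pi (X i0).
Hypothesis ve : ksymbol (2 * n - 4) v = pi (X i1).
Hypothesis we : ksymbol (2 * n - 2) w = pi (X i2).
Local Notation wfilt := (weight_filt n u v w).

Lemma wfilt_filt l (k : nat) x : wfilt l x -> 2 * l <= k%:Z -> filt k x.
Proof.
move=> lx; elim: lx k => {l x} [l|l l0|l c x y _ IHx _ IHy|l x lx IHx|l x lx IHx|l x lx IHx] k lk.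
- exact: filt0.
- by apply: (@filtW 0) => //; apply: filt1.
- by apply: filtP; auto.
- have [l2|l2] := ltP (l - 2) 0.
    by rewrite (wfilt_lt0 _ l2 lx) ?mulr0; [apply: filt0|lia].
  by rewrite (_ : k = 4 + (k - 4))%N; [apply: filtM => //; apply: IHx; lia|lia].
- have [l2|l2] := ltP (l - (n%:Z - 2)) 0.
    by rewrite (wfilt_lt0 _ l2 lx) ?mulr0; [apply: filt0|lia].
  by rewrite (_ : k = (2 * n - 4) + (k - (2 * n - 4)))%N; [apply: filtM => //; apply: IHx; lia|lia].
- have [l2|l2] := ltP (l - (n%:Z - 1)) 0.
    by rewrite (wfilt_lt0 _ l2 lx) ?mulr0; [apply: filt0|lia].
  by rewrite (_ : k = (2 * n - 2) + (k - (2 * n - 2)))%N; [apply: filtM => //; apply: IHx; lia|lia].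
Qed.

(** The symbol of x is a polynomial in the symbols of u, v and w. Subtracting
    the same polynomial in u, v and w themselves leaves an element of smaller
    degree. *)
Lemma filt_wfilt k x : filt k x -> wfilt k./2%:Z x.
Proof.
elim/ltn_ind: k x => k IH x kx.
have [P [e hom]] : kleinian_comp k (ksymbol k x) by apply/f_comp/symbol_comp.
pose mon (m : 'X_{1..3}) := u ^+ m i0 * (v ^+ m i1 * w ^+ m i2).
have deg (m : 'X_{1..3}) : m \in msupp P ->
    (m i0 * 4 + (m i1 * (2 * n - 4) + m i2 * (2 * n - 2)) = k)%N.
  by move/hom; rewrite big_ord3 addn0.
have monf m : m \in msupp P -> filt k (P@_m *: mon m).
  by move=> mP; rewrite -(deg m mP); apply/filtZ/filtM/filtM; apply: filtX.
have mone m : m \in msupp P -> ksymbol k (P@_m *: mon m) = pi (P@_m *: 'X_[m]).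
  move=> mP; rewrite -(deg m mP) ksymbolZ.
    rewrite !ksymbolM ?ksymbolX ?ue ?ve ?we //; try by [apply: filtX | apply: filtM; apply: filtX].
    rewrite -quot_piZ; congr (_ *: _).
    have [F FE] := quot_pi_lrmorphism (kleinian_ideal C n).
    by rewrite (mpolyXE_id _ m) big_ord3 mulr1 -!FE !rmorphM !rmorphXn.
  by apply/filtM/filtM; apply: filtX.
have [yf ye] := ksymbol_sum monf.
pose y := \sum_(m <- msupp P) P@_m *: mon m.
have : filt_pred k (x - y).
  apply/ksymbol_eq0; first exact: filtB.
  rewrite ksymbolB // ye e {1}[P]mpolyE.
  have [F FE] := quot_pi_lrmorphism (kleinian_ideal C n).
  rewrite -FE rmorph_sum /= big_seq [Y in _ - Y]big_seq -sumrB big1 // => m mP.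
  by rewrite mone // FE subrr.
have yw : wfilt k./2%:Z y.
  rewrite /y big_seq; apply: wfilt_sum => m /deg mk; apply: wfiltZ.
  apply: wfiltW (wfiltM (wfiltX (m i0) (wfilt_u n u v w))
    (wfiltM (wfiltX (m i1) (wfilt_v n u v w)) (wfiltX (m i2) (wfilt_w n u v w)))).
  move: mk; move: (m i0) (m i1) (m i2) => a b c mk; rewrite -mk.
  have [n' nE] : exists n', n = n'.+2 by exists (n - 2)%N; lia.
  have -> : (a * 4 + (b * (2 * n - 4) + c * (2 * n - 2)))%N =
      (a * 2 + b * n' + c * n'.+1).*2.
    have -> : (2 * n - 4 = 2 * n')%N by lia.
    have -> : (2 * n - 2 = 2 * n'.+1)%N by lia.
    by rewrite -muln2; lia.
  rewrite doubleK !PoszD !PoszM.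
  have -> : n%:Z - 2 = n' by lia.
  have -> : n%:Z - 1 = n'.+1 by lia.
  lia.
case: k {deg monf mone yf ye hom e} kx IH yw => [|k] kx IH yw /=.
  by move=> /eqP; rewrite subr_eq0 => /eqP->.
move=> h; rewrite -(subrK y x); apply: wfiltD => //.
by apply: wfiltW (IH _ _ _ h) => //; lia.
Qed.

Lemma deformation_filt k x : filt k x <-> wfilt k./2%:Z x.
Proof.
split=> [|h]; first exact: filt_wfilt.
by apply: wfilt_filt h _; have := odd_double_half k; lia.
Qed.

(** Commutators have zero symbol since the coordinate algebra is commutative.
    As the generators have even degree, the loss of one degree amounts to the
    loss of one unit of weight. *)
Lemma deformation_reduced : reduced n u v w ((-1) ^+ n).
Proof.
have lief i j k (x y : A) : (i + j = k.+1)%N -> filt i x -> filt j y -> filt k (lie x y).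
  move=> ijk ix jy; have : filt_pred k.+1 (lie x y).
    have xy := filtM ix jy; have yx := filtM jy ix; rewrite addnC in yx.
    rewrite -ijk; apply/(ksymbol_eq0 (filtB xy yx)); rewrite ksymbolB //.
    by rewrite ksymbolM // addnC ksymbolM // kleinian_mulC subrr.
  by [].
split.
- have /(_ (2 * n - 1)%N) h := lief _ _ _ _ _ _ uf vf.
  by apply: wfiltW (filt_wfilt (h _)); lia.
- have /(_ (2 * n + 1)%N) h := lief _ _ _ _ _ _ uf wf.
  by apply: wfiltW (filt_wfilt (h _)); lia.
- have /(_ (4 * n - 7)%N) h := lief _ _ _ _ _ _ vf wf.
  by apply: wfiltW (filt_wfilt (h _)); lia.
have w2 := filtX 2 wf; have v2 := filtX 2 vf; have uX := filtX n.-1 uf.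
have v2u := filtM v2 uf.
have w2e := ksymbolX 2 wf; have v2e := ksymbolX 2 vf; have uXe := ksymbolX n.-1 uf.
have v2ue := ksymbolM v2 uf.
move: w2 w2e v2u v2ue uX uXe.
rewrite (_ : (2 * (2 * n - 2) = (4 * n - 5).+1)%N); last lia.
rewrite (_ : (2 * (2 * n - 4) + 4 = (4 * n - 5).+1)%N); last lia.
rewrite (_ : (n.-1 * 4 = (4 * n - 5).+1)%N); last lia.
move=> w2 w2e v2u v2ue uX uXe.
have hf : filt (4 * n - 5) (w ^+ 2 - v ^+ 2 * u + (-1) ^+ n *: u ^+ n.-1).
  have hB := filtB w2 v2u; have hZ := filtZ ((-1) ^+ n) uX.
  have /ksymbol_eq0 h := filtD hB hZ; apply/h.
  rewrite ksymbolD // ksymbolB // ksymbolZ // w2e v2ue uXe v2e ue ve we.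
  have [F FE] := quot_pi_lrmorphism (kleinian_ideal C n).
  rewrite -!FE -!rmorphXn -!rmorphM -linearZ -!rmorphB -!rmorphD /= FE.
  apply/quot_pi_eq0; exists 1; rewrite mul1r /kleinian_rel.
  have -> : i0 = 0 by apply: val_inj.
  have -> : i1 = 1 by apply: val_inj.
  have -> : i2 = 2 by apply: val_inj.
  rewrite -[(-1) ^+ n in LHS]signr_odd scaler_sign -[(-1) ^+ n]signr_odd mulr_sign.
  by rewrite [_ * 'X_0]mulrC [LHS]addrC [_ - 'X_0 * _]addrC addrA.
by apply: wfiltW (filt_wfilt hf); lia.
Qed.

Lemma polyev_double_sum (B : algType C) (x y m : B) (p : {poly {poly C}}) N M :
  (size p <= N)%N -> (forall j, size (p`_j)%R <= M)%N ->
  polyev x y m p = \sum_(j < N) \sum_(i < M) p`_j`_i *: (y ^+ j * m * x ^+ i).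
Proof.
move=> pN pM; rewrite (ev_widen _ _ _ pN); apply: eq_bigr => j _.
rewrite horner_coef_alg mulr_sumr (big_ord_widen M (fun i => y ^+ j * m * (p`_j`_i *: x ^+ i))) //.
rewrite big_mkcond; apply: eq_bigr => i _; rewrite -scalerAr.
by case: ltnP => // h; rewrite nth_default // scale0r.
Qed.

Definition wtop (k : int) (p : {poly {poly C}}) : {poly {poly C}} :=
  \poly_(j < size p) \poly_(i < size p`_j)
    (p`_j`_i *+ (2 * i%:Z + (n%:Z - 2) * j%:Z == k)).

Lemma coef_wtop k p i j :
  (wtop k p)`_j`_i = p`_j`_i *+ (2 * i%:Z + (n%:Z - 2) * j%:Z == k).
Proof.
rewrite coef_poly; case: ltnP => jp; last by rewrite [p`_j]nth_default // !coef0 mul0rn.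
by rewrite coef_poly; case: ltnP => // ip; rewrite [p`_j`_i]nth_default // mul0rn.
Qed.

(** Only the terms of top weight contribute to the symbol. *)
Lemma ksymbol_polyev l (m : A) M k p N : filt l m -> ksymbol l m = M ->
  weight_le n k p -> l%:Z + 2 * k = N%:Z ->
  filt N (polyev u v m p) /\
  ksymbol N (polyev u v m p) = polyev (pi (X i0)) (pi (X i1)) M (wtop k p).
Proof.
move=> lm mM kp lkN; pose B := (\max_(c <- p) size c)%N.
have sB j : (size (p`_j)%R <= B)%N.
  have [jp|jp] := ltnP j (size p); last by rewrite nth_default // size_poly0.
  by apply: (leq_bigmax_seq (F := fun c : {poly C} => size c)) => //; apply: mem_nth.
have sB' j : (size ((wtop k p)`_j)%R <= B)%N.
  rewrite coef_poly; case: ifP; rewrite ?size_poly0 // => _.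
  by apply: leq_trans (size_poly _ _) (sB j).
rewrite (polyev_double_sum _ _ _ (leqnn _) sB).
rewrite (polyev_double_sum _ _ _ (size_poly _ _) sB').
have term (j i : nat) :
    filt N (p`_j`_i *: (v ^+ j * m * u ^+ i)) /\
    ksymbol N (p`_j`_i *: (v ^+ j * m * u ^+ i)) =
    (wtop k p)`_j`_i *: (pi (X i1) ^+ j * M * pi (X i0) ^+ i).
  rewrite coef_wtop.
  have [kij|ijk] := ltP k (2 * i%:Z + (n%:Z - 2) * j%:Z).
    by rewrite kp // mul0rn !scale0r ksymbol0; split=> //; apply: filt0.
  have tf := filtM (filtM (filtX j vf) lm) (filtX i uf).
  have te := etrans (ksymbolM (filtM (filtX j vf) lm) (filtX i uf))
    (congr2 *%R (etrans (ksymbolM (filtX j vf) lm) (congr2 *%R (ksymbolX j vf) mM)) (ksymbolX i uf)).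
  rewrite ue ve in te.
  case: eqP => [e|ne].
    have <- : (j * (2 * n - 4) + l + i * 4 = N)%N.
      apply/eqP; rewrite -eqz_nat -lkN -e !PoszD !PoszM; apply/eqP.
      have -> : (2 * n - 4)%N = 2 * (n%:Z - 2) :> int by lia.
      lia.
    by rewrite ksymbolZ // te; split=> //; apply: filtZ.
  have lt : (j * (2 * n - 4) + l + i * 4 < N)%N.
    rewrite -ltz_nat -lkN !PoszD !PoszM.
    have -> : (2 * n - 4)%N = 2 * (n%:Z - 2) :> int by lia.
    lia.
  rewrite mulr0n scale0r; split; first by apply/filtZ/(filtW _ tf); lia.
  apply/ksymbol_eq0; first by apply/filtZ/(filtW _ tf); lia.
  case: (N) lt => // N' lt /=.
  by apply/filtZ/(filtW _ tf); lia.
have sumE (j : 'I_(size p)) := ksymbol_sum (r := index_enum 'I_B)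
  (G := fun i : 'I_B => p`_j`_i *: (v ^+ j * m * u ^+ i)) (fun i _ => (term j i).1).
have [h1 h2] := ksymbol_sum (r := index_enum 'I_(size p))
  (G := fun j : 'I_(size p) => \sum_(i < B) p`_j`_i *: (v ^+ j * m * u ^+ i))
  (fun j _ => (sumE j).1).
split=> //; rewrite h2; apply: eq_bigr => j _; rewrite (sumE j).2.
by apply: eq_bigr => i _; rewrite (term j i).2.
Qed.

(** The symbol of a relation is a relation of top weight in the coordinate
    algebra, where normal forms are unique. *)
Lemma deformation_nf_free : nf_free u v w.
Proof.
have n2 : (2 <= n)%N by lia.
have main (N : nat) p r : weight_le n (N%:Z - 1) p -> weight_le n (N%:Z - n%:Z) r ->
    nf u v w p r = 0 -> p = 0 /\ r = 0.
  elim: N p r => [|N IH] p r kp kr nf0.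
    by split; [apply: wle_lt0 kp | apply: wle_lt0 kr] => //; lia.
  have [||f1 e1] := ksymbol_polyev (k := N%:Z) (p := p) (N := (2 * N)%N) (filt1 A) ksymbol1.
  - by apply: wleW kp; lia.
  - lia.
  have [||f2 e2] := ksymbol_polyev (k := N%:Z - n%:Z + 1) (p := r) (N := (2 * N)%N) wf we.
  - by apply: wleW kr; lia.
  - lia.
  have := ksymbolD f1 f2; rewrite -/(nf u v w p r) nf0 ksymbol0 e1 e2.
  move=> /esym /kleinian_nf_free [p0 r0].
  apply: IH => //.
    move=> i j; rewrite ltrBlDr ltzD1 le_eqVlt => /orP[/eqP h|h].
      by have := coef_wtop N%:Z p i j; rewrite p0 !coef0 -h eqxx.
    by apply: kp; lia.
  move=> i j h.
  have [/eqP e|ne] := boolP (2 * i%:Z + (n%:Z - 2) * j%:Z == N%:Z - n%:Z + 1).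
    by have := coef_wtop (N%:Z - n%:Z + 1) r i j; rewrite r0 !coef0 e eqxx.
  by apply: kr; move/eqP: ne; lia.
move=> p r; have [k kp] := wle_exhaustive p n2; have [l lr] := wle_exhaustive r n2.
apply: (main (k + l + n).+1); first by apply: wleW kp; lia.
by apply: wleW lr; lia.
Qed.

End Deformation.

Lemma deformation_generators (C : fieldType) n (A : filtAlg C) : (4 <= n)%N ->
  deformation n A -> exists u v w : A,
    coordinates n u v w /\ reduced n u v w ((-1) ^+ n).
Proof.
move=> n4 [f [f_bij f_comp]].
have [u [uf ue]] := ksymbol_gen f_bij f_comp (@Ordinal 3 0 isT).
have [v [vf ve]] := ksymbol_gen f_bij f_comp (@Ordinal 3 1 isT).
have [w [wf we]] := ksymbol_gen f_bij f_comp (@Ordinal 3 2 isT).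
exists u, v, w; split; last exact: (deformation_reduced n4 f_bij f_comp).
split; first exact: (deformation_nf_free n4 f_bij uf vf wf).
exact: (deformation_filt n4 f_bij f_comp).
Qed.

(** * Leading parts of the commutators *)

Section WsquareCoefficients.
Variables (C : fieldType) (n : nat) (eps : C).

Lemma coef_wsquareM (r : {poly {poly C}}) i j :
  (wsquare n eps * r)`_j`_i =
  (if (j < 2)%N then 0 else if i is i'.+1 then r`_(j - 2)`_i' else 0)
  - (if (i < n.-1)%N then 0 else eps * r`_j`_(i - n.-1)).
Proof.
rewrite /wsquare mulrBl -mulrA coefB coefXnM !coefCM coefB -scalerAl coefZ coefXnM.
congr (_ - _); last by case: ifP; rewrite ?mulr0.
case: ifP => _; first by rewrite coef0.
by rewrite coefXM; case: i.
Qed.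

(** The monomial v^2 u of wsquare carries each coefficient of r to a
    coefficient of the product, up to a multiple of a coefficient of r at a
    higher power of v; hence the descending induction on that power. *)
Lemma wle_wsquareM_inv k (r : {poly {poly C}}) : (4 <= n)%N ->
  weight_le n (k + 2 * n%:Z - 2) (wsquare n eps * r) -> weight_le n k r.
Proof.
move=> n4 h; have main N : forall i j : nat, (size r <= j + N)%N ->
    k < 2 * i%:Z + (n%:Z - 2) * j%:Z -> r`_j`_i = 0.
  elim/ltn_ind: N => N IH i j sj kij.
  have [jr|jr] := leqP (size r) j; first by rewrite [r`_j]nth_default // coef0.
  have := h i.+1 j.+2 ltac:(lia); rewrite coef_wsquareM /= !subSS subn0.
  case: ifP => [_|/negbT]; first by rewrite subr0.
  rewrite -leqNgt => hi; have jN := leq_trans jr sj.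
  rewrite (IH (N - 2)%N _ (i.+1 - n.-1)%N j.+2) ?mulr0 ?subr0 //; try lia.
by move=> i j kij; apply: (main (size r)) kij; apply: leq_addl.
Qed.

End WsquareCoefficients.

Lemma evCC (C : fieldType) (A : algType C) (u v m : A) (c : C) :
  polyev u v m c%:P%:P = c *: m.
Proof. by rewrite evC horner_algC mulr_algr. Qed.

Section Step.
Variables (C : fieldType) (A : algType C) (n : nat) (u v w : A) (eps : C).
Hypothesis n4 : (4 <= n)%N.
Hypothesis two : (2 : C) != 0.
Hypothesis eps0 : eps != 0.
Hypothesis red : reduced n u v w eps.
Hypothesis free : nf_free u v w.
Local Notation wfilt := (weight_filt n u v w).
Local Notation wle := (@weight_le C n).
Local Notation nf := (nf u v w).

Lemma wfilt_half k x : wfilt k (x *+ 2) -> wfilt k x.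
Proof.
move=> h; have -> : x = 2^-1 *: (x *+ 2) by rewrite -scaler_nat scalerA mulVf // scale1r.
exact: wfiltZ.
Qed.

Lemma wfilt_lie_exp m k x : wfilt m (lie x u) -> wfilt (m + 2 * k%:Z) (lie x (u ^+ k.+1)).
Proof.
move=> h; elim: k => [|k IH]; first by rewrite mulr0 addr0.
have uu := wfilt_u n u v w.
rewrite exprS lieMr; apply: wfiltD.
  by apply: wfiltW (wfiltM h (wfiltX k.+1 uu)); lia.
by apply: wfiltW (wfiltM uu IH); lia.
Qed.

(** The commutators lie d below the weights of the corresponding products. *)
Definition drops (d : int) := [/\ wfilt (n%:Z - d) (lie u v),
  wfilt (n%:Z + 1 - d) (lie u w) & wfilt (2 * n%:Z - 3 - d) (lie v w)].

(** The square of y differs from the commutative derivation rule by a second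
    commutator. *)
Lemma lie_square (x y : A) : lie x (y ^+ 2) = (y * lie x y) *+ 2 - lie y (lie x y).
Proof. rewrite expr2 mulr2n /lie; ncring. Qed.

(** The commutator of u with the relation w^2 = v^2 u - eps u^(n-1) + ...
    shows that 2 (w [u,w] - v [u,v] u) vanishes up to lower weight. In normal
    form this says that the leading parts of [u,v] and [u,w] are a w and a v u
    + b w. *)
Lemma drops_uv_uw d : 1 <= d -> drops d -> exists a b pA pB,
  [/\ lie u v = nf pA a%:P%:P, lie u w = nf pB b%:P%:P,
      wle (n%:Z - d - 1) pA, wle (n%:Z - d) (pB - 'X * a%:P%:P * ('X)%:P) &
      2 <= d -> a = 0 /\ b = 0].
Proof.
move=> d1 [duv duw dvw].
have uu := wfilt_u n u v w; have vv := wfilt_v n u v w; have ww := wfilt_w n u v w.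
have X3 : wfilt (2 * n%:Z - 3) (w ^+ 2 - v ^+ 2 * u + eps *: u ^+ n.-1) by case: red.
have [pA [rA [eA wpA wrA]]] := nf_leP n4 red duv.
have [pB [rB [eB wpB wrB]]] := nf_leP n4 red duw.
have const (r : {poly {poly C}}) k : k <= 1 -> wle k r -> r = (r`_0`_0)%:P%:P.
  move=> k1 kr; apply/polyP => j; apply/polyP => i; rewrite coefC.
  case: j => [|j]; first by rewrite coefC; case: i => [|i] //=; apply: kr; lia.
  by rewrite coef0; apply: kr; nia.
have rAE := const _ _ _ wrA; have rBE := const _ _ _ wrB.
set a := rA`_0`_0 in rAE; set b := rB`_0`_0 in rBE.
have {rAE}rAE : rA = a%:P%:P by apply: rAE; lia.
have {rBE}rBE : rB = b%:P%:P by apply: rBE; lia.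
have key : wfilt (2 * n%:Z - 1 - d) (w * lie u w - v * lie u v * u).
  apply: wfilt_half.
  have -> : (w * lie u w - v * lie u v * u) *+ 2 =
    lie u (w ^+ 2 - v ^+ 2 * u + eps *: u ^+ n.-1) + lie w (lie u w) - lie v (lie u v) * u.
    rewrite lieDr lieBr lieZr lieMr liexx mulr0 addr0 !lie_square.
    have -> : lie u (u ^+ n.-1) = 0 by rewrite /lie -exprS -exprSr subrr.
    rewrite scaler0 addr0 mulrnBl mulrBl mulrnAl.
    move: (w * _ *+ 2) (v * _ * u *+ 2) (lie w _) (lie v _) => x1 x2 x3 x4; ncring.
  apply: wfiltB; first apply: wfiltD.
  - by apply: wfiltW (wfilt_lie duv duw dvw uu X3); lia.
  - by apply: wfiltW (reduced_lie n4 red ww duw); lia.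
  - by apply: wfiltW (wfiltM (reduced_lie n4 red vv duv) uu); lia.
have {key} : wfilt (2 * n%:Z - 1 - d)
   (nf (wsquare n eps * rB - 'X * pA * ('X)%:P) (pB - 'X * rA * ('X)%:P)).
  have wB := mulw_nf n4 red wpB (wleW _ wrB).
  have {}wB : wfilt (2 * n%:Z - 1 - d) (w * nf pB rB - nf (wsquare n eps * rB) pB).
    by apply: wfiltW (wB _); lia.
  rewrite nfB nfMC nfX horner_algX -eA.
  have -> : nf (wsquare n eps * rB) pB - v * lie u v * u =
    (w * lie u w - v * lie u v * u) - (w * nf pB rB - nf (wsquare n eps * rB) pB).
    by rewrite -eB; move: (v * _ * u) (w * _) => x1 x2; ncring.
  exact: wfiltB.
move=> /(nf_wle n4 red free) []; rewrite rAE rBE => h1 h2.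
have b0 : 2 <= d -> b = 0.
  move=> d2; have [d3|d3] := ltP 2 d; first by rewrite /b wrB //; lia.
  have := h1 n.-1 0%N ltac:(lia); rewrite !coefB coef_wsquareM /= ltnn subnn.
  rewrite -mulrA coefXM /= coef0 subr0 sub0r !coefC /= => /eqP.
  by rewrite oppr_eq0 mulf_eq0 (negPf eps0) => /eqP.
exists a, b, pA, pB; split.
- by rewrite eA rAE.
- by rewrite eB rBE.
- move=> i j hij; have := h1 i.+1 j.+1 ltac:(lia).
  rewrite !coefB -['X * pA * _]mulrA coefXM /=.
  have -> : (wsquare n eps * b%:P%:P)`_j.+1`_i.+1 = 0.
    have [d2|d2] := leP 2 d; first by rewrite b0 // !polyC0 mulr0 !coef0.
    have hb : wle (2 * n%:Z - 2 + 0) (wsquare n eps * b%:P%:P).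
      by apply: wleM; [apply: wle_wsquare | apply: wleCC].
    by apply: hb; lia.
  by rewrite sub0r coefMC coefMX /= => /eqP; rewrite oppr_eq0 => /eqP.
- by apply: wleW h2; lia.
- by move=> d2; split; [rewrite /a wrA //; lia | exact: b0].
Qed.

(** The commutator of v with the same relation bounds w [v,w], and
    multiplication by w loses no weight. *)
Lemma drops_vw d : 1 <= d -> drops d -> wfilt (n%:Z - d - 1) (lie u v) ->
  wfilt (2 * n%:Z - 4 - d) (lie v w).
Proof.
move=> d1 [duv duw dvw] duv'.
have uu := wfilt_u n u v w; have vv := wfilt_v n u v w; have ww := wfilt_w n u v w.
have X3 : wfilt (2 * n%:Z - 3) (w ^+ 2 - v ^+ 2 * u + eps *: u ^+ n.-1) by case: red.
have [pD [rD [eD wpD wrD]]] := nf_leP n4 red dvw.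
have key : wfilt (3 * n%:Z - 5 - d) (w * lie v w).
  apply: wfilt_half.
  have -> : (w * lie v w) *+ 2 =
    lie v (w ^+ 2 - v ^+ 2 * u + eps *: u ^+ n.-1) + lie w (lie v w) - v ^+ 2 * lie u v
    - eps *: lie v (u ^+ n.-1).
    rewrite lieDr lieBr lieZr lieMr !lie_square liexx mulr0 lie0r mul0rn subr0 mul0r add0r.
    rewrite [lie v u]lieC mulrN.
    move: (w * _ *+ 2) (_ *: _) (lie w _) (_ * lie u v) => x1 x2 x3 x4; ncring.
  apply: wfiltB; first apply: wfiltB; first apply: wfiltD.
  - by apply: wfiltW (wfilt_lie duv duw dvw vv X3); lia.
  - by apply: wfiltW (reduced_lie n4 red ww dvw); lia.
  - by apply: wfiltW (wfiltM (wfiltX 2 vv) duv'); lia.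
  apply: wfiltZ; have -> : n.-1 = (n - 2).+1 by lia.
  have := wfilt_lie_exp (m := n%:Z - d - 1) (n - 2) (x := v).
  by rewrite [lie v u]lieC => /(_ (wfiltN duv')) h; apply: wfiltW h; lia.
have wD := mulw_nf n4 red wpD wrD; rewrite -eD in wD.
have {key} : wfilt (3 * n%:Z - 5 - d) (nf (wsquare n eps * rD) pD).
  have -> : nf (wsquare n eps * rD) pD = w * lie v w - (w * lie v w - nf (wsquare n eps * rD) pD).
    by move: (w * _) => x1; ncring.
  by apply: wfiltB => //; apply: wfiltW wD; lia.
move=> /(nf_wle n4 red free) [] h1 h2.
rewrite eD; apply: wfilt_nf; first by apply: wleW h2; lia.
by apply: (wle_wsquareM_inv n4 (eps := eps)); apply: wleW h1; lia.
Qed.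

Lemma drops_step d : 1 <= d -> drops d ->
  drops (d + 1) \/ exists2 a, a != 0 &
    wfilt (n%:Z - 2) (lie u v - a *: w) /\ wfilt (n%:Z - 1) (lie u w - a *: (v * u)).
Proof.
move=> d1 dd; have [a [b [pA [pB [eA eB wA wB ab]]]]] := drops_uv_uw d1 dd.
have c0 (c : C) : wle 0 c%:P%:P by apply: wleCC.
have [a0|a0] := eqVneq a 0.
  left; have [duv duw dvw] := dd.
  have duv' : wfilt (n%:Z - d - 1) (lie u v).
    by rewrite eA a0; apply: wfilt_nf => //; rewrite !polyC0; apply: wle0.
  split; first by apply: wfiltW duv'; lia.
    rewrite eB; apply: wfilt_nf.
      by move: wB; rewrite a0 !polyC0 mulr0 mul0r subr0; apply: wleW; lia.
    have [d2|d2] := leP 2 d; last by apply: wleW (c0 b); lia.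
    by have [_ ->] := ab d2; rewrite !polyC0; apply: wle0.
  by apply: wfiltW (drops_vw d1 dd duv'); lia.
right; have d1' : d = 1.
  by have [/ab [a00 _]|] := leP 2 d; [rewrite a00 eqxx in a0|lia].
rewrite d1' in wA wB; exists a => //; split.
  have -> : lie u v - a *: w = nf pA 0.
    by rewrite eA /nf ev0 addr0 evCC addrK.
  by apply: wfilt_nf; [apply: wleW wA; lia | apply: wle0].
have -> : lie u w - a *: (v * u) = nf (pB - 'X * a%:P%:P * ('X)%:P) b%:P%:P.
  rewrite -[b%:P%:P in RHS]subr0 nfB -eB; congr (_ - _).
  by rewrite /nf ev0 addr0 evMC evX horner_algX evCC -scalerAr mulr1 scalerAl.
by apply: wfilt_nf; [apply: wleW wB; lia | apply: wleW (c0 b); lia].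
Qed.

Lemma drops1 : drops 1.
Proof.
by have [h1 h2 h3 _] := red; split; [apply: wfiltW h1|apply: wfiltW h2|apply: wfiltW h3]; lia.
Qed.

(** If the scalar a were zero at every step, the commutators of the generators
    would lie in arbitrarily negative weight. *)
Lemma noncommutative_leading :
  ~ [/\ lie u v = 0, lie u w = 0 & lie v w = 0] -> exists2 a, a != 0 &
    wfilt (n%:Z - 2) (lie u v - a *: w) /\ wfilt (n%:Z - 1) (lie u w - a *: (v * u)).
Proof.
move=> nc; have h (N : nat) : drops (1 + N%:Z) \/ exists2 a, a != 0 &
    wfilt (n%:Z - 2) (lie u v - a *: w) /\ wfilt (n%:Z - 1) (lie u w - a *: (v * u)).
  elim: N => [|N [IH|IH]]; [by left; rewrite addr0; apply: drops1| |by right].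
  have -> : 1 + N.+1%:Z = (1 + N%:Z) + 1 by lia.
  by apply: drops_step IH; lia.
(* After 3n steps the bounds on the weights of the commutators are negative. *)
have [[h1 h2 h3]|//] := h (3 * n)%N; case: nc.
have n2 : (1 < n)%N by lia.
by split; [apply: wfilt_lt0 h1|apply: wfilt_lt0 h2|apply: wfilt_lt0 h3] => //; lia.
Qed.

End Step.

(** * Normalising the commutators with u *)

Section Normalisation.
Variables (C : fieldType) (A : algType C) (n : nat).
Hypothesis n4 : (4 <= n)%N.
Hypothesis two : (2 : C) != 0.
Implicit Types u v w : A.

Definition standard eps u v w := [/\ eps != 0, reduced n u v w eps & nf_free u v w].

Lemma wfilt_horner_of u v w y k (c : {poly C}) : weight_filt n u v w 2 y ->
  (forall i : nat, k < 2 * i%:Z -> c`_i = 0) -> weight_filt n u v w k c.<[y]>.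
Proof.
move=> y2 h; rewrite horner_coef_alg; apply: wfilt_sum => i _.
have [ki|ki] := ltP k (2 * i%:Z); first by rewrite h // scale0r; apply: Wfilt0.
apply: wfiltZ; apply: wfiltW ki _; rewrite mulrC; exact: wfiltX.
Qed.

Lemma horner_alg_comp u (c e : {poly C}) : (c \Po e).<[u]> = c.<[e.<[u]>]>.
Proof.
rewrite comp_polyE rmorph_sum horner_coef_alg; apply: eq_bigr => i _ /=.
by rewrite linearZ /= mulr_algl rmorphXn.
Qed.

Lemma half_mulr2n (x : A) : (2^-1 *: x) *+ 2 = x.
Proof. by rewrite -scaler_nat scalerA mulfV // scale1r. Qed.

Lemma lie_horner u (c : {poly C}) : lie u c.<[u]> = 0.
Proof.
rewrite /lie -{1 4}[u]horner_algX -!rmorphM mulrC subrr //.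
Qed.

(** Scaling makes the scalar a equal to 2. The relation [u,v] = v + 2w can
    then be imposed exactly by solving it for w. *)
Lemma normalise_bracket_uv eps u v w a : standard eps u v w -> a != 0 ->
  weight_filt n u v w (n%:Z - 2) (lie u v - a *: w) ->
  weight_filt n u v w (n%:Z - 1) (lie u w - a *: (v * u)) ->
  exists u1 v1 w1 eps1, [/\ standard eps1 u1 v1 w1,
    forall k x, weight_filt n u1 v1 w1 k x <-> weight_filt n u v w k x,
    lie u1 v1 = v1 + w1 *+ 2 &
    weight_filt n u1 v1 w1 (n%:Z - 1) (lie u1 w1 - (v1 * u1) *+ 2)].
Proof.
move=> [eps0 red free] a0 huv huw.
(* With l u and m w in place of u and w, the scalar a becomes l a / m = m a = 2,
   and l = m^2 preserves the shape of the relation for w^2. *)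
pose l := 4 / a ^+ 2; pose m := 2 / a.
have four : (4 : C) != 0 by rewrite (natrM C 2 2) mulf_neq0.
have l0 : l != 0 by rewrite mulf_neq0 // invr_eq0 expf_neq0.
have m0 : m != 0 by rewrite mulf_neq0 // invr_eq0.
have lm : m ^+ 2 = 1 ^+ 2 * l by rewrite /l /m; field.
pose u1 := l *: u; pose w1 := 2^-1 *: (lie u1 v - v).
have vv := wfilt_v n u v w; have uu := wfilt_u n u v w.
have hw : weight_filt n u v w (n%:Z - 2) (w1 - m *: w).
  have -> : w1 - m *: w = (l / 2) *: (lie u v - a *: w) - 2^-1 *: v.
    rewrite /w1 /u1 lieZl !scalerBr !scalerA [l / 2]mulrC.
    have -> : 2^-1 * l * a = m by rewrite /l /m; field; rewrite a0.
    by rewrite addrAC.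
  by apply: wfiltB; apply: wfiltZ.
have hu : weight_filt n u v w 1 (u1 - l *: u) by rewrite subrr; apply: Wfilt0.
have hv : weight_filt n u v w (n%:Z - 3) (v - 1 *: v).
  by rewrite scale1r subrr; apply: Wfilt0.
have one0 : (1 : C) != 0 := oner_neq0 _.
have pw := perturb_wfilt n4 l0 one0 m0 hu hv hw.
have pf := perturb_nf_free n4 red free l0 one0 m0 hu hv hw.
pose eps1 := m ^+ 2 * eps / l ^+ n.-1.
have pr : reduced n u1 v w1 eps1.
  apply: (perturb_reduced n4 red l0 one0 m0 hu hv hw) lm _.
  by rewrite /eps1 divfK // expf_neq0.
exists u1, v, w1, eps1; split=> //.
- by split=> //; rewrite /eps1 !mulf_neq0 ?invr_eq0 ?expf_neq0.
- rewrite /w1 -scaler_nat scalerA mulfV // scale1r addrC subrK //.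
apply/pw; have -> : lie u1 w1 - v * u1 *+ 2 =
   (m * l) *: (lie u w - a *: (v * u)) + lie u1 (w1 - m *: w).
  have E1 : lie u1 (m *: w) = (m * l) *: lie u w by rewrite lieZr lieZl scalerA.
  have E2 : v * u1 *+ 2 = (m * l) *: (a *: (v * u)).
    rewrite -scalerAr -scaler_nat !scalerA; congr (_ *: _).
    by rewrite /l /m; field; rewrite a0.
  rewrite lieBr E1 E2 scalerBr.
  move: (_ *: lie u w) (_ *: (_ *: _)) (lie _ w1) => x1 x2 x3; ncring.
apply: wfiltD; first exact: wfiltZ.
by apply: wfiltW (reduced_lie n4 red (wfiltZ l uu) hw); lia.
Qed.

Lemma nf_low u v w p (r : {poly {poly C}}) : weight_le n (n%:Z - 1) p -> weight_le n 0 r ->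
  nf u v w p r = (p`_0).<[u]> + p`_1`_0 *: v + r`_0`_0 *: w.
Proof.
move=> hp hr; rewrite /nf.
have rE : r = (r`_0`_0)%:P%:P.
  apply/polyP => j; apply/polyP => i; rewrite coefC.
  case: j => [|j]; first by rewrite coefC; case: i => [|i] //=; apply: hr; lia.
  by rewrite coef0; apply: hr; nia.
have pE : p = (p`_0)%:P + 'X * (p`_1`_0)%:P%:P.
  apply/polyP => j; rewrite coefD coefC coefXM coefC.
  case: j => [|[|j]] /=; first by rewrite addr0.
    rewrite add0r; apply/polyP => i; rewrite coefC; case: i => [|i] //=; apply: hp; lia.
  by rewrite addr0; apply/polyP => i; rewrite coef0; apply: hp; nia.
by rewrite [in LHS]rE [in LHS]pE evD evX !evCC evC mul1r -scalerAr mulr1.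
Qed.

(** The part of [u,w] - 2vu below the leading term is f(u) + d v + c w. A
    translation of u removes d v, and adding to v a polynomial in u reduces f
    to a constant. *)
Lemma normalise_bracket_uw eps u v w : standard eps u v w ->
  lie u v = v + w *+ 2 ->
  weight_filt n u v w (n%:Z - 1) (lie u w - (v * u) *+ 2) ->
  exists u1 v1 w1 eps1 c rho, [/\ standard eps1 u1 v1 w1,
    forall k x, weight_filt n u1 v1 w1 k x <-> weight_filt n u v w k x,
    lie u1 v1 = v1 + w1 *+ 2 &
    lie u1 w1 = (v1 * u1) *+ 2 + c *: w1 + rho%:A].
Proof.
move=> [eps0 red free] huv huw.
have [p [r [e hp hr]]] := nf_leP n4 red huw.
have {}e : lie u w = v * u *+ 2 + ((p`_0).<[u]> + p`_1`_0 *: v + r`_0`_0 *: w).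
  rewrite -nf_low -?e //; last by rewrite subrr in hr.
  by rewrite addrC subrK.
have r2 : forall i : nat, n%:Z - 1 < 2 * i%:Z -> p`_0`_i = 0 by move=> i hi; apply: hp; lia.
move: (p`_0) r2 (p`_1`_0) (r`_0`_0) e => {p hp r hr} f f2 d c e.
(* Since 2 v (u + d/2) = 2 v u + d v. *)
pose t := d / 2; pose u1 := u + t%:A.
have uu := wfilt_u n u v w; have vv := wfilt_v n u v w.
have hu1 : weight_filt n u v w 2 u1.
  by apply: wfiltD => //; apply: wfilt_alg.
pose f1 := f \Po ('X - t%:P).
have uE : u = ('X - t%:P).<[u1]> by rewrite rmorphB /= horner_algX horner_algC addrK.
have f1E : f1.<[u1]> = f.<[u]> by rewrite [in RHS]uE horner_alg_comp.
(* Adding g(u)/2 to v and -g(u)/4 to w changes f(u) into f(u) - g(u)(u - c/4),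
   so g is the quotient of f by x - c/4. *)
pose z := c / 4.
have [g gE] : exists g, f1 - f1.[z]%:P = g * ('X - z%:P).
  by apply/factor_theorem; rewrite /root !hornerE subrr.
have uc (y : A) : lie u1 y = lie u y.
  by rewrite lieDl lieZl lie1l scaler0 addr0.
pose v1 := v + (2^-1 *: g).<[u1]>; pose w1 := w - 2^-1 *: (2^-1 *: g).<[u1]>.
have sg (i : nat) : n%:Z - 3 < 2 * i%:Z -> g`_i = 0.
  move=> hi; have [ig|gi] := ltnP i (size g); last exact: nth_default.
  have g0 : g != 0 by rewrite -size_poly_gt0; apply: leq_ltn_trans ig.
  have sz : (size g < maxn (size f) 1)%N.
    have := size_polyD f1 (- f1.[z]%:P); rewrite gE size_Mmonic ?monicXsubC //.
    rewrite size_XsubC addn2 /= size_polyN size_comp_poly2 ?size_XsubC // => h.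
    by apply: leq_trans h _; rewrite geq_max leq_maxl leq_max size_polyC leq_b1 orbT.
  have sf : (i.+1 < size f)%N.
    by have := leq_ltn_trans ig sz; rewrite leq_max [(i.+1 < 1)%N]ltnS ltn0 orbF.
  have : f`_(size f).-1 != 0 by rewrite -lead_coefE lead_coef_eq0 -size_poly_gt0; apply: leq_ltn_trans sf.
  by rewrite f2 ?eqxx //; move: sf; case: (size f) => // m; lia.
have gw : weight_filt n u v w (n%:Z - 3) (2^-1 *: g).<[u1]>.
  by apply: wfilt_horner_of => // i hi; rewrite coefZ sg // mulr0.
have hu : weight_filt n u v w 1 (u1 - 1 *: u).
  by rewrite scale1r /u1 addrAC subrr add0r; apply: wfilt_alg.
have hv : weight_filt n u v w (n%:Z - 3) (v1 - 1 *: v) by rewrite scale1r /v1 addrAC subrr add0r.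
have hw : weight_filt n u v w (n%:Z - 2) (w1 - 1 *: w).
  rewrite scale1r /w1 addrAC subrr add0r; apply: wfiltN; apply: wfiltZ.
  by apply: wfiltW gw; lia.
have one0 : (1 : C) != 0 := oner_neq0 _.
exists u1, v1, w1, eps, c, f1.[z]; split.
- split=> //; first by apply: (perturb_reduced n4 red one0 one0 one0 hu hv hw); rewrite !expr1n ?mul1r ?mulr1.
  exact: (perturb_nf_free n4 red free one0 one0 one0 hu hv hw).
- exact: (perturb_wfilt n4 one0 one0 one0 hu hv hw).
- rewrite /v1 lieDr lie_horner addr0 uc huv /w1 mulrnBl half_mulr2n.
  by rewrite addrACA subrr addr0.
rewrite {1}/w1 lieBr lieZr lie_horner scaler0 subr0 uc e -f1E.
pose H := (2^-1 *: g).<[u1]>.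
have gH : g.<[u1]> = H *+ 2 by rewrite /H linearZ /= mulr_algl half_mulr2n.
have -> : f1.<[u1]> = (H * u1) *+ 2 - (c / 2) *: H + f1.[z]%:A.
  have {1}-> : f1 = g * ('X - z%:P) + f1.[z]%:P by rewrite -gE subrK.
  rewrite rmorphD rmorphM rmorphB /= horner_algX !horner_algC gH mulrBr mulr_algr.
  rewrite mulrnAl; congr (_ - _ + _); rewrite -scaler_nat scalerA; congr (_ *: _).
  have four : (4 : C) != 0 by rewrite (natrM C 2 2) mulf_neq0.
  by rewrite /z; field; rewrite four two.
have -> : v * u *+ 2 = (v * u1) *+ 2 - d *: v.
  rewrite /u1 mulrDr mulr_algr mulrnDl -[(t *: v) *+ 2]scaler_nat scalerA.
  by rewrite /t mulrC divfK // addrK.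
rewrite /v1 /w1 -/H scalerBr scalerA mulrDl mulrnDl.
move: (v * u1 *+ 2) (d *: v) (H * u1 *+ 2) (_ *: H) (_ *: w) (_%:A) => x1 x2 x3 x4 x5 x6.
ncring.
Qed.

End Normalisation.

(** * The remaining relations *)

Lemma eq0_of_sub (V : zmodType) (x l r : V) : l = r -> x = l - r -> x = 0.
Proof. by move=> -> ->; rewrite subrr. Qed.

Section Shapes.
Variables (C : fieldType) (n : nat).
Implicit Types (p r : {poly {poly C}}) (a b c : {poly C}).

(** Elimination gives a (1 - 4x) = 0. *)
Lemma affine_pair_eq0 a b : 2%:P * a + b = 0 -> a + 2%:P * ('X * b) = 0 -> a = 0 /\ b = 0.
Proof.
move=> e1 e2; have bE : b = - (2%:P * a) by apply/eqP; rewrite -addr_eq0 addrC e1.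
have : a * (1 - 4%:P * 'X) = 0.
  by rewrite -e2 bE (_ : 4 = 2 * 2) ?polyCM; [ring | rewrite -natrM].
move/eqP; rewrite mulf_eq0 => /orP[/eqP a0|/eqP /(congr1 (fun f : {poly C} => f`_0))].
  by rewrite bE a0 mulr0 oppr0.
by rewrite coefB coefCM coefX coef1 mulr0 subr0 coef0 => /eqP; rewrite oner_eq0.
Qed.

Lemma quadratic_free a b c : a%:P + 'X * b%:P + 'X^2 * c%:P = 0 -> [/\ a = 0, b = 0 & c = 0].
Proof.
move=> h; have co j := congr1 (fun f : {poly {poly C}} => f`_j) h.
split.
- by have := co 0%N; rewrite !(coefD, coefXM, coefXnM, coefC, coef0) /= ?coefC /= ?addr0 ?add0r.
- by have := co 1%N; rewrite !(coefD, coefXM, coefXnM, coefC, coef0) /= ?coefC /= ?addr0 ?add0r.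
- by have := co 2%N; rewrite !(coefD, coefXM, coefXnM, coefC, coef0) /= ?coefC /= ?addr0 ?add0r.
Qed.

Lemma quadratic_shape p : (4 <= n)%N -> weight_le n (2 * n%:Z - 3) p ->
  p = (p`_0)%:P + 'X * (p`_1)%:P + 'X^2 * (p`_2`_0)%:P%:P.
Proof.
move=> n4 hp; apply/polyP => j; rewrite !coefD coefC coefXM coefXnM !coefC.
case: j => [|[|[|j]]] /=; rewrite ?addr0 ?add0r //.
  by apply/polyP => i; rewrite coefC; case: i => [|i] //=; apply: hp; lia.
by apply/polyP => i; rewrite coef0; apply: hp; nia.
Qed.

Lemma linear_shape r : (4 <= n)%N -> weight_le n (n%:Z - 2) r ->
  r = (r`_0)%:P + 'X * (r`_1`_0)%:P%:P.
Proof.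
move=> n4 hr; apply/polyP => j; rewrite coefD coefC coefXM coefC.
case: j => [|[|j]] /=; rewrite ?addr0 ?add0r //.
  by apply/polyP => i; rewrite coefC; case: i => [|i] //=; apply: hr; lia.
by apply/polyP => i; rewrite coef0; apply: hr; nia.
Qed.

End Shapes.

Section Jacobi.
Variables (C : fieldType) (A : algType C) (n : nat) (u v w : A) (eps c rho : C).
Hypothesis n4 : (4 <= n)%N.
Hypothesis two : (2 : C) != 0.
Hypothesis red : reduced n u v w eps.
Hypothesis free : nf_free u v w.
Hypothesis uv : lie u v = v + w *+ 2.
Hypothesis uw : lie u w = (v * u) *+ 2 + c *: w + rho%:A.
Local Notation wfilt := (weight_filt n u v w).
Local Notation wle := (@weight_le C n).
Local Notation NF := (nf u v w).
Local Notation "a %:PP" := (a%:P%:P : {poly {poly C}}) (at level 2, format "a %:PP").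
Local Notation K := (lie v w).
Local Notation U := (('X)%:P : {poly {poly C}}).

Lemma nf_expv j : NF ('X^j) 0 = v ^+ j.
Proof. by rewrite /nf ev0 addr0 -['X^j]mulr1 evXn -[X in polyev _ _ _ X]polyC1 evC rmorph1 !mulr1. Qed.

Lemma nf_expvw j : NF 0 ('X^j) = v ^+ j * w.
Proof. by rewrite /nf ev0 add0r -['X^j]mulr1 evXn -[X in polyev _ _ _ X]polyC1 evC rmorph1 !mulr1. Qed.

(** Jacobi identity for u, v and w. *)
Lemma lie_u_K : lie u K = (1 + c) *: K - 2 *: (v ^+ 2 + 2 *: (v * w)).
Proof.
have -> : lie u K = lie u v * w + v * lie u w - lie u w * v - w * lie u v.
  by rewrite /lie; ncring.
have vu : v * (v * u) = v * (u * v) - v * (v + w *+ 2) by rewrite -uv /lie; ncring.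
rewrite uv uw scalerDl scale1r !scaler_nat mulr2n.
have -> : (v + (w + w)) * w + v * (v * u + v * u + c *: w + rho%:A)
  - (v * u + v * u + c *: w + rho%:A) * v - w * (v + (w + w)) =
  (v * w - w * v) + (v * (c *: w) - (c *: w) * v) + (v * rho%:A - rho%:A * v)
  + (v * (v * u) + v * (v * u) - v * (u * v) - v * (u * v)
  + (v * (u * v) + v * (u * v) - v * u * v - v * u * v)) by ncring.
have -> : v * rho%:A - rho%:A * v = 0 by rewrite mulr_algr mulr_algl subrr.
rewrite vu -scalerAr -scalerAl -[c *: lie v w]/(c *: (v * w - w * v)) scalerBr /lie.
move: (c *: (v * w)) (c *: (w * v)) => x1 x2.
rewrite expr2 !mulr2n; ncring.
Qed.

Lemma lie_u_vv : lie u (v ^+ 2) = 2 *: v ^+ 2 + 4 *: (v * w) - 2 *: K.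
Proof.
by rewrite !expr2 lieMr uv !scaler_nat !(mulrS, mulr0n) /lie; ncring.
Qed.

Lemma lie_u_vw : lie u (v * w) = 2 *: w ^+ 2 + (1 + c) *: (v * w) + 2 *: (v ^+ 2 * u) + rho *: v.
Proof.
rewrite lieMr uv uw !mulrDr mulr_algr -scalerAr scalerDl scale1r !scaler_nat !(mulrS, mulr0n).
by move: (c *: _) (rho *: _) => x1 x2; rewrite !expr2; ncring.
Qed.

Lemma lie_u_mulr x (f : {poly C}) : lie u (x * f.<[u]>) = lie u x * f.<[u]>.
Proof. by rewrite lieMr lie_horner mulr0 addr0. Qed.

(** The weight of [v,w] is at most 2n - 4, which leaves room for few normal
    forms. *)
Lemma lie_shape : exists (P B D : {poly C}) (k : C),
  (forall i : nat, 2 * n%:Z - 4 < 2 * i%:Z -> P`_i = 0) /\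
  K = NF (P%:P + 'X * B%:P + 'X^2 * k%:PP) D%:P.
Proof.
have [_ _ h _] := red; have [p [r [-> hp hr]]] := nf_leP n4 red h.
exists p`_0, p`_1, r`_0, p`_2`_0; split; first by move=> i hi; apply: hp; lia.
rewrite -(quadratic_shape n4); last by apply: wleW hp; lia.
congr NF; rewrite [LHS](linear_shape n4); last by apply: wleW hr; lia.
have -> : r`_1`_0 = 0 by apply: hr; lia.
by rewrite !polyC0 mulr0 addr0.
Qed.

Lemma nf_const a : NF a%:PP 0 = a%:A.
Proof. by rewrite /nf ev0 addr0 evCC. Qed.

Lemma nf_constw a : NF 0 a%:PP = a *: w.
Proof. by rewrite /nf ev0 add0r evCC. Qed.

Lemma nf_v : NF 'X 0 = v. Proof. exact: (nf_expv 1). Qed.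
Lemma nf_vw : NF 0 'X = v * w. Proof. exact: (nf_expvw 1). Qed.

Lemma nf_split p r : NF p r = NF p 0 + NF 0 r.
Proof. by rewrite -nfD addr0 add0r. Qed.

Lemma nf_vu : NF ('X * U) 0 = v * u.
Proof. by rewrite -[X in NF _ X](mul0r U) nfMC horner_algX nf_v. Qed.

Lemma nf_uv : NF 'X 2%:PP = lie u v.
Proof. by rewrite uv nf_split nf_v nf_constw scaler_nat. Qed.

Lemma nf_uw : NF (2%:PP * ('X * U) + rho%:PP) c%:PP = lie u w.
Proof.
rewrite uw nf_split nf_constw -[X in NF _ X + _]addr0 nfD nf_const.
by rewrite -[X in NF _ X](mulr0 2%:PP) nfZ nf_vu scaler_nat addrAC.
Qed.

(** The commutator [u,[v,w]] is computed from the Jacobi identity and from the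
    normal form of [v,w]. Comparison determines every coefficient except the
    polynomial P. *)
Lemma lie_vw_shape : exists P : {poly C},
  [/\ c = 1, K = P.<[u]> - v ^+ 2 & forall i : nat, 2 * n%:Z - 4 < 2 * i%:Z -> P`_i = 0].
Proof.
have [P [B [D [k [sP KE]]]]] := lie_shape.
have E1 : K = P.<[u]> + v * B.<[u]> + k *: v ^+ 2 + w * D.<[u]>.
  by rewrite KE /nf !evD evC mul1r evX evXn evC mul1r evCC evC -scalerAr mulr1.
have := lie_u_K.
rewrite {1}E1 !lieDr lie_horner add0r lieZr !lie_u_mulr lie_u_vv -nf_uv -nf_uw KE.
rewrite -(nf_expv 2) -nf_vw -!nfMC -!nfZ -!nfD -!nfZ -!nfB -!nfZ -!nfD -?nfZ -?nfB.
move=> /(nf_inj free) [ep er].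
have [] := @quadratic_free _ (2%:P * B - (2 * k)%:P * D - D) (4 * k + 4)%:P 0.
  apply: (eq0_of_sub er).
  by rewrite !(polyCD, polyCM); ring.
move=> r0 /eqP; rewrite polyC_eq0 => /eqP k4 _.
have four : (4 : C) != 0 by rewrite (natrM C 2 2) mulf_neq0.
(* The coefficient of v w gives k = -1, and that of v^2 then gives c = 1. *)
have kE : k = -1.
  by apply: (mulfI four); apply/eqP; rewrite -subr_eq0 mulrN opprK mulr1 k4.
have [] := @quadratic_free _ (rho%:P * D - (1 + c + 2 * k)%:P * P)
   (B + 2%:P * ('X * D) - (1 + c + 2 * k)%:P * B) (2 * k + 2 - (1 + c + 2 * k) * k)%:P.
  apply: (eq0_of_sub ep).
  by rewrite !(polyCD, polyCM, polyCN); ring.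
move=> _ p1 /eqP; rewrite polyC_eq0 kE => /eqP c1.
have cE : c = 1 by apply/eqP; rewrite -subr_eq0 -c1; apply/eqP; ring.
have BD : B = 0 /\ D = 0.
  apply: affine_pair_eq0.
  - by rewrite -r0 kE !(polyCD, polyCM, polyCN); ring.
  - move: p1; have -> : 1 + c + 2 * k = 0 by rewrite kE cE; ring.
    by rewrite polyC0 mul0r subr0.
exists P; case: BD => -> ->; split=> //.
rewrite (nf_expv 2) !polyC0 mulr0 addr0 /nf ev0 addr0 evD evC mul1r evXn evCC.
by rewrite scaleN1r mulrN mulr1.
Qed.

(** The weight of w^2 - v^2 u + eps u^(n-1) is at most 2n - 3. *)
Lemma square_shape : exists (Q T S : {poly C}) (k l : C),
  [/\ Q`_n.-1 = eps, (size Q <= n)%N &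
   w ^+ 2 = NF ('X^2 * U + 'X^2 * k%:PP + 'X * T%:P - Q%:P) (S%:P + 'X * l%:PP)].
Proof.
have [_ _ _ h] := red.
have uu := wfilt_u n u v w; have vv := wfilt_v n u v w.
have [p [r [e hp hr]]] := nf_leP n4 red h.
exists (eps *: 'X^(n.-1) - p`_0), p`_1, r`_0, p`_2`_0, r`_1`_0; split.
- rewrite coefB coefZ coefXn eqxx mulr1 hp ?subr0 //; lia.
- apply/leq_sizeP => i ni; rewrite coefB coefZ coefXn hp; last lia.
  by case: eqP => [ie|_]; [lia | rewrite mulr0 subr0].
have pE := quadratic_shape n4 hp.
have rE : r = (r`_0)%:P + 'X * (r`_1`_0)%:PP.
  by apply: (linear_shape n4); apply: wleW hr; lia.
rewrite -rE polyCB opprB.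
have -> : 'X^2 * U + 'X^2 * (p`_2`_0)%:PP + 'X * (p`_1)%:P + ((p`_0)%:P - (eps *: 'X^(n.-1))%:P)
  = p + ('X^2 * U - (eps *: 'X^(n.-1))%:P) by rewrite {4}pE; ring.
rewrite -[r]addr0 nfD -e.
have -> : NF ('X^2 * U - (eps *: 'X^(n.-1))%:P) 0 = v ^+ 2 * u - eps *: u ^+ n.-1.
  rewrite /nf ev0 addr0 evB evC mul1r linearZ /= mulr_algl rmorphXn /= horner_algX.
  by rewrite evMC horner_algX -[polyev _ _ _ _]addr0 -(ev0 u v w) -/(nf _ _ _ _ _) (nf_expv 2).
move: (v ^+ 2 * u) (_ *: _) => x1 x2; ncring.
Qed.

Lemma lie_u_square (P : {poly C}) : c = 1 -> K = P.<[u]> - v ^+ 2 ->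
  lie u (w ^+ 2) = 4 *: (v * w * u) + 6 *: (v ^+ 2 * u) + 2 *: (v * w) + (2 * rho) *: v
    - 2 *: (P.<[u]> * u) + 2 *: w ^+ 2 + (2 * rho) *: w.
Proof.
move=> cE KE.
have wvE : w * v = v * w - P.<[u]> + v ^+ 2.
  have -> : v * w - P.<[u]> + v ^+ 2 = v * w - (P.<[u]> - v ^+ 2) by ncring.
  by rewrite -KE /lie opprB addrC subrK.
have uwE : u * w = w * u + ((v * u) *+ 2 + w + rho%:A).
  by rewrite -[w in _ + w + _]scale1r -cE -uw /lie addrC subrK.
have wvu : w * (v * u) = (v * w - P.<[u]> + v ^+ 2) * u by rewrite -wvE mulrA.
rewrite expr2 lieMr uw cE scale1r.
have -> : (v * u *+ 2 + w + rho%:A) * w + w * (v * u *+ 2 + w + rho%:A) =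
   (v * (u * w)) *+ 2 + (w * (v * u)) *+ 2 + (w * w) *+ 2 + (2 * rho) *: w.
  rewrite mulrDr mulrDl !mulr2n mulrDl mulrDr mulr_algl mulr_algr.
  rewrite -[(2 * rho) *: w]scalerA scaler_nat mulr2n; move: (rho *: w) => x1; ncring.
rewrite wvu uwE !mulrDr mulr_algr -!scalerA !scaler_nat !(mulrS, mulr0n).
move: (rho *: w) (rho *: v) (P.<[u]>) => x1 x2 x3; rewrite !expr2; ncring.
Qed.

Lemma nf_horner (f : {poly C}) : NF f%:P 0 = f.<[u]>.
Proof. by rewrite /nf ev0 addr0 evC mul1r. Qed.

Lemma nf_vvu : NF ('X^2 * U) 0 = v ^+ 2 * u.
Proof. by rewrite -[X in NF _ X](mul0r U) nfMC horner_algX (nf_expv 2). Qed.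

Lemma nf_vwu : NF 0 ('X * U) = v * w * u.
Proof. by rewrite -[X in NF X _](mul0r U) nfMC horner_algX nf_vw. Qed.

(** Again two computations are compared, now of [u,w^2]: one by the derivation
    rule, one from the normal form of w^2. *)
Lemma square_relation (P : {poly C}) : c = 1 -> K = P.<[u]> - v ^+ 2 ->
  exists Q : {poly C}, [/\ Q`_n.-1 = eps, (size Q <= n)%N &
    w ^+ 2 = v ^+ 2 * u + v * w + rho *: v - Q.<[u]>].
Proof.
move=> cE KE; have [Q [T [S [k [l [Qn sQ wwE]]]]]] := square_shape.
have four : (4 : C) != 0 by rewrite (natrM C 2 2) mulf_neq0.
have E : w ^+ 2 = v ^+ 2 * ('X + k%:P).<[u]> + l *: (v * w) + w * S.<[u]> + v * T.<[u]> - Q.<[u]>.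
  rewrite wwE nf_split /nf !ev0 addr0 add0r !(evB, evD) !(evX, evXn) !evCC !evC.
  rewrite rmorphD /= horner_algX horner_algC !mul1r mulrDr -!scalerAr !mulr1.
  rewrite ?horner_algX.
  move: (_ *: _) (_ *: _) => x1 x2; ncring.
have Zl a p : a *: NF p 0 = NF (a%:PP * p) 0 by rewrite -nfZ mulr0.
have Zr a r : a *: NF 0 r = NF 0 (a%:PP * r) by rewrite -nfZ mulr0.
have hv a : a *: v = NF (a%:PP * 'X) 0 by rewrite -{1}nf_v Zl.
have hvv : v ^+ 2 = NF ('X^2) 0 by rewrite (nf_expv 2).
have hPu : P.<[u]> * u = NF (P * 'X)%:P 0 by rewrite nf_horner rmorphM /= horner_algX.
have := lie_u_square cE KE; rewrite {1}E.
rewrite lieBr !lieDr lieZr !lie_u_mulr lie_horner subr0 lie_u_vv lie_u_vw cE KE.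
rewrite -nf_uv -nf_uw cE !hv !scalerBr wwE -nf_vvu -nf_vwu -nf_vw hPu -nf_horner hvv.
rewrite -nf_constw -!nfZ -!nfD -!nfB -?nfD -!nfMC -?nfZ -!nfD -?nfB -?nfD.
move=> /(nf_inj free) [ep er].
have [] := @quadratic_free _ (2%:P * Q - (2 * l)%:P * Q + rho%:P * S - (2 * k)%:P * P)
  ((2 * l - 1)%:P * T + 2%:P * ('X * S) + (l * rho - 2 * rho)%:P)
  ((4 * l - 4)%:P * 'X + (2 * k + 2 * l * k)%:P).
  apply: (eq0_of_sub ep). rewrite !(polyCD, polyCM, polyCN); ring.
move=> _ p1 p2.
have [] := @quadratic_free _ ((2 * l - 1)%:P * S + 2%:P * T - (2 * rho)%:P)
  (4 * k + 2 * l * l - 2)%:P 0.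
  apply: (eq0_of_sub er). rewrite !(polyCD, polyCM, polyCN); ring.
move=> r0 _ _.
(* The coefficients of v^2 u and v^2 give l = 1 and k = 0. *)
have lE : l = 1.
  have /eqP := congr1 (fun f : {poly C} => f`_1) p2.
  rewrite coefD coefCM coefX coefC coef0 /= mulr1 addr0 => /eqP l4.
  by apply: (mulfI four); apply/eqP; rewrite -subr_eq0 mulr1 l4.
have kE : k = 0.
  have := congr1 (fun f : {poly C} => f`_0) p2.
  rewrite coefD coefCM coefX coefC coef0 /= mulr0 add0r lE => k4.
  by apply: (mulfI four); rewrite mulr0 -k4; ring.
have [T0 S0] : T - rho%:P = 0 /\ S = 0.
  apply: affine_pair_eq0.
    by rewrite -r0 lE !(polyCD, polyCM, polyCN); ring.
  by rewrite -p1 lE !(polyCD, polyCM, polyCN); ring.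
have TE : T = rho%:P by apply/eqP; rewrite -subr_eq0 T0.
exists Q; split=> //; rewrite S0 TE kE lE -nf_horner -nfB; congr NF.
  by rewrite polyC0 !mulr0 [_%:PP * 'X]mulrC.
by rewrite polyC0 polyC1 mulr1 !addr0 subr0.
Qed.

End Jacobi.

(** * Symmetry of the parameters *)

Section Compatibility.
Variables (C : fieldType) (A : algType C) (u v w : A) (rho : C) (P Q : {poly C}).
Hypothesis rel : Drel rho P Q u v w.
Hypothesis free : nf_free u v w.
Implicit Types a b p : {poly C}.

(** In the skew group algebra u is h^2, while v a(u) + w b(u) has leading
    coefficient a(h^2) + h b(h^2); a pair of polynomials in u is therefore
    treated as one polynomial in h. *)
Definition evenodd a b : {poly C} := (a \Po 'X^2) + 'X * (b \Po 'X^2).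

Lemma evenoddD a b a' b' : evenodd (a + a') (b + b') = evenodd a b + evenodd a' b'.
Proof. by rewrite /evenodd !comp_polyD; ring. Qed.

Lemma evenodd_inj a b a' b' : evenodd a b = evenodd a' b' -> a = a' /\ b = b'.
Proof.
move/eqP; rewrite -subr_eq0 => /eqP h.
have [|] := @even_odd_free _ (a - a') (b - b').
  by rewrite -h /evenodd !comp_polyB; ring.
by move=> /eqP + /eqP; rewrite !subr_eq0 => /eqP-> /eqP->.
Qed.

(** Moving p(u) to the right of v a(u) + w b(u) replaces h by h + 1, as it
    does for the group generator of the skew group algebra. *)
Lemma horner_mul_vw p a b : exists a' b' c,
  p.<[u]> * (v * a.<[u]> + w * b.<[u]>) = v * a'.<[u]> + w * b'.<[u]> + c.<[u]> /\
  evenodd a' b' = (p \Po ('X + 1) ^+ 2) * evenodd a b.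
Proof.
have [uv uw _ _] := rel.
have uvE : u * v = v * u + (v + w *+ 2) by rewrite -uv /lie addrC subrK.
have uwE : u * w = w * u + (v * u) *+ 2 + w + rho%:A.
  by move: uw; rewrite /lie => /eqP; rewrite subr_eq => /eqP ->; ncring.
elim/poly_ind: p a b => [|p d IH] a b.
  by exists 0, 0, 0; rewrite /evenodd !comp_poly0 !rmorph0 !mulr0 !mul0r !addr0.
have [a' [b' [c [e1 e2]]]] := IH ('X * a + a + 2%:P * ('X * b)) (2%:P * a + 'X * b + b).
exists (a' + d%:P * a), (b' + d%:P * b), (c + p * (rho%:P * b)); split.
  rewrite rmorphD rmorphM /= horner_algX horner_algC mulrDl -mulrA.
  have -> : u * (v * a.<[u]> + w * b.<[u]>) =
    v * ('X * a + a + 2%:P * ('X * b)).<[u]> + w * (2%:P * a + 'X * b + b).<[u]>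
     + (rho%:P * b).<[u]>.
    rewrite mulrDr !mulrA uvE uwE !(rmorphD, rmorphM) /= !horner_algX !horner_algC.
    rewrite [(_ + rho%:A) * _]mulrDl !mulr_algl !mulr2n ?scale1r.
    move: (rho *: _) => x1; ncring.
  rewrite mulrDr e1 mulr_algl !(rmorphD, rmorphM) /= !horner_algC !mulr_algl -!scalerAr !mulrDr -!scalerAr scalerDr.
  move: (d *: _) => x1; move: (d *: _) => x2; move: (rho *: _) => x3; ncring.
rewrite evenoddD e2 comp_polyD comp_polyM comp_polyX comp_polyC /evenodd.
rewrite !(comp_polyD, comp_polyM, comp_polyX, comp_polyC); ring.
Qed.

Lemma nf_linear a b c : nf u v w (c%:P + 'X * a%:P) b%:P = c.<[u]> + v * a.<[u]> + w * b.<[u]>.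
Proof. by rewrite /nf evD evX !evC !mul1r. Qed.

(** The commutator [v,w^2] is computed by the derivation rule and from the
    relation for w^2. *)
Lemma compatibility_in_algebra :
  P.<[u]> * w + w * P.<[u]> + P.<[u]> * v + v * Q.<[u]> - Q.<[u]> * v = 0.
Proof.
have [uv uw vw ww] := rel.
have e : lie v w * w + w * lie v w =
    v ^+ 2 * lie v u + v * lie v w - (v * Q.<[u]> - Q.<[u]> * v).
  rewrite -/(lie v Q.<[u]>) -lieMr -expr2 ww lieBr !lieDr lieZr liexx scaler0 addr0.
  by rewrite !(expr2, lieMr, liexx, mul0r, mulr0, add0r).
have e' : lie v u = - (v + w *+ 2) by rewrite lieC uv.
have vvw : v * (v * w) - w * (v * v) = v * (P.<[u]> - v ^+ 2) + (P.<[u]> - v ^+ 2) * v.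
  by rewrite -vw /lie; ncring.
move: e; rewrite e' vw => /eqP; rewrite -subr_eq0 => /eqP <-.
apply/eqP; rewrite -subr_eq0; apply/eqP; apply: (eq0_of_sub (esym vvw)).
rewrite !expr2 mulr2n; ncring.
Qed.

(** Moving the polynomials in u to the right in the preceding identity gives,
    for the coefficients of v and w together, (x+1) P((x+1)^2) + Q(x^2) + x
    P(x^2) - Q((x+1)^2) = 0, where the first and last terms are those of
    evenodd Q P at -x-1. *)
Lemma compatibility : evenodd Q P \Po (- 'X - 1) = evenodd Q P.
Proof.
have [_ _ sg _] := rel.
have [a1 [b1 [c1 [e1 f1]]]] := horner_mul_vw P 1 1.
have [a2 [b2 [c2 [e2 f2]]]] := horner_mul_vw Q 1 0.
have E : nf u v w ((c1 - c2)%:P + 'X * (a1 + Q - a2)%:P) (b1 + P - b2)%:P = 0.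
  rewrite nf_linear -compatibility_in_algebra.
  move: e1 e2; rewrite !rmorph1 !rmorph0 mulr0 addr0 !mulr1 mulrDr => e1 e2.
  have -> : P.<[u]> * w + w * P.<[u]> + P.<[u]> * v + v * Q.<[u]> - Q.<[u]> * v =
    (P.<[u]> * v + P.<[u]> * w) + w * P.<[u]> + v * Q.<[u]> - Q.<[u]> * v by ncring.
  rewrite e1 e2 !(rmorphD, rmorphN) /=; ncring.
have [] := free E => p0 /eqP; rewrite polyC_eq0 => /eqP r0.
have [|_ q0 _] := @quadratic_free _ (c1 - c2) (a1 + Q - a2) 0.
  by rewrite mulr0 addr0.
have : evenodd (a1 + Q - a2) (b1 + P - b2) = 0.
  by rewrite q0 r0 /evenodd !comp_poly0 mulr0 addr0.
rewrite -!addrA !evenoddD f1.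
have -> : evenodd (- a2) (- b2) = - evenodd a2 b2.
  by rewrite /evenodd !(raddfN (comp_poly _)) /=; ring.
rewrite f2 /evenodd.
have -> : (1 : {poly C}) \Po 'X^2 = 1 by rewrite -polyC1 comp_polyC.
rewrite comp_poly0 mulr0 addr0 !mulr1 => h.
rewrite comp_polyD comp_polyM -!comp_polyA comp_polyX comp_Xn_poly.
have -> : (- 'X - 1 : {poly C}) ^+ 2 = ('X + 1) ^+ 2 by ring.
apply/eqP; rewrite -subr_eq0; apply/eqP; apply: (eq0_of_sub (esym h)); ring.
Qed.

End Compatibility.

(** * Recovering q from the parameters *)

Section Symmetric.
Variable C : numClosedFieldType.
Implicit Types p q F G P Q e : {poly C}.
Local Notation y := ('X + (2^-1)%:P : {poly C}).
Local Notation reflect p := (p \Po (- 'X - 1)).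

Lemma two_neq0 : (2 : C) != 0. Proof. by rewrite pnatr_eq0. Qed.

Lemma half_double : (2^-1 + 2^-1 : C) = 1. Proof. by field. Qed.

Lemma poly_one_halves : (1 : {poly C}) = (2^-1)%:P + (2^-1)%:P.
Proof. by rewrite -polyCD half_double. Qed.

Lemma reflect_y : reflect y = - y.
Proof.
rewrite comp_polyD comp_polyX comp_polyC opprD -addrA; congr (_ + _).
by rewrite {1}poly_one_halves opprD addrNK.
Qed.

(** In the variable x + 1/2 the reflection is the change of sign. *)
Lemma symmetric_poly F : reflect F = F -> exists e, F = e \Po y ^+ 2.
Proof.
move=> sF; pose H := F \Po ('X - (2^-1)%:P).
have Hy : H \Po y = F.
  by rewrite -comp_polyA comp_polyB comp_polyX comp_polyC addrK comp_polyXr.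
have Hm : H \Po (- 'X) = H.
  rewrite /H -comp_polyA comp_polyB comp_polyX comp_polyC -{2}sF -comp_polyA.
  congr (F \Po _); rewrite comp_polyB comp_polyC (raddfN (comp_poly _)) /= comp_polyX.
  by rewrite polyC1 poly_one_halves; ring.
have He := poly_even_odd H.
have [_ o0] : even_poly H = even_poly H /\ 2%:P * odd_poly H = 0.
  split=> //; have [|//] := @even_odd_free _ 0 (2%:P * odd_poly H).
  rewrite comp_poly0 add0r comp_polyM comp_polyC.
  apply: (eq0_of_sub (esym Hm)); rewrite -[X in _ = X - _]He -[X in X \Po - 'X]He !(comp_polyD, comp_polyM) -!comp_polyA.
  rewrite comp_polyX !comp_Xn_poly sqrrN; ring.
move/eqP: o0; rewrite mulf_eq0 polyC_eq0 (negPf two_neq0) => /eqP o0.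
by exists (even_poly H); rewrite -[LHS]Hy -[X in X \Po _ = _]He o0 comp_poly0 mul0r addr0 -comp_polyA comp_Xn_poly.
Qed.

(** With y = x + 1/2, each factor y^2 - t splits as (y - s)(y + s) where s^2 =
    t, and the reflection takes y - s to -(y + s). *)
Lemma symmetric_product (r : seq C) (c : C) :
  exists q, q * reflect q = c *: (\prod_(t <- r) ('X - t%:P) \Po y ^+ 2).
Proof.
elim: r c => [|t r IH] c.
  exists (sqrtC c)%:P; rewrite big_nil comp_polyC -polyCM -expr2 sqrtCK.
  by rewrite -[in RHS]polyC1 comp_polyC -mul_polyC mulr1.
have [q qE] := IH (- c); exists (q * (y - (sqrtC t)%:P)).
rewrite big_cons !comp_polyM comp_polyB comp_polyC reflect_y mulrACA qE.
have tE : t%:P = (sqrtC t)%:P ^+ 2 by rewrite -rmorphXn /= sqrtCK.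
rewrite comp_polyB comp_polyX comp_polyC tE -!mul_polyC polyCN; ring.
Qed.

Lemma reflectC (c : C) : reflect c%:P = c%:P.
Proof. exact: comp_polyC. Qed.

Local Notation lin := (1 + 2%:P * 'X : {poly C}).

Lemma reflect_linear : reflect lin = - lin.
Proof.
rewrite comp_polyD comp_polyM reflectC comp_polyX -[in LHS]polyC1 reflectC.
by rewrite !polyCMn polyC1; ring.
Qed.

Lemma reflect_linear_sqr : reflect (lin ^+ 2) = lin ^+ 2.
Proof.
by rewrite expr2 [LHS]comp_polyM reflect_linear mulrNN.
Qed.

Lemma size_linear : size (1 + 2%:P * 'X : {poly C}) = 2%N.
Proof.
by rewrite addrC -polyC1 -cons_poly_def size_cons_poly /nilp size_polyC two_neq0.
Qed.

Lemma linear_neq0 : lin != 0.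
Proof. by rewrite -size_poly_eq0 size_linear. Qed.

Lemma size_linear_sqrM p : p != 0 -> size (lin ^+ 2 * p) = (size p).+2.
Proof.
move=> p0; rewrite expr2 -mulrA !size_mul ?mulf_neq0 ?linear_neq0 // size_linear.
by rewrite !addSn.
Qed.

Lemma reflect_reflect : reflect ((- 'X - 1) : {poly C}) = 'X.
Proof.
rewrite comp_polyD !(raddfN (comp_poly _)) /= comp_polyX -polyC1 comp_polyC; ring.
Qed.

Lemma size_reflect q : size (reflect q) = size q.
Proof.
apply: size_comp_poly2; rewrite -opprD size_polyN -polyC1.
by rewrite -[1%:P]opprK -polyCN size_XsubC.
Qed.

Lemma size_mul_reflect q : size (q * reflect q) = (2 * size q).-1.
Proof.
have [->|q0] := eqVneq q 0; first by rewrite mul0r size_poly0.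
by rewrite size_mul // -?size_poly_eq0 size_reflect ?size_poly_eq0 // mul2n addnn.
Qed.

Lemma horner_linear : lin.[- 2^-1] = 0.
Proof.
by rewrite hornerD hornerM -polyC1 !hornerC hornerX mulrN mulfV ?two_neq0 // subrr.
Qed.

Lemma horner_mul_reflect q :
  (4%:P * (q * reflect q)).[- 2^-1] = Dq_rho q ^+ 2.
Proof.
rewrite !hornerM hornerC horner_comp hornerD !hornerN hornerX -polyC1 hornerC.
have -> : - - 2^-1 - 1 = - 2^-1 :> C by field.
by rewrite /Dq_rho; ring.
Qed.

Lemma size_comp_square p : size (p \Po 'X^2) = (2 * size p).-1.
Proof.
have [->|p0] := eqVneq p 0; first by rewrite comp_poly0 size_poly0.
have := size_comp_poly p 'X^2; rewrite size_polyXn /=.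
have : p \Po 'X^2 != 0.
  by apply: contraNneq p0 => e; rewrite -(@comp_poly_eq0 _ p 'X^2) ?e // size_polyXn.
rewrite -size_poly_gt0; move: p0; rewrite -size_poly_gt0.
by move: (size p) (size (p \Po _)) => i j; lia.
Qed.

(** The right-hand side is invariant under the reflection, hence a polynomial
    in (x+1/2)^2 that splits into symmetric factors. At -1/2 both sides are
    squares, so the value of q there is right up to sign. *)
Lemma q_of_parameters n rho P Q : (4 <= n)%N -> (size P <= n.-1)%N -> size Q = n ->
  reflect (evenodd Q P) = evenodd Q P ->
  exists q, [/\ size q = n.+1, Dq_rho q = rho &
    4%:P * (q * reflect q) = (rho ^+ 2)%:P + (1 + 2%:P * 'X) ^+ 2 * evenodd Q P].
Proof.
move=> n4 sP sQ sG; pose F := (rho ^+ 2)%:P + (1 + 2%:P * 'X) ^+ 2 * evenodd Q P.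
have sF : reflect F = F.
  by rewrite /F comp_polyD reflectC comp_polyM reflect_linear_sqr sG.
have sizeG : size (evenodd Q P) = (2 * n).-1.
  rewrite /evenodd size_polyDl size_comp_square sQ //.
  apply: leq_ltn_trans (size_polyMleq _ _) _; rewrite size_polyX size_comp_square.
  by move: sP; case: (size P) => [|m]; lia.
have sizeF : size F = (2 * n).+1.
  have G0 : evenodd Q P != 0 by rewrite -size_poly_eq0 sizeG; lia.
  have sM : size ((1 + 2%:P * 'X) ^+ 2 * evenodd Q P) = (2 * n).+1.
    by rewrite size_linear_sqrM // sizeG; lia.
  rewrite /F addrC size_polyDl sM //.
  by apply: leq_ltn_trans (size_polyC_leq1 _) _; lia.
have [e Fe] := symmetric_poly sF.
have [r er] := closed_field_poly_normal e.
have [q qE] := symmetric_product r (4^-1 * lead_coef e).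
have four0 : (4 : C) != 0 by rewrite pnatr_eq0.
have qF : 4%:P * (q * reflect q) = F.
  rewrite qE Fe er lead_coefZ (monicP (monic_prod_XsubC _ _ _)) mulr1.
  by rewrite comp_polyZ -!mul_polyC mulrA -polyCM mulVKf.
have size_q : size q = n.+1.
  have := size_mul_reflect q; rewrite -(size_Cmul (q * _) four0) qF sizeF; lia.
(* The factor 1 + 2x vanishes at -1/2. *)
have q2 : (Dq_rho q) ^+ 2 = rho ^+ 2.
  have := congr1 (fun p => p.[- 2^-1]) qF.
  rewrite horner_mul_reflect => ->.
  by rewrite /F hornerD hornerC hornerM horner_exp horner_linear expr0n mul0r addr0.
have : (Dq_rho q == rho) || (Dq_rho q == - rho) by rewrite -eqf_sqr q2.
case/orP=> /eqP rE; first by exists q; split.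
exists (- q); split; first by rewrite size_polyN.
  by rewrite /Dq_rho hornerN mulrN -[2 * _]/(Dq_rho q) rE opprK.
by rewrite (raddfN (comp_poly _)) mulrNN.
Qed.

(** Written in terms of y^2 = (x+1/2)^2, the left-hand side has constant term
    rho^2, its value at -1/2; the remainder is divisible by 4 y^2 = (1+2x)^2.
    *)
Lemma parameters_of_q n q : size q = n.+1 -> (0 < n)%N ->
  exists P Q, [/\ (size P <= n.-1)%N, (size Q <= n)%N &
    4%:P * (q * reflect q) =
      (Dq_rho q ^+ 2)%:P + (1 + 2%:P * 'X) ^+ 2 * evenodd Q P].
Proof.
move=> sq n0; pose F := 4%:P * (q * reflect q).
have sF : reflect F = F.
  rewrite /F !comp_polyM reflectC -comp_polyA; congr (_ * _).
  rewrite reflect_reflect.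
  by rewrite comp_polyXr mulrC.
have [e Fe] := symmetric_poly sF.
pose e1 := drop_poly 1 e.
have eE : e = (e.[0])%:P + e1 * 'X.
  rewrite -[LHS](poly_take_drop 1) horner_coef0; congr (_ + _).
  apply/polyP=> -[|i]; rewrite coef_take_poly coefC //=.
have linE : lin = 2%:P * y.
  by rewrite mulrDr -polyCM mulfV ?two_neq0 // addrC.
have rhoE : e.[0] = Dq_rho q ^+ 2.
  have := congr1 (fun p => p.[- 2^-1]) Fe.
  rewrite horner_comp horner_exp hornerD hornerX hornerC addNr expr0n /= => <-.
  by rewrite horner_mul_reflect.
pose G := 4^-1 *: (e1 \Po y ^+ 2).
have FG : F = (Dq_rho q ^+ 2)%:P + lin ^+ 2 * G.
  rewrite Fe eE comp_polyD comp_polyC rhoE comp_polyM comp_polyX linE; congr (_ + _).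
  have four : (2%:P ^+ 2) * (4^-1)%:P = 1 :> {poly C}.
    by rewrite -rmorphXn -polyCM /= -polyC1; congr _%:P; field.
  rewrite /G -mul_polyC [in RHS]exprMn [in RHS]mulrACA four mul1r mulrC //.
have sG : (size G <= (2 * n).-1)%N.
  have sF2 : (size (F - (Dq_rho q ^+ 2)%:P)%R <= (2 * n).+1)%N.
    apply: leq_trans (size_polyD _ _) _; rewrite geq_max size_polyN.
    rewrite (leq_trans (size_polyC_leq1 _)) ?andbT //.
    by rewrite /F size_Cmul ?pnatr_eq0 // size_mul_reflect sq mulnS.
  move: sF2; rewrite FG addrC addKr.
  have [->|G0] := eqVneq G 0; first by rewrite size_poly0.
  by rewrite size_linear_sqrM //; move: (size G) => k; lia.
exists (odd_poly G), (even_poly G); split.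
- apply/leq_sizeP => j hj; rewrite coef_odd_poly nth_default //.
  by apply: leq_trans sG _; lia.
- apply/leq_sizeP => j hj; rewrite coef_even_poly nth_default //.
  by apply: leq_trans sG _; lia.
have GE : evenodd (even_poly G) (odd_poly G) = G.
  by rewrite -[RHS]poly_even_odd /evenodd mulrC.
by rewrite GE -FG.
Qed.

End Symmetric.

(** * Classification *)

Local Notation reflect p := (p \Po (- 'X - 1)).

Section Presentations.
Variable C : fieldType.

Lemma Drel_embedding (A B : algType C) (f : {lrmorphism A -> B}) rho P Q u v w :
  injective f -> Drel rho P Q (f u) (f v) (f w) <-> Drel rho P Q u v w.
Proof.
move=> fi; have fl x y : lie (f x) (f y) = f (lie x y).
  by rewrite /lie rmorphB /= !rmorphM.
have e1 : f v + f w *+ 2 = f (v + w *+ 2) by rewrite rmorphD /= rmorphMn.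
have e2 : (f v * f u) *+ 2 + f w + rho%:A = f ((v * u) *+ 2 + w + rho%:A).
  by rewrite !mulr2n !rmorphD /= !rmorphM /= linearZ /= rmorph1.
have e3 : P.<[f u]> - f v ^+ 2 = f (P.<[u]> - v ^+ 2).
  by rewrite rmorphB /= rmorphXn /= horner_alg_morph.
have e4 : f v ^+ 2 * f u + f v * f w + rho *: f v - Q.<[f u]> =
    f (v ^+ 2 * u + v * w + rho *: v - Q.<[u]>).
  by rewrite !expr2 rmorphB !rmorphD /= !rmorphM /= linearZ /= horner_alg_morph.
rewrite /Drel !fl e1 e2 e3 e4 -rmorphXn.
by split=> -[h1 h2 h3 h4]; split; by [apply: fi | rewrite (h1, h2, h3, h4)].
Qed.

Lemma Drel_Dalg (q P Q : {poly C}) : (2 : C) != 0 ->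
  4%:P * (q * reflect q) =
    (Dq_rho q ^+ 2)%:P + (1 + 2%:P * 'X) ^+ 2 * evenodd Q P ->
  Drel (Dq_rho q) P Q (Du q) (Dv q) (Dw q).
Proof.
move=> two e; apply/(Drel_embedding (f := @Dval C q)); first exact: Dval_inj.
exact: Drel_skew.
Qed.

Lemma horner_algZ (A : algType C) (u : A) c (p : {poly C}) :
  (c *: p).<[u]> = c *: p.<[u]>.
Proof. by rewrite linearZ /= mulr_algl. Qed.

(** The scalar theta of the classification arises from this scaling of v and
    w. *)
Lemma Drel_scale (A : algType C) rho P Q (u v w : A) c : Drel rho P Q u v w ->
  Drel (c * rho) (c ^+ 2 *: P) (c ^+ 2 *: Q) u (c *: v) (c *: w).
Proof.
move=> [h1 h2 h3 h4]; split.
- by rewrite lieZr h1 scalerDr -scalerMnr.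
- by rewrite lieZr h2 !mulr2n !scalerDr scalerAl scalerA.
- by rewrite lieZl lieZr h3 scalerA -expr2 exprZn horner_algZ scalerBr.
- rewrite !exprZn h4 scalerBr !scalerDr horner_algZ -!scalerAl -!scalerAr.
  by rewrite !scalerA expr2 mulrAC.
Qed.

Lemma coordinates_scale n (A : filtAlg C) (u v w : A) eps c : (4 <= n)%N ->
  coordinates n u v w -> reduced n u v w eps -> c != 0 ->
  coordinates n u (c *: v) (c *: w).
Proof.
move=> n4 [free fA] red c0; have one0 : (1 : C) != 0 := oner_neq0 _.
have [hu hv hw] : [/\ weight_filt n u v w 1 (u - 1 *: u),
    weight_filt n u v w (n%:Z - 3) (c *: v - c *: v) &
    weight_filt n u v w (n%:Z - 2) (c *: w - c *: w)].
  by rewrite scale1r !subrr; split; apply: Wfilt0.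
split; first exact: (perturb_nf_free n4 red free one0 c0 c0 hu hv hw).
by move=> k x; rewrite fA (perturb_wfilt n4 one0 c0 c0 hu hv hw).
Qed.

End Presentations.

(** The first two relations with w eliminated. *)
Lemma lie_u_lie_uv (C : fieldType) (A : algType C) rho P Q (u v w : A) :
  Drel rho P Q u v w ->
  lie u (lie u v) = 4 *: (v * u) + 2 *: lie u v - v + (2 * rho)%:A.
Proof.
move=> [h1 h2 _ _]; rewrite {1}h1 mulr2n !lieDr h2 h1.
rewrite -[(2 * rho)%:A]scalerA !scaler_nat !(mulrS, mulr0n).
move: (rho%:A) => x; ncring.
Qed.

Lemma lie_u_lie_uv_nf (C : fieldType) (A : algType C) rho P Q (u v w : A) :
  Drel rho P Q u v w -> lie u (lie u v) =
  nf u v w ((2 * rho)%:P%:P + 'X * (4%:P * 'X + 1)%:P) 4%:P%:P.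
Proof.
move=> rel; rewrite (lie_u_lie_uv rel); have [-> _ _ _] := rel.
have -> : nf u v w ((2 * rho)%:P%:P + 'X * (4%:P * 'X + 1)%:P) 4%:P%:P =
    (2 * rho)%:A + v * (4 *: u + 1) + 4 *: w.
  by rewrite nf_linear mul_polyC rmorphD rmorph1 /= horner_algZ horner_algX !horner_algC mulr_algr.
move: ((2 * rho)%:A) => x; rewrite !scaler_nat !(mulrS, mulr0n); ncring.
Qed.

Section Rigidity.
Variables (C : fieldType) (n : nat).
Hypothesis n5 : (5 <= n)%N.
Hypothesis two : (2 : C) != 0.
Variables (A : algType C) (u v w u1 v1 w1 : A).
Variables (rho rho' : C) (P Q P' Q' : {poly C}).
Hypothesis rel : Drel rho P Q u v w.
Hypothesis rel1 : Drel rho' P' Q' u1 v1 w1.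
Hypothesis free : nf_free u v w.
Hypothesis u1_le : nf_le n u v w 2 u1.
Hypothesis v1_le : nf_le n u v w (n%:Z - 2) v1.
Hypothesis uv1 : lie u1 v1 != 0.

(** As n >= 5, the weights of v and w exceed 2. *)
Lemma weight_two_shape : exists a b, u1 = a *: u + b%:A.
Proof.
have [p [r [-> hp hr]]] := u1_le.
have -> : r = 0 by apply: wle_lt0 hr; lia.
have -> : p = (p`_0`_1 *: 'X + (p`_0`_0)%:P)%:P.
  apply/polyP => j; apply/polyP => i; rewrite coefC.
  case: j => [|j] /=; last by rewrite coef0; apply: hp; nia.
  rewrite coefD coefZ coefX coefC.
  case: i => [|[|i]]; rewrite /= ?mulr0 ?mulr1 ?addr0 ?add0r //.
  by apply: hp; lia.
exists p`_0`_1, p`_0`_0; rewrite nf_horner rmorphD /=.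
by rewrite horner_algZ horner_algX horner_algC.
Qed.

Lemma weight_v_shape : exists c p, v1 = c *: v + p.<[u]>.
Proof.
have [p [r [-> hp hr]]] := v1_le.
have -> : r = 0 by apply: wle_lt0 hr; lia.
have n4 : (4 <= n)%N by lia.
rewrite (linear_shape n4 hp); exists p`_1`_0, p`_0.
by rewrite -polyC0 nf_linear horner_algC rmorph0 mulr0 addr0 mulr_algr addrC.
Qed.

(** The relation [u,[u,v]] = 4vu + 2[u,v] - v + 2 rho holds for both sets of
    generators. Substituting u1 = a u + b and v1 = c v + p(u), the coefficient
    of w gives a = 1, then that of v gives b = 0; the remaining terms say that
    (4u - 1) p(u) is a constant, so p = 0. *)
Lemma coordinate_change : exists c, [/\ c != 0, u1 = u, v1 = c *: v, w1 = c *: w & rho' = c * rho].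
Proof.
have [a [b u1E]] := weight_two_shape; have [c [p v1E]] := weight_v_shape.
have lE x : lie u1 x = a *: lie u x by rewrite u1E lieDl !lieZl lie1l scaler0 addr0.
have uvE : lie u1 v1 = (a * c) *: lie u v.
  by rewrite lE v1E lieDr lie_horner lieZr addr0 scalerA.
have ac0 : a * c != 0 by apply: contraNneq uv1 => ac0; rewrite uvE ac0 scale0r.
have [a0 c0] : a != 0 /\ c != 0 by apply/andP; rewrite -negb_or -mulf_eq0.
have [uv _ _ _] := rel.
have v1u1 : v1 * u1 = nf u v w ((p * (a *: 'X + b%:P))%:P + 'X * (c *: (a *: 'X + b%:P))%:P) 0.
  have u1p : (a *: 'X + b%:P).<[u]> = u1.
    by rewrite rmorphD /= horner_algZ horner_algX horner_algC.
  rewrite -polyC0 nf_linear rmorph0 mulr0 addr0 horner_algZ rmorphM /= u1p.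
  by rewrite -scalerAr scalerAl -mulrDl v1E addrC.
have v1nf : v1 = nf u v w (p%:P + 'X * c%:P%:P) 0.
  by rewrite -polyC0 nf_linear rmorph0 mulr0 addr0 horner_algC mulr_algr v1E addrC.
have e := lie_u_lie_uv rel1.
rewrite {1}uvE lE lieZr (lie_u_lie_uv_nf rel) uvE v1u1 v1nf -(nf_uv uv) -(nf_const u v w) in e.
rewrite -!nfZ -!nfD -!nfB -!nfD in e; have [ep er] := nf_inj free e.
have four : (4 : C) != 0 by rewrite (natrM C 2 2) mulf_neq0.
have a1 : a = 1.
  move: er; rewrite mulr0 subr0 addr0 add0r -!polyCM => /polyC_inj/polyC_inj er.
  have ac4 : a * c * 4 != 0 by rewrite mulf_neq0.
  apply: (mulIf ac4); rewrite er; ring.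
move: u1E uvE ep; rewrite {}a1 !scale1r mul1r => u1E uvE ep {e er lE v1u1 v1nf}.
have [] := @quadratic_free _ ((2 * c * rho)%:P - 4%:P * (p * ('X + b%:P)) + p - (2 * rho')%:P)
  (- (4 * (c * b)))%:P 0.
  apply: (eq0_of_sub ep); rewrite -mul_polyC !(polyCD, polyCM, polyCN); ring.
move=> p0 /eqP; rewrite polyC_eq0 oppr_eq0 !mulf_eq0 (negPf four) (negPf c0) => /eqP b0 _.
have pX : p * (4%:P * 'X - 1) = (2 * c * rho - 2 * rho')%:P.
  apply/eqP; rewrite -subr_eq0 -oppr_eq0 -p0 b0 !(polyCD, polyCM, polyCN); apply/eqP; ring.
have p00 : p = 0.
  apply/eqP; apply: contraT => pn0; have := size_polyC_leq1 (2 * c * rho - 2 * rho').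
  have s2 : size (4%:P * 'X - 1 : {poly C}) = 2%N.
    by rewrite -polyC1 -polyCN -cons_poly_def size_cons_poly /nilp size_polyC four.
  rewrite -pX size_mul //; last by rewrite -size_poly_eq0 s2.
  by rewrite s2 addn2 /= ltnS leqNgt size_poly_gt0 pn0.
have r : rho' = c * rho.
  move: pX; rewrite p00 mul0r => /esym/eqP; rewrite polyC_eq0 subr_eq0 -mulrA.
  by move/eqP/(mulfI two).
have u1u : u1 = u by rewrite u1E b0 scale0r addr0.
have v1v : v1 = c *: v by rewrite v1E p00 rmorph0 addr0.
exists c; split=> //.
have [uv1' _ _ _] := rel1.
apply: (scalerI two); rewrite !scaler_nat; apply: (addrI v1); rewrite -uv1' uvE uv.
by rewrite v1v scalerDr scalerMnr.
Qed.

Lemma rigidity : exists c, [/\ c != 0, rho' = c * rho, P' = c ^+ 2 *: P & Q' = c ^+ 2 *: Q].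
Proof.
have [c [c0 eu ev ew er]] := coordinate_change; exists c.
have [_ _ h3 h4] := Drel_scale c rel.
have [_ _ h3' h4'] := rel1.
have hP : P'.<[u]> = (c ^+ 2 *: P).<[u]>.
  by apply: (addIr (- (c *: v) ^+ 2)); rewrite -h3 -{1}eu -{1}ev -h3' ev ew.
have hQ : Q'.<[u]> = (c ^+ 2 *: Q).<[u]>.
  apply: oppr_inj; apply: (addrI ((c *: v) ^+ 2 * u + (c *: v) * (c *: w) + (c * rho) *: (c *: v))).
  by rewrite -h4 -er -ev -ew -eu -h4'.
split=> //; apply: polyC_inj.
  by move: hP; rewrite -!(nf_horner u v w) => /(nf_inj free) [].
by move: hQ; rewrite -!(nf_horner u v w) => /(nf_inj free) [].
Qed.

End Rigidity.

Section Classification.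
Variable C : numClosedFieldType.
Local Notation two := (two_neq0 C).

Lemma size_of_weight_bound (P : {poly C}) n : (4 <= n)%N ->
  (forall i : nat, 2 * n%:Z - 4 < 2 * i%:Z -> P`_i = 0) -> (size P <= n.-1)%N.
Proof. by move=> n4 h; apply/leq_sizeP => i hi; apply: h; lia. Qed.

(** If the generators commute, the commutator of any two elements has
    arbitrarily negative weight. *)
Lemma generators_noncommute n (A : filtAlg C) (u v w : A) :
  coordinates n u v w -> ~ (forall x y : A, x * y = y * x) -> (4 <= n)%N ->
  ~ [/\ lie u v = 0, lie u w = 0 & lie v w = 0].
Proof.
move=> [_ fA] nc n4 [uv uw vw]; apply: nc => x y.
have [i xi] := filt_exhaustive x; have [j yj] := filt_exhaustive y.
have n2 : (1 < n)%N by lia.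
(* The drop d is chosen so that the commutator of x and y gets weight -1. *)
pose d : int := i./2%:Z + j./2%:Z + 1.
have : weight_filt n u v w (i./2%:Z + j./2%:Z - d) (lie x y).
  by apply: wfilt_lie; rewrite ?uv ?uw ?vw; [apply: Wfilt0.. | apply/fA | apply/fA].
move/(wfilt_lt0 n2 _)=> h; apply/eqP; rewrite -subr_eq0; apply/eqP; apply: h.
rewrite /d; lia.
Qed.

(** The coefficient of u^(n-1) in Q is the scalar eps of the reduced relation;
    being nonzero, it fixes the degree of Q. *)
Lemma deformation_presentation n (A : filtAlg C) : (4 <= n)%N -> deformation n A ->
  ~ (forall x y : A, x * y = y * x) ->
  exists (rho : C) (P Q : {poly C}) (u v w : A), [/\ (size P <= n.-1)%N, size Q = n,
    coordinates n u v w & Drel rho P Q u v w].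
Proof.
move=> n4 dA nc; have [u [v [w [cA red]]]] := deformation_generators n4 dA.
have [free fA] := cA.
have sg : ((-1) ^+ n : C) != 0 by rewrite signr_eq0.
have [a a0 [huv huw]] :=
  noncommutative_leading n4 two sg red free (generators_noncommute cA nc n4).
have std : standard n ((-1) ^+ n) u v w by split.
have [u1 [v1 [w1 [e1 [std1 f1 uv1 uw1]]]]] := normalise_bracket_uv n4 two std a0 huv huw.
have [u2 [v2 [w2 [e2 [c [rho [std2 f2 uv2 uw2]]]]]]] := normalise_bracket_uw n4 two std1 uv1 uw1.
have [e20 red2 free2] := std2.
have [P [c1 vw2 hP]] := lie_vw_shape n4 two red2 free2 uv2 uw2.
have [Q [Qn sQ ww2]] := square_relation n4 two red2 free2 uv2 uw2 c1 vw2.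
exists rho, P, Q, u2, v2, w2; split.
- exact: size_of_weight_bound.
- apply/eqP; rewrite eqn_leq sQ /= leqNgt; apply/negP => sQn.
  by move: e20; rewrite -Qn nth_default ?eqxx //; case: (n) n4 sQn.
- by split=> // k x; rewrite fA f2 f1.
by split=> //; rewrite uw2 c1 scale1r.
Qed.

Lemma Dalg_generators n (q : {poly C}) : (4 <= n)%N -> size q = n.+1 ->
  coordinates n (Du q) (Dv q) (Dw q).
Proof.
move=> n4 sq; have := @Dalg_coordinates C q; rewrite sq; exact.
Qed.

Lemma deformation_is_Dalg n (A : filtAlg C) : (4 <= n)%N -> deformation n A ->
  ~ (forall x y : A, x * y = y * x) ->
  exists q : {poly C}, size q = n.+1 /\ filtered_iso A (Dalg q).
Proof.
move=> n4 dA nc; have [rho [P [Q [u [v [w [sP sQ cA rA]]]]]]] := deformation_presentation n4 dA nc.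
have [free _] := cA.
have [q [sq rE qE]] := q_of_parameters rho n4 sP sQ (compatibility rA free).
exists q; split=> //.
have sQ' : (size Q <= n)%N by rewrite sQ.
apply: (filtered_iso_of_Drel n4 sP sQ' cA (Dalg_generators n4 sq) rA).
by rewrite -rE; apply: Drel_Dalg; [exact: two | rewrite rE].
Qed.

(** The values at -1/2 give rho up to the sign of theta, and only theta^2
    enters the hypothesis. *)
Lemma iso_of_scale n (q q' : {poly C}) theta : (4 <= n)%N ->
  size q = n.+1 -> size q' = n.+1 -> theta != 0 ->
  q' * reflect q' = theta ^+ 2 *: (q * reflect q) -> filtered_iso (Dalg q) (Dalg q').
Proof.
move=> n4 sq sq' t0 e.
have n0 : (0 < n)%N by lia.
have [P [Q [sP sQ F]]] := parameters_of_q sq n0.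
have [P' [Q' [sP' sQ' F']]] := parameters_of_q sq' n0.
have FF : 4%:P * (q' * reflect q') = theta ^+ 2 *: (4%:P * (q * reflect q)).
  by rewrite e -!mul_polyC; ring.
have r2 : Dq_rho q' ^+ 2 = (theta * Dq_rho q) ^+ 2.
  by have := horner_mul_reflect q'; rewrite FF hornerZ horner_mul_reflect => <-; rewrite [in RHS]exprMn.
have [c [c0 c2 rE]] : exists c, [/\ c != 0, c ^+ 2 = theta ^+ 2 & Dq_rho q' = c * Dq_rho q].
  move/eqP: r2; rewrite eqf_sqr => /orP[/eqP r|/eqP r]; first by exists theta.
  by exists (- theta); rewrite oppr_eq0 sqrrN mulNr.
have [QE PE] : Q' = c ^+ 2 *: Q /\ P' = c ^+ 2 *: P.
  apply: evenodd_inj; have l0 := linear_neq0 C; have l2 := expf_neq0 2 l0.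
  apply: (mulfI l2); apply: (addrI (Dq_rho q' ^+ 2)%:P); rewrite -F' FF F -c2 rE.
  rewrite /evenodd !comp_polyZ -!mul_polyC exprMn !polyCM; ring.
have cD := Dalg_generators n4 sq; have rD := Drel_Dalg two F.
have red := Drel_reduced n4 sP sQ rD.
apply: (filtered_iso_of_Drel n4 sP' sQ' (coordinates_scale n4 cD red c0)
  (Dalg_generators n4 sq') _ (Drel_Dalg two F')).
by rewrite rE PE QE; apply: Drel_scale.
Qed.

(** The images of the generators satisfy the hypotheses of the rigidity lemma.
    *)
Lemma scale_of_iso n (q q' : {poly C}) : (5 <= n)%N ->
  size q = n.+1 -> size q' = n.+1 -> filtered_iso (Dalg q) (Dalg q') ->
  exists theta, theta != 0 /\
    q' * reflect q' = theta ^+ 2 *: (q * reflect q).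
Proof.
move=> n5 sq sq' [f [fb ff]].
have n4 : (4 <= n)%N by lia.
have n0 : (0 < n)%N by lia.
have [P [Q [sP sQ F]]] := parameters_of_q sq n0.
have [P' [Q' [sP' sQ' F']]] := parameters_of_q sq' n0.
have [free fA] := Dalg_generators n4 sq; have rD := Drel_Dalg two F.
have cD' := Dalg_generators n4 sq'; have rD' := Drel_Dalg two F'.
have [free' fA'] := cD'.
have rf : Drel (Dq_rho q) P Q (f (Du q)) (f (Dv q)) (f (Dw q)).
  by apply/Drel_embedding => //; apply: bij_inj.
have le k x : filt k x -> nf_le n (Du q') (Dv q') (Dw q') k./2%:Z (f x).
  by move=> kx; apply/(nf_exists n4 sP' sQ' cD' rD'); apply/ff.
have hu : nf_le n (Du q') (Dv q') (Dw q') 2 (f (Du q)).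
  by apply: (le 4); apply/fA; apply: wfilt_u.
have hv : nf_le n (Du q') (Dv q') (Dw q') (n%:Z - 2) (f (Dv q)).
  have -> : n%:Z - 2 = ((n - 2).*2)./2%:Z by rewrite doubleK; lia.
  apply: le; apply/fA; rewrite doubleK; apply: wfiltW (wfilt_v _ _ _ _); lia.
have nz : lie (f (Du q)) (f (Dv q)) != 0.
  have [-> _ _ _] := rf; rewrite -rmorphMn -rmorphD /=.
  apply/eqP; rewrite -(rmorph0 f) => /(bij_inj fb).
  have [uv _ _ _] := rD; rewrite -uv -(nf_uv uv) => /free [] /eqP.
  by rewrite polyX_eq0.
have [c [c0 rE PE QE]] := rigidity n5 two rD' rf free' hu hv nz.
exists c^-1; split; first by rewrite invr_eq0.
have e : 4%:P * (q * reflect q) = (c ^+ 2)%:P * (4%:P * (q' * reflect q')).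
  by rewrite F F' rE PE QE /evenodd !comp_polyZ -!mul_polyC exprMn !polyCM; ring.
apply: (scalerI (expf_neq0 2 c0)); rewrite scalerA -exprMn mulfV // expr1n scale1r.
have four : (4%:P : {poly C}) != 0 by rewrite polyC_eq0 pnatr_eq0.
by apply: (mulfI four); rewrite e -mul_polyC mulrCA.
Qed.

End Classification.

Theorem theorem5p2 (R : realType) :
  (forall n : nat, (4 <= n)%N ->
     forall A : filtAlg R[i], deformation n A ->
     ~ (forall x y : A, x * y = y * x) ->
     exists q : {poly R[i]}, size q = n.+1 /\ filtered_iso A (Dalg q))
  /\
  (forall n : nat, (5 <= n)%N ->
     forall q q' : {poly R[i]}, size q = n.+1 -> size q' = n.+1 ->
     filtered_iso (Dalg q) (Dalg q') <->
     exists theta : R[i], theta != 0 /\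
       q' * (q' \Po (- 'X - 1)) = theta ^+ 2 *: (q * (q \Po (- 'X - 1)))).
Proof.
split=> [n n4 A dA nc|n n5 q q' sq sq']; first exact: deformation_is_Dalg.
split=> [|[theta [t0 e]]]; first exact: scale_of_iso n5 sq sq'.
by apply: iso_of_scale sq sq' t0 e; apply: ltnW.
Qed.
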